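(* There exists an absolute constant $c>0$ such that the following holds. Suppose $V$ satisfies Assumption 1 (stated in the context) with constants $M,L,m>0$, and suppose $d\le\gamma n$, where $\gamma := c\bigl(\frac{m}{M}\wedge \frac{m^2}{L\sqrt{M}}\bigr)^2$. Let $f\in C^s$ with $s=k+1+\rho$ for some integer $k\ge0$ and some $\rho\in(0,1]$, and let $\sigma_f^2(\theta):=\langle\mathcal{I}^{-1}f'(\theta),f'(\theta)\rangle$. Then $$\sup_{\theta\in\mathbb{R}^d}\Bigl|\,\|f_k(\hat\theta)-f(\theta)\|_{L_2(\mathbb{P}_\theta)}-\frac{\sigma_f(\theta)}{\sqrt n}\Bigr|\le C\,\|f\|_{C^s}\Bigl[\sqrt{\frac{c(V)}{n}}\Bigl(\frac dn\Bigr)^{\rho/2}+\Bigl(\sqrt{\frac dn}\Bigr)^s\Bigr],$$ where $C>0$ depends only on $L,M,m,s$.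
   Context: Model. Let $n,d\ge 1$ be integers and let $V:\mathbb{R}^d\to\mathbb{R}$ be a (known) convex function with $\int e^{-V(x)}dx=1$. Put $P(dx)=e^{-V(x)}dx$ and $P_\theta(dx)=e^{-V(x-\theta)}dx$, $\theta\in\mathbb{R}^d$. Under $\mathbb{P}_\theta$, $X_1,\dots,X_n$ are i.i.d. with law $P_\theta$; $\xi$ denotes a random vector with law $P$. The maximum likelihood estimator is $\hat\theta:=\operatorname{argmin}_{\theta\in\mathbb{R}^d}\frac1n\sum_{j=1}^nV(X_j-\theta)$ (it exists and is unique when $V$ is strictly convex). $V',V''$ are the gradient and Hessian of $V$; $\mathcal{I}:=\mathbb{E}V'(\xi)\otimes V'(\xi)$ is the Fisher information matrix (under Assumption 1 it equals $\mathbb{E}V''(\xi)$). $\|\cdot\|$ is the Euclidean norm of vectors and the operator norm of matrices and multilinear forms; $a\wedge b=\min(a,b)$. Assumption 1 (constants $M,L,m>0$): (i) $V$ is strictly convex and twice continuously differentiable with $\|V''\|_{L_\infty}=\sup_x\|V''(x)\|\le M$ and $\|V''\|_{\rm Lip}=\sup_{x\ne y}\|V''(x)-V''(y)\|/\|x-y\|\le L$; (ii) $\mathcal{I}\succeq mI_d$. Poincaré constant: $c(V)$ is the smallest $C$ such that $\mathrm{Var}(g(\xi))\le C\,\mathbb{E}\|\nabla g(\xi)\|^2$ for all locally Lipschitz $g:\mathbb{R}^d\to\mathbb{R}$. Hölder norm: for $s=l+\rho$, $l\ge0$ an integer, $\rho\in(0,1]$, and $f:\mathbb{R}^d\to\mathbb{R}$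 that is $l$ times differentiable, $\|f\|_{C^s}:=\max_{0\le j\le l}\sup_x\|f^{(j)}(x)\|\vee\sup_{x\neq y}\frac{\|f^{(l)}(x)-f^{(l)}(y)\|}{\|x-y\|^\rho}$; $f\in C^s$ means this is finite. The functions $f_k$: for bounded $g$ on $\mathbb{R}^d$ let $(\mathcal{T}g)(\theta):=\mathbb{E}_\theta g(\hat\theta)$ and $(\mathcal{B}g)(\theta):=(\mathcal{T}g)(\theta)-g(\theta)$. Then $f_k:=\sum_{j=0}^k(-1)^j\mathcal{B}^jf$. *)

(* Defs.v *)
From HB Require Import structures.
From mathcomp Require Import all_boot all_order all_algebra.
From mathcomp Require Import all_classical all_reals all_analysis.
From mathcomp Require Import measurable_realfun.
Set Implicit Arguments. Unset Strict Implicit. Unset Printing Implicit Defensive.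
Import Order.TTheory GRing.Theory Num.Theory.
Import numFieldNormedType.Exports.
Local Open Scope classical_set_scope.
Local Open Scope ring_scope.

(* The Borel sigma-algebra of R^n = 'rV[R]_n, generated by the coordinates,
   as the library does for tuples. *)
Definition row_display : measure_display.
Proof. exact: default_measure_display. Qed.

Section row_measurable.
Context {R : realType} (n : nat).

Let coord (i : 'I_n) (v : 'rV[R]_n) : measurableTypeR R := v ord0 i.

Let row_set0 : g_sigma_preimage coord set0.
Proof. exact: sigma_algebra0. Qed.

Let row_setC A : g_sigma_preimage coord A -> g_sigma_preimage coord (~` A).
Proof. exact: sigma_algebraC. Qed.

Let row_bigcup (F : (set 'rV[R]_n)^nat) :
  (forall i, g_sigma_preimage coord (F i)) ->
  g_sigma_preimage coord (\bigcup_i (F i)).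
Proof. exact: sigma_algebra_bigcup. Qed.

HB.instance Definition _ :=
  @isMeasurable.Build row_display 'rV[R]_n
    (g_sigma_preimage coord) row_set0 row_setC row_bigcup.

Lemma measurable_coord (i : 'I_n) :
  measurable_fun [set: 'rV[R]_n]
    (fun v : 'rV[R]_n => v ord0 i : measurableTypeR R).
Proof.
move=> _ Y mY; rewrite setTI; apply: sub_sigma_algebra => /=.
rewrite -bigcup_seq/=; exists i => /=; first by rewrite mem_index_enum.
by exists Y => //; rewrite setTI.
Qed.

Lemma measurable_fun_row d (T : measurableType d) (f : T -> 'rV[R]_n) :
  (forall i, measurable_fun [set: T]
     (fun t => f t ord0 i : measurableTypeR R)) ->
  measurable_fun [set: T] f.
Proof.
move=> mf; have fS : g_sigma_preimage (fun i => coord i \o f) `<=` measurable.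
  apply: smallest_sub; first exact: sigma_algebra_measurable.
  rewrite -bigcup_seq => A [/= i _ [B mB <-]]; exact: mf.
move=> _ A mA; apply: fS; rewrite g_sigma_preimage_comp.
by exists A.
Qed.
End row_measurable.

Section lebesgue_row.
Context {R : realType}.

Section step.
Variables (n : nat) (mu : {sigma_finite_measure set 'rV[R]_n -> \bar R}).

Definition row_cons (p : measurableTypeR R * 'rV[R]_n) : 'rV[R]_n.+1 :=
  row_mx (p.1%:M : 'rV[R]_1) p.2.

Lemma measurable_row_cons : measurable_fun setT row_cons.
Proof.
apply: measurable_fun_row => i.
have [j ->|j ->] := split_ordP (i : 'I_(1 + n)).
  rewrite (_ : (fun _ => _) = fst); first exact: measurable_fst.
  apply/funext => t; rewrite /row_cons.
  by rewrite (@row_mxEl R 1 1 n t.1%:M t.2 ord0 j) mxE !ord1 eqxx mulr1n.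
rewrite (_ : (fun _ => _) = (fun v : 'rV[R]_n => v ord0 j) \o snd).
  by apply: measurableT_comp; [exact: measurable_coord|exact: measurable_snd].
by apply/funext => t; exact: (@row_mxEr R 1 1 n t.1%:M t.2 ord0 j).
Qed.


HB.instance Definition _ :=
  isMeasurableFun.Build _ _ _ _ row_cons measurable_row_cons.

(* The library only covers dimension one; Lebesgue measure on R^(n+1) is the
   image of the product of Lebesgue measures on R and R^n. *)
Definition lebesgue_row_step : set 'rV[R]_n.+1 -> \bar R :=
  pushforward (lebesgue_measure \x mu)%E row_cons.

Let step0 : lebesgue_row_step set0 = 0%E.
Proof. exact: measure0. Qed.

Let step_ge0 A : (0 <= lebesgue_row_step A)%E.
Proof. exact: measure_ge0. Qed.

Let step_sigma_additive : semi_sigma_additive lebesgue_row_step.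
Proof. exact: measure_semi_sigma_additive. Qed.

HB.instance Definition _ := isMeasure.Build _ _ _ lebesgue_row_step
  step0 step_ge0 step_sigma_additive.

Let row_uncons (v : 'rV[R]_n.+1) : measurableTypeR R * 'rV[R]_n :=
  (v ord0 ord0, \row_j v ord0 (lift ord0 j)).

Let row_consK : cancel row_cons row_uncons.
Proof.
move=> [x v]; congr pair.
  transitivity (row_cons (x, v) ord0 (@lshift 1 n ord0)).
    by congr (row_cons (x, v) _ _); exact: val_inj.
  by rewrite /row_cons (@row_mxEl R 1 1 n x%:M v) mxE eqxx mulr1n.
apply/rowP => j; rewrite mxE -(@row_mxEr R 1 1 n x%:M v ord0 j).
by congr (row_cons (x, v) _ _); exact: val_inj.
Qed.

Let measurable_row_uncons : measurable_fun setT row_uncons.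
Proof.
apply: measurable_fun_pair; first exact: measurable_coord.
apply: measurable_fun_row => i.
rewrite (_ : (fun _ => _) = (fun v : 'rV[R]_n.+1 => v ord0 (lift ord0 i))).
  exact: measurable_coord.
by apply/funext => v; rewrite mxE.
Qed.

Let step_sigma_finite : sigma_finite setT lebesgue_row_step.
Proof.
pose l : {sigma_finite_measure set (measurableTypeR R) -> \bar R} :=
  lebesgue_measure.
have /sigma_finiteP[F [TF ndF Foo]] := sigma_finiteT l.
have /sigma_finiteP[G [TG ndG Goo]] := sigma_finiteT mu.
exists (fun k => row_uncons @^-1` (F k `*` G k)).
  rewrite -preimage_bigcup (_ : \bigcup_k _ = setT) ?preimage_setT//.
  rewrite -subTset => -[x y] _.
  have [i _ Fix] : (\bigcup_i F i) x by rewrite -TF.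
  have [j _ Gjy] : (\bigcup_i G i) y by rewrite -TG.
  exists (maxn i j) => //; split.
  - by move: x Fix; exact/subsetPset/ndF/leq_maxl.
  - by move: y Gjy; exact/subsetPset/ndG/leq_maxr.
move=> k; have [mF Fk] := Foo k; have [mG Gk] := Goo k; split.
  rewrite -[X in measurable X]setTI; apply: measurable_row_uncons => //.
  exact: measurableX.
rewrite /lebesgue_row_step /pushforward -comp_preimage.
rewrite (_ : _ \o _ = id); last by apply/funext => p; exact: row_consK.
by rewrite preimage_id product_measure1E// lte_mul_pinfty// ge0_fin_numE.
Qed.

HB.instance Definition _ := Measure_isSigmaFinite.Build _ _ _
  lebesgue_row_step step_sigma_finite.

End step.

Fixpoint lebesgue_row n : {sigma_finite_measure set 'rV[R]_n -> \bar R} :=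
  if n is m.+1 then lebesgue_row_step (lebesgue_row m)
  else \d_(0 : 'rV[R]_0).

End lebesgue_row.
Arguments lebesgue_row : clear implicits.

Section euclidean.
Context {R : realType} {d : nat}.
Implicit Types (A : 'M[R]_d) (f : 'rV[R]_d -> R) (x y : 'rV[R]_d).

(* The library norm `|x| on 'rV[R]_d is the sup norm. *)
Definition enorm x : R := Num.sqrt (\sum_i x ord0 i ^+ 2).

(* x *m A^T is the row vector representing A applied to x. *)
Definition opnorm A : \bar R :=
  ereal_sup [set (enorm (x *m A^T))%:E | x in [set x | enorm x <= 1]].

Definition psd A : Prop := forall x, 0 <= (x *m A *m x^T) ord0 ord0.

Definition multilinear_norm j (T : j.-tuple 'rV[R]_d -> R) : \bar R :=
  ereal_sup [set `|T u|%:E |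
    u in [set u : j.-tuple 'rV[R]_d | forall i, enorm (tnth u i) <= 1]].

Definition gradient f x : 'rV[R]_d := \row_i 'D_(delta_mx ord0 i) f x.

Definition hessian f x : 'M[R]_d :=
  \matrix_(i, j) 'D_(delta_mx ord0 i) ('D_(delta_mx ord0 j) f) x.

(* The form f^(j)(x)[u_1, ..., u_j] = D_(u_1) ... D_(u_j) f (x). *)
Definition derivative_form j f x (u : j.-tuple 'rV[R]_d) : R :=
  foldr (fun v g => 'D_v g) f u x.

(* Frechet differentiability, iterated: in finite dimension f' is l times
   differentiable iff each of its components D_u f is. *)
Fixpoint times_differentiable l f : Prop :=
  if l is l'.+1 then
    (forall x, differentiable f x) /\
    (forall u, times_differentiable l' ('D_u f))
  else True.

(* The norm of C^s for s = l + rho. *)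
Definition holder_norm l (rho : R) f : \bar R :=
  Order.max
    (\big[Order.max/-oo%E]_(j < l.+1)
       ereal_sup [set multilinear_norm (derivative_form (j := j) f x)
                 | x in [set: 'rV[R]_d]])
    (ereal_sup [set (multilinear_norm (fun u : l.-tuple 'rV[R]_d =>
                       (derivative_form f p.1 u - derivative_form f p.2 u)%R)
                     * ((enorm (p.1 - p.2) `^ rho)^-1)%:E)%E
               | p in [set p : 'rV[R]_d * 'rV[R]_d | p.1 != p.2]]).

Definition in_holder l (rho : R) f : Prop :=
  times_differentiable l f /\ (holder_norm l rho f < +oo)%E.

Definition strictly_convex f : Prop :=
  forall x y (t : R), x != y -> 0 < t < 1 ->
    f (t *: x + (1 - t) *: y) < t * f x + (1 - t) * f y.

Definition locally_lipschitz f : Prop :=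
  forall x, exists2 U, nbhs x U &
    exists K : R, forall y z, U y -> U z -> `|f y - f z| <= K * enorm (y - z).

End euclidean.

Record potential (R : realType) (d : nat) := Potential {
  pot :> 'rV[R]_d -> R;
  pot_convex : convex_function (E := 'rV[R]_d) setT pot;
  (* implied by convexity, but used to turn e^(-V) dx into a measure *)
  pot_measurable : measurable_fun [set: 'rV[R]_d] pot;
  pot_normalized : (\int[lebesgue_row R d]_x (expR (- pot x))%:E = 1)%E
}.

Section gibbs.
Context {R : realType} {d : nat}.
Variable V : potential R d.
Local Open Scope ereal_scope.

Definition gibbs (A : set 'rV[R]_d) : \bar R :=
  \int[lebesgue_row R d]_(x in A) (expR (- V x))%:E.

Let measurable_density :
  measurable_fun [set: 'rV[R]_d] (fun x => (expR (- V x))%:E).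
Proof.
apply/measurable_EFinP; apply: measurableT_comp => //.
by apply: measurableT_comp => //; exact: pot_measurable.
Qed.

Let gibbs0 : gibbs set0 = 0.
Proof. exact: integral_set0. Qed.

Let gibbs_ge0 A : 0 <= gibbs A.
Proof. by apply: integral_ge0 => x _; rewrite lee_fin expR_ge0. Qed.

Let gibbs_sigma_additive : semi_sigma_additive gibbs.
Proof.
move=> F mF tF mUF; rewrite /gibbs ge0_integral_bigcup//.
  by apply: is_cvg_nneseries => k _ _; exact: gibbs_ge0.
exact: measurable_funTS.
Qed.

HB.instance Definition _ := isMeasure.Build _ _ _ gibbs
  gibbs0 gibbs_ge0 gibbs_sigma_additive.

Let gibbs_setT : gibbs setT = 1.
Proof. exact: pot_normalized. Qed.

HB.instance Definition _ := Measure_isProbability.Build _ _ _ gibbs gibbs_setT.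

End gibbs.

Section potential_constants.
Context {R : realType} {d : nat}.
Implicit Type V : potential R d.

Definition fisher V : 'M[R]_d :=
  \matrix_(i, j) fine 'E_(gibbs V)[fun x =>
    ((gradient V x)^T *m gradient V x) i j].

(* The gradient of a locally Lipschitz function exists almost everywhere by
   Rademacher's theorem; its value elsewhere is irrelevant. *)
Definition poincare V : \bar R :=
  ereal_inf [set C%:E | C in [set C : R | forall g : 'rV[R]_d -> R,
    locally_lipschitz g ->
    ('V_(gibbs V)[g] <=
      C%:E * 'E_(gibbs V)[fun x => (enorm (gradient g x) ^+ 2)%R])%E]].

Record assumption1 (M L m : R) V : Prop := Assumption1 {
  a1_strictly_convex : strictly_convex V;
  a1_twice_differentiable : times_differentiable 2 V;
  a1_continuous_hessian : continuous (hessian V);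
  a1_hessian_bounded :
    (ereal_sup [set opnorm (hessian V x) | x in [set: 'rV[R]_d]] <= M%:E)%E;
  a1_hessian_lipschitz :
    (ereal_sup [set opnorm (hessian V p.1 - hessian V p.2)
                      * ((enorm (p.1 - p.2))^-1)%:E
               | p in [set p : 'rV[R]_d * 'rV[R]_d | p.1 != p.2]] <= L%:E)%E;
  a1_fisher : psd (fisher V - m%:M)
}.

(* sigma_f(theta), the square root of <I^-1 f'(theta), f'(theta)> *)
Definition asymptotic_std V (f : 'rV[R]_d -> R) (theta : 'rV[R]_d) : R :=
  Num.sqrt ((gradient f theta *m invmx (fisher V) *m (gradient f theta)^T)
              ord0 ord0).

Definition mle n V (x : 'I_n -> 'rV[R]_d) : 'rV[R]_d :=
  xget 0 [set t | forall t',
    n%:R^-1 * \sum_(j < n) V (x j - t) <= n%:R^-1 * \sum_(j < n) V (x j - t')].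

End potential_constants.

Section location_model.
Context {R : realType} {n d : nat} {dO : measure_display}
  {Omega : measurableType dO}.
Variables (V : potential R d) (Pr : 'rV[R]_d -> probability Omega R)
  (X : 'I_n -> Omega -> 'rV[R]_d).

(* Under each Pr theta, X_1, ..., X_n are i.i.d. with density
   e^(-V(x - theta)); some of the B j may be setT, so that iid_independent
   covers all subfamilies. *)
Record iid_location_sample : Prop := IidLocationSample {
  iid_measurable : forall j, measurable_fun [set: Omega] (X j);
  iid_law : forall theta j (A : set 'rV[R]_d), measurable A ->
    Pr theta (X j @^-1` A) =
      (\int[lebesgue_row R d]_(x in A) (expR (- V (x - theta)%R))%:E)%E;
  iid_independent : forall theta (B : 'I_n -> set 'rV[R]_d),
    (forall j, measurable (B j)) ->
    Pr theta (\bigcap_(j in [set: 'I_n]) (X j @^-1` B j)) =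
      (\prod_(j < n) Pr theta (X j @^-1` B j))%E
}.

Definition mle_estimator (w : Omega) : 'rV[R]_d := mle V (fun j => X j w).

(* With T and B the operators g |-> E_theta g(mle) and T - id, f_k is the
   partial Neumann sum of (-1)^j B^j f. *)
Definition mle_mean (g : 'rV[R]_d -> R) (theta : 'rV[R]_d) : R :=
  fine 'E_(Pr theta)[fun w => g (mle_estimator w)].

Definition mle_bias (g : 'rV[R]_d -> R) (theta : 'rV[R]_d) : R :=
  mle_mean g theta - g theta.

Definition bias_reduced k (f : 'rV[R]_d -> R) (theta : 'rV[R]_d) : R :=
  \sum_(j < k.+1) (-1) ^+ j * iter j mle_bias f theta.

End location_model.

(* Main.v *)
Require Import Defs.
From HB Require Import structures.
From mathcomp Require Import all_boot all_order all_algebra.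
From mathcomp Require Import all_classical all_reals all_analysis.
From mathcomp Require Import measurable_realfun.
From mathcomp Require Import ring lra.
Set Implicit Arguments. Unset Strict Implicit. Unset Printing Implicit Defensive.
Import Order.TTheory GRing.Theory Num.Theory.
Import numFieldNormedType.Exports.
Local Open Scope classical_set_scope.
Local Open Scope ring_scope.

(** Write [T g theta = E g (theta + mle)] for a centred sample and let [Delta] be
    the square root of [d / n].  Newton-type steps [it_i] with the Fisher
    information in place of the empirical Hessian start from [it_0 = 0], are
    globally Lipschitz functions of the sample, and satisfy
    [|mle - it_i| <= C Z^(i+1)] on the event that [Z] is small, where [Z] measures
    the deviation of the empirical gradient and Hessian from their means and has
    moments [E Z^p <= C Delta^p].  Since [E it_1 = 0], the bias operator [T - 1]
    loses one derivative and gains a factor [Delta], and at the last step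
    [Delta^(1 + rho)]; the partial Neumann sum [f_k] therefore satisfies
    [|T f_k - f| <= C Delta^s].

    For the fluctuations, replace [mle] by [it_(k+1)] and subtract the linear part
    [<f_k' theta, it_1>], whose standard deviation is the main term up to the
    difference between [f_k'] and [f'].  The gradient of what remains in a single
    observation is at most [C (Z^rho + Z) / n], so the Efron-Stein inequality and the
    Poincare inequality in each observation bound its variance by
    [C c(V) / n * Delta^(2 rho)]. *)

(** * Euclidean geometry *)

(** The obstacle is that the estimator is controlled only while [Z] is small: elsewhere the
    empirical Hessian may degenerate, and no Lipschitz bound in the sample, as the Efron-Stein and
    Poincare inequalities require, is available. The Newton iterates involve only the fixed matrix
    [I^-1] and the Lipschitz gradient, so they are controlled everywhere. Off the good event
    [1 <= (Z / kappa)^p], so a bounded quantity is at most a multiple of any power of [Z], and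
    moments of [Z] suffice. The iterate of order [k + 1] is the first whose distance to the
    estimator, of order [Z^(k+2)], is at most of order [Delta^s] in mean square.

    The Hessian deviation is measured in the Frobenius norm, because its rows are averages of
    bounded vectors, for which moment bounds free of the dimension give [d / n] after summing over
    [d] rows. Passing from [f_k'] to [f'] in the linear part costs [Delta / sqrt n] without a factor
    [c(V)]; the lower bound [c(V) >= m / M^2], from the test function [D_u V], absorbs it. *)

Section dot_product.
Context {R : realType} {d : nat}.
Implicit Types (x y z : 'rV[R]_d) (A B : 'M[R]_d).

Definition dot x y : R := \sum_i x ord0 i * y ord0 i.

Lemma dotC x y : dot x y = dot y x.
Proof. by apply: eq_bigr => i _; rewrite mulrC. Qed.

Lemma dotDl x y z : dot (x + y) z = dot x z + dot y z.
Proof. by rewrite -big_split; apply: eq_bigr => i _; rewrite mxE mulrDl. Qed.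

Lemma dotZl a x y : dot (a *: x) y = a * dot x y.
Proof. by rewrite /dot big_distrr; apply: eq_bigr => i _; rewrite mxE /= mulrA. Qed.

Lemma dotNl x y : dot (- x) y = - dot x y.
Proof. by rewrite -scaleN1r dotZl mulN1r. Qed.

Lemma dotBl x y z : dot (x - y) z = dot x z - dot y z.
Proof. by rewrite dotDl dotNl. Qed.

Lemma dot0l x : dot 0 x = 0.
Proof. by rewrite -(scale0r x) dotZl mul0r. Qed.

Lemma dotDr x y z : dot x (y + z) = dot x y + dot x z.
Proof. by rewrite !(dotC x) dotDl. Qed.

Lemma dotZr a x y : dot x (a *: y) = a * dot x y.
Proof. by rewrite !(dotC x) dotZl. Qed.

Lemma dotNr x y : dot x (- y) = - dot x y.
Proof. by rewrite !(dotC x) dotNl. Qed.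

Lemma dotBr x y z : dot x (y - z) = dot x y - dot x z.
Proof. by rewrite dotDr dotNr. Qed.

Lemma dot0r x : dot x 0 = 0.
Proof. by rewrite dotC dot0l. Qed.

Lemma dot_suml I (s : seq I) (P : pred I) (F : I -> 'rV[R]_d) y :
  dot (\sum_(i <- s | P i) F i) y = \sum_(i <- s | P i) dot (F i) y.
Proof.
elim/big_rec2 : _ => [|i a b _ <-]; first exact: dot0l.
by rewrite dotDl.
Qed.

Lemma dot_mulmx x A y : dot (x *m A) y = dot x (y *m A^T).
Proof.
rewrite /dot; under eq_bigr do rewrite mxE big_distrl/=.
rewrite exchange_big; apply: eq_bigr => i _; rewrite mxE big_distrr/=.
by apply: eq_bigr => j _; rewrite mxE; ring.
Qed.

Lemma dotE x y : (x *m y^T) ord0 ord0 = dot x y.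
Proof. by rewrite mxE; apply: eq_bigr => i _; rewrite mxE. Qed.

Lemma dot_delta i x : dot (delta_mx ord0 i) x = x ord0 i.
Proof.
rewrite /dot (bigD1 i)//= mxE !eqxx mul1r big1 ?addr0// => j ji.
by rewrite mxE (negPf ji) andbF mul0r.
Qed.

Lemma dotxx_ge0 x : 0 <= dot x x.
Proof. by apply: sumr_ge0 => i _; rewrite -expr2 sqr_ge0. Qed.

Lemma enormE x : enorm x = Num.sqrt (dot x x).
Proof. by rewrite /enorm; congr Num.sqrt; apply: eq_bigr => i _; rewrite expr2. Qed.

Lemma enorm_ge0 x : 0 <= enorm x. Proof. exact: sqrtr_ge0. Qed.

Lemma sqr_enorm x : enorm x ^+ 2 = dot x x.
Proof. by rewrite enormE sqr_sqrtr// dotxx_ge0. Qed.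

Lemma enorm_eq0 x : (enorm x == 0) = (x == 0).
Proof.
apply/eqP/eqP => [x0|->]; last by rewrite enormE dot0l sqrtr0.
have /eqP : dot x x = 0 by rewrite -sqr_enorm x0 expr0n.
rewrite psumr_eq0 => [/allP h|i _]; last by rewrite -expr2 sqr_ge0.
apply/rowP => i; have /h := mem_index_enum i.
by rewrite /= mulf_eq0 orbb mxE => /eqP.
Qed.

Lemma enorm0 : enorm (0 : 'rV[R]_d) = 0.
Proof. by apply/eqP; rewrite enorm_eq0. Qed.

Lemma cauchy_schwarz x y : `|dot x y| <= enorm x * enorm y.
Proof.
have [->|y0] := eqVneq y 0; first by rewrite dot0r normr0 mulr_ge0// enorm_ge0.
rewrite -(@ler_pXn2r _ 2)// ?nnegrE ?normr_ge0 ?mulr_ge0 ?enorm_ge0//.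
rewrite real_normK ?num_real// exprMn !sqr_enorm.
have yy : 0 < dot y y.
  by rewrite -sqr_enorm exprn_gt0// lt_def enorm_eq0 y0 enorm_ge0.
have := dotxx_ge0 (dot y y *: x - dot x y *: y).
rewrite !(dotBl, dotBr, dotZl, dotZr) (dotC y x) => h.
have : 0 <= dot y y * (dot x x * dot y y - dot x y ^+ 2) by move: h; nra.
by rewrite pmulr_rge0// subr_ge0.
Qed.

Lemma dot_le x y : dot x y <= enorm x * enorm y.
Proof. exact: le_trans (ler_norm _) (cauchy_schwarz x y). Qed.

Lemma enormZ a x : enorm (a *: x) = `|a| * enorm x.
Proof.
by rewrite !enormE dotZl dotZr mulrA -expr2 sqrtrM ?sqr_ge0// sqrtr_sqr.
Qed.

Lemma enormN x : enorm (- x) = enorm x.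
Proof. by rewrite -scaleN1r enormZ normrN1 mul1r. Qed.

Lemma enormB x y : enorm (x - y) = enorm (y - x).
Proof. by rewrite -opprB enormN. Qed.

Lemma enormD x y : enorm (x + y) <= enorm x + enorm y.
Proof.
rewrite -(@ler_pXn2r _ 2)// ?nnegrE ?addr_ge0 ?enorm_ge0//.
rewrite sqrrD !sqr_enorm dotDl !dotDr (dotC y x); have := dot_le x y; lra.
Qed.

Lemma enormD_le x y a b : enorm x <= a -> enorm y <= b -> enorm (x + y) <= a + b.
Proof. by move=> xa yb; apply: le_trans (enormD _ _) _; exact: lerD. Qed.

Lemma enorm_sum I (s : seq I) (P : pred I) (F : I -> 'rV[R]_d) :
  enorm (\sum_(i <- s | P i) F i) <= \sum_(i <- s | P i) enorm (F i).
Proof.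
elim/big_rec2 : _ => [|i a b _ h]; first by rewrite enorm0.
exact: enormD_le.
Qed.

Lemma coord_le_enorm x i : `|x ord0 i| <= enorm x.
Proof.
rewrite -dot_delta; apply: le_trans (cauchy_schwarz _ _) _.
by rewrite [enorm (delta_mx _ _)]enormE dot_delta mxE !eqxx sqrtr1 mul1r.
Qed.

Lemma enorm_delta i : enorm (delta_mx ord0 i : 'rV[R]_d) = 1.
Proof. by rewrite enormE dot_delta mxE !eqxx sqrtr1. Qed.

Lemma enorm_le_coord x : enorm x <= \sum_i `|x ord0 i|.
Proof.
rewrite [in X in X <= _](row_sum_delta x).
apply: le_trans (enorm_sum _ _ _) _; apply: ler_sum => i _.
by rewrite enormZ enorm_delta mulr1.
Qed.

Lemma normr_le_enorm x : `|x| <= enorm x.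
Proof.
have [x0|] := eqVneq (`|x|) 0; first by rewrite x0 enorm_ge0.
move=> /(@mx_norm_neq0 _ _ _ x)[[i j] /= h]; rewrite {1}/Num.norm/= h.
by rewrite (ord1 i) coord_le_enorm.
Qed.

Lemma coord_le_normr x i : `|x ord0 i| <= `|x|.
Proof.
rewrite /Num.norm/= mx_normE.
exact: (@le_bigmax _ _ _ 0%:nng (fun i : 'I_1 * 'I_d => `|x i.1 i.2|%:nng) (ord0, i)).
Qed.

Lemma enorm_le_normr x : enorm x <= d%:R * `|x|.
Proof.
apply: le_trans (enorm_le_coord x) _; rewrite -[d in d%:R]card_ord mulr_natl -sumr_const.
by apply: ler_sum => i _; exact: coord_le_normr.
Qed.

(** Take [y = x]. This reduces bounds on vectors to bounds on scalars, to which the mean value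
    theorem applies. *)
Lemma enorm_dual_le x (a : R) : 0 <= a ->
  (forall y, dot x y <= a * enorm y) -> enorm x <= a.
Proof.
move=> a0 h; have [->|x0] := eqVneq x 0; first by rewrite enorm0.
have := h x; rewrite -sqr_enorm expr2 ler_pM2r//.
by rewrite lt_def enorm_eq0 x0 enorm_ge0.
Qed.

(** The Frobenius norm. It dominates the operator norm, and its square is a sum over rows, so its
    moments follow from those of random vectors without matrix concentration. *)
Definition fnorm A : R := Num.sqrt (\sum_i \sum_j A i j ^+ 2).

Lemma fnorm_ge0 A : 0 <= fnorm A. Proof. exact: sqrtr_ge0. Qed.

Lemma sqr_fnorm A : fnorm A ^+ 2 = \sum_i enorm (row i A) ^+ 2.
Proof.
rewrite sqr_sqrtr; last first.
  by apply: sumr_ge0 => i _; apply: sumr_ge0 => j _; exact: sqr_ge0.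
apply: eq_bigr => i _; rewrite sqr_enorm; apply: eq_bigr => j _.
by rewrite mxE expr2.
Qed.

Lemma enorm_mulmx x A : enorm (x *m A) <= enorm x * fnorm A.
Proof.
apply: enorm_dual_le => [|y]; first by rewrite mulr_ge0 ?enorm_ge0 ?fnorm_ge0.
rewrite dot_mulmx; apply: le_trans (dot_le _ _) _.
rewrite -mulrA ler_wpM2l ?enorm_ge0//.
rewrite -(@ler_pXn2r _ 2)// ?nnegrE ?mulr_ge0 ?enorm_ge0 ?fnorm_ge0//.
rewrite exprMn sqr_fnorm big_distrl/= sqr_enorm; apply: ler_sum => i _.
rewrite -expr2 -real_normK ?num_real// -exprMn ler_pXn2r ?nnegrE ?mulr_ge0 ?enorm_ge0//.
have -> : (y *m A^T) ord0 i = dot (row i A) y.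
  by rewrite mxE; apply: eq_bigr => j _; rewrite !mxE mulrC.
exact: cauchy_schwarz.
Qed.

(** An operator and its adjoint have the same norm. This connects [opnorm], where a matrix acts by
    [x *m A^T], with the products [x *m A] used throughout. *)
Lemma enorm_mulmx_transpose A (a : R) : 0 <= a ->
  (forall x, enorm (x *m A^T) <= a * enorm x) ->
  forall x, enorm (x *m A) <= a * enorm x.
Proof.
move=> a0 h x; apply: enorm_dual_le => [|y]; first by rewrite mulr_ge0 ?enorm_ge0.
rewrite dot_mulmx; apply: le_trans (dot_le _ _) _.
by rewrite mulrAC [leRHS]mulrC ler_wpM2l ?enorm_ge0.
Qed.

Lemma opnorm_le A (a : R) : 0 <= a -> (opnorm A <= a%:E)%E ->
  forall x, enorm (x *m A) <= a * enorm x.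
Proof.
move=> a0 h; apply: enorm_mulmx_transpose => // x.
have [->|x0] := eqVneq x 0; first by rewrite mul0mx enorm0 mulr0.
have ex : 0 < enorm x by rewrite lt_def enorm_eq0 x0 enorm_ge0.
have : ((enorm (((enorm x)^-1 *: x) *m A^T))%:E <= opnorm A)%E.
  apply: ereal_sup_ubound; exists ((enorm x)^-1 *: x) => //=.
  by rewrite enormZ ger0_norm ?invr_ge0 ?enorm_ge0// mulVf ?gt_eqF.
move=> /le_trans /(_ h); rewrite lee_fin -scalemxAl enormZ ger0_norm ?invr_ge0 ?enorm_ge0//.
by rewrite ler_pdivrMl// mulrC.
Qed.

Lemma fnorm_le A (a : R) : (forall x, enorm (x *m A) <= a * enorm x) ->
  fnorm A ^+ 2 <= d%:R * a ^+ 2.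
Proof.
move=> h; rewrite sqr_fnorm -[d in d%:R]card_ord mulr_natl -sumr_const.
apply: ler_sum => i _; have := h (delta_mx ord0 i).
rewrite -rowE enorm_delta mulr1 => h1.
by rewrite ler_pXn2r ?nnegrE ?enorm_ge0// (le_trans _ h1) ?enorm_ge0.
Qed.

End dot_product.

(** * Inverses of positive definite matrices *)

Section positive_definite.
Context {R : realType} {d : nat}.
Variables (A : 'M[R]_d) (m : R).
Hypothesis m_gt0 : 0 < m.
Hypothesis Am : psd (A - m%:M).
Implicit Types x y : 'rV[R]_d.

Lemma psd_dot_ge x : m * enorm x ^+ 2 <= dot (x *m A) x.
Proof.
have := Am x; rewrite mulmxBr mul_mx_scalar mulmxBl mxE dotE mxE -scalemxAl mxE dotE.
by rewrite sqr_enorm subr_ge0.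
Qed.

Lemma psd_unitmx : A \in unitmx.
Proof.
rewrite -row_free_unit -kermx_eq0; apply/eqP/row_matrixP => i; rewrite row0.
apply/eqP; rewrite -enorm_eq0.
have := psd_dot_ge (row i (kermx A)); rewrite -row_mul mulmx_ker row0 dot0l.
rewrite pmulr_rle0// => h; have := sqr_ge0 (enorm (row i (kermx A))).
by move=> h2; rewrite -sqrf_eq0; apply/eqP/le_anti; rewrite h h2.
Qed.

(** For [y = x *m invmx A], coercivity and Cauchy-Schwarz give [m |y|^2 <= <x, y> <= |x| |y|]. *)
Lemma enorm_invmx x : enorm (x *m invmx A) <= m^-1 * enorm x.
Proof.
set y := x *m invmx A; have xE : x = y *m A by rewrite /y mulmxKV ?psd_unitmx.
have [y0|y0] := eqVneq y 0.
  by rewrite y0 enorm0 mulr_ge0 ?enorm_ge0// invr_ge0 ltW.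
have ey : 0 < enorm y by rewrite lt_def enorm_eq0 y0 enorm_ge0.
rewrite -ler_pdivrMl ?invr_gt0// invrK.
have := le_trans (psd_dot_ge y) (dot_le _ _); rewrite -xE.
by rewrite expr2 mulrA ler_pM2r.
Qed.

Lemma dot_invmx_ge0 x : 0 <= dot (x *m invmx A) x.
Proof.
set y := x *m invmx A; have -> : x = y *m A by rewrite /y mulmxKV ?psd_unitmx.
rewrite dotC; apply: le_trans (psd_dot_ge y).
by rewrite mulr_ge0 ?sqr_ge0 ?ltW.
Qed.

Lemma dot_invmx_le x : dot (x *m invmx A) x <= m^-1 * enorm x ^+ 2.
Proof.
apply: le_trans (dot_le _ _) _; rewrite expr2 mulrA ler_wpM2r ?enorm_ge0//.
exact: enorm_invmx.
Qed.

End positive_definite.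

(** * Differential calculus *)

Section directional_derivative.
Context {R : realType} {d : nat}.
Implicit Types (g : 'rV[R]_d -> R) (x y u v : 'rV[R]_d).

Lemma is_derive_line g x u (t : R) : differentiable g (x + t *: u) ->
  is_derive t 1 (fun s : R => g (x + s *: u)) ('D_u g (x + t *: u)).
Proof.
move=> dg; have dv := diff_derivable (v := u) dg.
have E : (fun h : R => h^-1 *: (((fun s : R => g (x + s *: u)) \o shift t) (h *: (1 : R)) - g (x + t *: u)))
   = (fun h : R => h^-1 *: ((g \o shift (x + t *: u)) (h *: u) - g (x + t *: u))).
  apply/funext => h /=; congr (_ *: (g _ - _)).
  by rewrite scalerDl [h *: 1]mulr1 addrCA.
by split; [rewrite /derivable E|rewrite /derive E].
Qed.

Lemma mean_value g x u : (forall y, differentiable g y) ->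
  exists2 t, 0 < t < 1 & g (x + u) - g x = 'D_u g (x + t *: u).
Proof.
move=> dg; have h (t : R) := is_derive_line (dg (x + t *: u)).
have hd (t : R) (_ : t \in `]0, 1[%R) := h t.
have hc : {within `[0, 1], continuous (fun s : R => g (x + s *: u))}.
  apply: continuous_subspaceT => t; apply: differentiable_continuous.
  apply/derivable1_diffP; exact: (@ex_derive _ _ _ _ _ _ _ (h t)).
have [t] := MVT ltr01 hd hc.
rewrite in_itv/= => t01; rewrite scale1r scale0r addr0 subr0 mulr1 => E.
by exists t.
Qed.

Lemma deriveZdir g x : differentiable g x ->
  forall a u, 'D_(a *: u) g x = a * 'D_u g x.
Proof. by move=> dg a u; rewrite !deriveE// linearZ. Qed.

Lemma deriveBdir g x : differentiable g x ->
  forall u v, 'D_(u - v) g x = 'D_u g x - 'D_v g x.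
Proof. by move=> dg u v; rewrite !deriveE// linearB. Qed.

Lemma derive_gradient g x u : differentiable g x -> 'D_u g x = dot (gradient g x) u.
Proof.
move=> dg; rewrite [in LHS](row_sum_delta u) deriveE// linear_sum.
by apply: eq_bigr => i _; rewrite linearZ/= -deriveE// mxE mulrC.
Qed.

(** A named map, so that [dot p] can carry the linear structure that a candidate for the
    differential must have. *)
Let dotl (p : 'rV[R]_d) : 'rV[R]_d -> R := dot p.

Let dotl_linear p : linear (dotl p).
Proof. by move=> a u v; rewrite /dotl dotDr dotZr. Qed.

HB.instance Definition _ p := GRing.isLinear.Build R 'rV[R]_d R _ (dotl p) (dotl_linear p).

(** A remainder of order [1 + a] is little-o of [u]. Since such remainders can be averaged and
    composed, this criterion replaces dominated convergence when expectations are differentiated. *)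
Lemma holder_differentiable g x p (K a : R) : 0 < a -> 0 <= K ->
  (forall u, `|g (x + u) - g x - dot p u| <= K * (enorm u * enorm u `^ a)) ->
  differentiable g x /\ forall u, 'D_u g x = dot p u.
Proof.
move=> a0 K0 h.
have lc : continuous (dotl p).
  apply/linear_bounded_continuous/linear_boundedP; near=> r => u; apply: le_trans (cauchy_schwarz _ _) _.
  apply: (@le_trans _ _ (enorm p * (d%:R * `|u|))).
    by rewrite ler_wpM2l ?enorm_ge0 ?enorm_le_normr.
  by rewrite mulrA ler_wpM2r//; near: r; exact: nbhs_pinfty_ge.
have E : (g : 'rV[R]_d -> R^o) \o shift x = cst (g x : R^o) + (dotl p : 'rV[R]_d -> R^o) +o_ (0 : 'rV[R]_d) id.
  apply/eqaddoP => e e0; near=> u; rewrite !fctE/=.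
  rewrite opprD addrA [u + x]addrC; apply: le_trans (h u) _.
  rewrite mulrA mulrAC.
  apply: (@le_trans _ _ (K * enorm u `^ a * (d%:R * `|u|))).
    by rewrite ler_wpM2l ?mulr_ge0 ?powR_ge0 ?enorm_le_normr.
  rewrite mulrA ler_wpM2r//.
  have c0 : 0 < (K + 1) * (d%:R + 1) by rewrite mulr_gt0// ltr_wpDl.
  (* On this radius [K |u|^a d] is at most [e]; the added 1s keep the denominator positive when [K]
     or [d] vanishes. *)
  have ud : enorm u <= (e / ((K + 1) * (d%:R + 1))) `^ a^-1.
    apply: le_trans (enorm_le_normr u) _.
    apply: (@le_trans _ _ ((d%:R + 1) * `|u|)); first by rewrite ler_wpM2r// lerDl.
    rewrite -ler_pdivlMl ?ltr_wpDl//; near: u.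
    apply: (@nbhs0_le R 'rV[R]_d).
    apply: mulr_gt0; first by rewrite invr_gt0 ltr_wpDl.
    by apply: powR_gt0; apply: divr_gt0 => //; rewrite mulr_gt0// ltr_wpDl.
  have : enorm u `^ a <= e / ((K + 1) * (d%:R + 1)).
    apply: le_trans (ge0_ler_powR (ltW a0) _ _ ud) _; rewrite ?nnegrE ?enorm_ge0 ?powR_ge0//.
    by rewrite -powRrM mulVf ?gt_eqF// powRr1// divr_ge0// ltW.
  rewrite ler_pdivlMr// => h2; apply: le_trans h2.
  rewrite mulrAC mulrC ler_wpM2l ?powR_ge0//.
  by rewrite ler_pM ?ler0n// lerDl.
have D := diff_unique lc E.
have dg : differentiable g x by apply/diff_locallyP; rewrite D.
by split=> // u; rewrite deriveE// D.
Unshelve. all: by end_near. Qed.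
End directional_derivative.

(** * Convex potentials with a bounded Lipschitz Hessian *)

Section smooth_convex.
Context {R : realType} {d : nat}.
Variables (V : 'rV[R]_d -> R) (M L : R).
Hypotheses (M_gt0 : 0 < M) (L_gt0 : 0 < L).
Hypothesis Vsc : strictly_convex V.
Hypothesis Vd : times_differentiable 2 V.
Hypothesis VM : (ereal_sup [set opnorm (hessian V x) | x in [set: 'rV[R]_d]] <= M%:E)%E.
Hypothesis VL : (ereal_sup [set opnorm (hessian V p.1 - hessian V p.2)
                      * ((enorm (p.1 - p.2))^-1)%:E
               | p in [set p : 'rV[R]_d * 'rV[R]_d | p.1 != p.2]] <= L%:E)%E.
Implicit Types (x y h u w : 'rV[R]_d).

Lemma differentiable_potential x : differentiable V x.
Proof. by have [] := Vd. Qed.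

Lemma differentiable_potential2 w x : differentiable ('D_w V) x.
Proof. by have [_ /(_ w)[]] := Vd. Qed.

Lemma derive2_hessian h w x : 'D_h ('D_w V) x = dot (h *m hessian V x) w.
Proof.
have -> : 'D_w V = \sum_(j < d) w ord0 j \*: 'D_(delta_mx ord0 j) V.
  apply/funext => y; rewrite (derive_gradient _ (differentiable_potential y)) fct_sumE.
  by apply: eq_bigr => j _ /=; rewrite mxE mulrC.
have D j y : derivable (w ord0 j \*: 'D_(delta_mx ord0 j) V) y h.
  by apply: derivableZ; apply: diff_derivable; exact: differentiable_potential2.
rewrite derive_sum//; apply: eq_bigr => j _.
rewrite deriveZ; last by apply: diff_derivable; exact: differentiable_potential2.
rewrite (derive_gradient _ (differentiable_potential2 _ _)) [LHS]mulrC mxE; congr (_ * _).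
by apply: eq_bigr => i _; rewrite !mxE mulrC.
Qed.

Lemma hessian_bounded h x : enorm (h *m hessian V x) <= M * enorm h.
Proof.
apply: opnorm_le (ltW M_gt0) _ _; apply: le_trans VM.
by apply: ereal_sup_ubound; exists x.
Qed.

Lemma hessian_lipschitz h x y :
  enorm (h *m hessian V x - h *m hessian V y) <= L * enorm (x - y) * enorm h.
Proof.
have [->|xy] := eqVneq x y; first by rewrite !subrr enorm0 mulr0 mul0r.
have e0 : 0 < enorm (x - y) by rewrite lt_def enorm_eq0 subr_eq0 xy enorm_ge0.
rewrite -mulmxBr; apply: opnorm_le; first by rewrite mulr_ge0// ltW.
rewrite EFinM -lee_pdivrMr//; apply: le_trans VL.
by apply: ereal_sup_ubound; exists (x, y).
Qed.

(** The intermediate point depends on [w], so bounds on the norm of the increment are derived one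
    direction at a time and assembled by [enorm_dual_le]. *)
Lemma gradient_increment w x h : exists2 t, 0 < t < 1 &
  dot (gradient V (x + h) - gradient V x) w = dot (h *m hessian V (x + t *: h)) w.
Proof.
have [t t01 E] := mean_value x h (differentiable_potential2 w).
exists t => //; rewrite -derive2_hessian -E dotBl.
by rewrite !(derive_gradient _ (differentiable_potential _)).
Qed.

Lemma gradient_lipschitz x y : enorm (gradient V x - gradient V y) <= M * enorm (x - y).
Proof.
apply: enorm_dual_le => [|w]; first by rewrite mulr_ge0 ?enorm_ge0 ?ltW.
have [t _] := gradient_increment w y (x - y); rewrite [y + _]addrC subrK => ->.
apply: le_trans (dot_le _ _) _; rewrite ler_wpM2r ?enorm_ge0//.
exact: hessian_bounded.
Qed.

(** The mean value theorem replaces the integral remainder, hence the constant [L] instead of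
    [L / 2], and likewise [M] in [potential_taylor]. *)
Lemma gradient_taylor x h :
  enorm (gradient V (x + h) - gradient V x - h *m hessian V x) <= L * enorm h ^+ 2.
Proof.
apply: enorm_dual_le => [|w]; first by rewrite mulr_ge0 ?sqr_ge0 ?ltW.
rewrite dotBl; have [t /andP[t0 t1] ->] := gradient_increment w x h.
rewrite -dotBl; apply: le_trans (dot_le _ _) _; rewrite ler_wpM2r ?enorm_ge0//.
apply: le_trans (hessian_lipschitz _ _ _) _.
rewrite addrAC subrr add0r enormZ gtr0_norm// expr2 mulrA ler_wpM2r ?enorm_ge0//.
by rewrite (ler_wpM2l (ltW L_gt0))// ler_piMl ?enorm_ge0// ltW.
Qed.

Lemma potential_taylor x h :
  `|V (x + h) - V x - dot (gradient V x) h| <= M * enorm h ^+ 2.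
Proof.
have [t /andP[t0 t1] ->] := mean_value x h differentiable_potential.
rewrite (derive_gradient _ (differentiable_potential _)) -dotBl.
apply: le_trans (cauchy_schwarz _ _) _; rewrite expr2 mulrA ler_wpM2r ?enorm_ge0//.
apply: le_trans (gradient_lipschitz _ _) _.
rewrite addrAC subrr add0r enormZ gtr0_norm//.
by rewrite (ler_wpM2l (ltW M_gt0))// ler_piMl ?enorm_ge0// ltW.
Qed.

(** Divide the convexity inequality at [x + t h] by [t]: the Taylor error becomes [t M |h|^2], and
    [t] is chosen to make it at most [e]. *)
Lemma potential_tangent x h : V x + dot (gradient V x) h <= V (x + h).
Proof.
have [->|h0] := eqVneq h 0; first by rewrite dot0r !addr0.
apply/ler_addgt0Pr => e e0.
pose t := Num.min (1 / 2) (e / (M * enorm h ^+ 2)).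
have h20 : 0 < M * enorm h ^+ 2.
  by rewrite mulr_gt0// exprn_gt0// lt_def enorm_eq0 h0 enorm_ge0.
have t0 : 0 < t by rewrite /t lt_min divr_gt0//= divr_gt0.
have t1 : t < 1 by rewrite /t gt_min; apply/orP; left; lra.
have te : t * (M * enorm h ^+ 2) <= e by rewrite -ler_pdivlMr// /t ge_min lexx orbT.
have xh : x + h != x by rewrite -subr_eq0 addrAC subrr add0r.
have := Vsc xh (_ : 0 < t < 1); rewrite t0 t1 => /(_ erefl).
have -> : t *: (x + h) + (1 - t) *: x = x + t *: h.
  by apply/rowP => i; rewrite !mxE; ring.
have := potential_taylor x (t *: h); rewrite dotZr enormZ (gtr0_norm t0) ler_norml => /andP[T _] S.
rewrite -(ler_pM2l t0) !mulrDr; move: T S te; nra.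
Qed.

End smooth_convex.

(** * Measurability and translation on row vectors *)

Section row_measurability.
Context {R : realType} {d : nat}.
Local Notation rV := 'rV[R]_d.

Let rat_row (q : 'rV[rat]_d) : rV := map_mx ratr q.

Let box (x : rV) (e : R) : set rV := [set y | forall i, `|x ord0 i - y ord0 i| < e].

Let measurable_box x e : measurable (box x e).
Proof.
have -> : box x e = \bigcap_(i in [set: 'I_d]) [set y : rV | `|x ord0 i - y ord0 i| < e].
  by apply/seteqP; split => y /= h i; [move=> _; exact: h|exact: (h i)].
apply: fin_bigcap_measurable => [|i _]; first exact: finite_finset.
rewrite -[X in measurable X]setTI.
rewrite (_ : [set y : rV | _] = (fun y : rV => `|x ord0 i - y ord0 i|) @^-1` `]-oo, e[%classic); last first.
  by apply/seteqP; split => y /=; rewrite in_itv.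
suff h : measurable_fun [set: rV] (fun y : rV => `|x ord0 i - y ord0 i| : measurableTypeR R) by exact: h.
apply: measurableT_comp => //; apply: measurable_funB => //.
exact: measurable_coord.
Qed.

(** The sigma-algebra is generated by coordinates, so boxes are measurable; an open set is the union
    of the boxes with rational centre and radius [1 / (r + 1)] that it contains, enumerated by
    [pickle]. *)
Lemma open_measurable_row (U : set rV) : open U -> measurable U.
Proof.
move=> oU.
pose F (p : rV * nat) := box p.1 p.2.+1%:R^-1.
pose G k : set rV := if unpickle k is Some (q, r) then
  (if `[< F (rat_row q, r) `<=` U >] then F (rat_row q, r) else set0) else set0.
suff -> : U = \bigcup_k G k.
  apply: bigcup_measurable => k _; rewrite /G; case: unpickle => [[q r]|]//.
  by case: ifP => // _; exact: measurable_box.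
apply/seteqP; split => [x Ux|x [k _]]; last first.
  rewrite /G; case: unpickle => [[q r]|]//; case: ifPn => // /asboolP h; exact: h.
have /nbhs_ballP[e /= e0 xe] : nbhs x U by exact: open_nbhs_nbhs.
have [r re] : exists r : nat, r.+1%:R^-1 < e / 2 :> R.
  have e20 : 0 < e / 2 by rewrite divr_gt0.
  exists (Num.truncn (e / 2)^-1); rewrite invf_plt ?posrE//.
  exact: truncnS_gt.
have r0 : 0 < r.+1%:R^-1 :> R by rewrite invr_gt0.
have Q i : {q : rat | `|ratr q - x ord0 i| < r.+1%:R^-1}.
  have lt1 : x ord0 i - r.+1%:R^-1 < x ord0 i + r.+1%:R^-1.
    by rewrite ltrBlDr -addrA ltrDl addr_gt0.
  apply: cid; have [q] := rat_in_itvoo lt1.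
  by rewrite in_itv/= => h; exists q; rewrite ltr_distl.
pose q := \row_i sval (Q i).
have qx i : `|rat_row q ord0 i - x ord0 i| < r.+1%:R^-1.
  by rewrite !mxE; exact: (svalP (Q i)).
exists (pickle (q, r)) => //; rewrite /G pickleK asboolT => [i|y hy]; first exact: qx.
apply: xe; split => // i j; rewrite (ord1 i) /ball/=.
rewrite -(subrKA (rat_row q ord0 j)); apply: le_lt_trans (ler_normD _ _) _.
rewrite (splitr e); apply: ltrD; apply: lt_trans re; last exact: hy.
by rewrite distrC; exact: qx.
Qed.

Lemma continuous_measurable_row (f : rV -> R) : continuous f -> measurable_fun setT f.
Proof.
move=> cf; apply: (measurability _ (RGenOpens.measurableE R)).
move=> _ [_ [a [b ->] <-]]; rewrite setTI; apply: open_measurable_row.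
by apply: open_comp => // x _; exact: cf.
Qed.

Lemma measurable_row_comp dT (T : measurableType dT) (f : T -> rV) i :
  measurable_fun setT f -> measurable_fun setT (fun t => f t ord0 i).
Proof. by move=> mf; apply: (measurableT_comp (measurable_coord i)). Qed.

Lemma measurable_rowD dT (T : measurableType dT) (f g : T -> rV) :
  measurable_fun setT f -> measurable_fun setT g -> measurable_fun setT (fun t => f t + g t).
Proof.
move=> mf mg; apply: measurable_fun_row => i.
under eq_fun do rewrite mxE.
by apply: measurable_funD; exact: measurable_row_comp.
Qed.

Lemma measurable_rowN dT (T : measurableType dT) (f : T -> rV) :
  measurable_fun setT f -> measurable_fun setT (fun t => - f t).
Proof.
move=> mf; apply: measurable_fun_row => i.
under eq_fun do rewrite mxE.
by apply: measurableT_comp => //; exact: measurable_row_comp.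
Qed.

Lemma measurable_rowB dT (T : measurableType dT) (f g : T -> rV) :
  measurable_fun setT f -> measurable_fun setT g -> measurable_fun setT (fun t => f t - g t).
Proof. by move=> mf mg; apply: measurable_rowD => //; exact: measurable_rowN. Qed.

Lemma measurable_row_scale dT (T : measurableType dT) (a : R) (f : T -> rV) :
  measurable_fun setT f -> measurable_fun setT (fun t => a *: f t).
Proof.
move=> mf; apply: measurable_fun_row => i.
under eq_fun do rewrite mxE.
by apply: measurable_funM => //; exact: measurable_row_comp.
Qed.

Lemma measurable_row_sum dT (T : measurableType dT) n (f : 'I_n -> T -> rV) :
  (forall i, measurable_fun setT (f i)) -> measurable_fun setT (fun t => \sum_i f i t).
Proof.
move=> mf; apply: measurable_fun_row => i.
under eq_fun do rewrite summxE.
by apply: measurable_sum => j; exact: measurable_row_comp.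
Qed.

Lemma measurable_dot dT (T : measurableType dT) (f g : T -> rV) :
  measurable_fun setT f -> measurable_fun setT g -> measurable_fun setT (fun t => dot (f t) (g t)).
Proof.
by move=> mf mg; apply: measurable_sum => i; apply: measurable_funM; exact: measurable_row_comp.
Qed.

Lemma measurable_enorm dT (T : measurableType dT) (f : T -> rV) :
  measurable_fun setT f -> measurable_fun setT (fun t => enorm (f t)).
Proof.
move=> mf; rewrite (_ : (fun _ => _) = Num.sqrt \o (fun t => dot (f t) (f t))).
  by apply: measurableT_comp; [exact: continuous_measurable_fun (@sqrt_continuous R)|exact: measurable_dot].
by apply/funext => t /=; rewrite enormE.
Qed.

End row_measurability.

Lemma measurable_mulmx (R : realType) (m d : nat) dT (T : measurableType dT) (f : T -> 'rV[R]_m) (A : 'M[R]_(m, d)) :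
  measurable_fun setT f -> measurable_fun setT (fun t => f t *m A).
Proof.
move=> mf; apply: measurable_fun_row => i.
under eq_fun do rewrite mxE.
apply: measurable_sum => j; apply: measurable_funM => //; exact: measurable_row_comp.
Qed.

(** * Translation invariance of Lebesgue measure *)

Section translation_invariance.
Context {R : realType}.
Local Open Scope ereal_scope.

(** The translated measure agrees with Lebesgue measure on half-open intervals, and these determine
    it. *)
Lemma ge0_integral_translate1 (a : R) (f : R -> \bar R) :
  measurable_fun [set: R] f -> (forall r, 0 <= f r) ->
  \int[lebesgue_measure]_r f (r + a)%R = \int[lebesgue_measure]_r f r.
Proof.
move=> mf f0.
have mt : measurable_fun [set: measurableTypeR R] (fun r : R => (r + a)%R : measurableTypeR R).
  by apply: measurable_funD.
transitivity (\int[pushforward lebesgue_measure (fun r : R => (r + a)%R : measurableTypeR R)]_r f r).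
  by rewrite ge0_integral_pushforward.
apply: eq_measure_integral => A mA _; apply/esym/lebesgue_measure_unique => //= _ [[x y]] _ <-.
have E : ((fun r : R => (r + a)%R) @^-1` `]x, y]%classic) = `](x - a)%R, (y - a)%R]%classic.
  by apply/seteqP; split => r /=; rewrite !in_itv/= ltrBlDr lerBrDr.
by rewrite /pushforward E !lebesgue_measure_itv/= !lte_fin ltrD2r -!EFinB (_ : y - a - (x - a) = y - x)%R; [|ring].
Qed.

Lemma row_consD n (p : measurableTypeR R * 'rV[R]_n) (v : 'rV[R]_n.+1) :
  (row_cons p + v)%R = row_cons ((p.1 + v ord0 ord0)%R : measurableTypeR R, (p.2 + \row_j v ord0 (lift ord0 j))%R).
Proof.
apply/rowP => i; rewrite mxE.
have [j ->|j ->] := split_ordP (i : 'I_(1 + n)).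
  rewrite /row_cons !(@row_mxEl R 1 1 n) !mxE !ord1 eqxx !mulr1n.
  by congr (_ + v _ _)%R; exact: val_inj.
rewrite /row_cons !(@row_mxEr R 1 1 n) !mxE.
by congr (_ + v _ _)%R; exact: val_inj.
Qed.

Lemma ge0_integral_lebesgue_rowS n (f : 'rV[R]_n.+1 -> \bar R) :
  measurable_fun setT f -> (forall x, 0 <= f x) ->
  \int[lebesgue_row R n.+1]_x f x =
  \int[lebesgue_measure]_r \int[lebesgue_row R n]_v f (row_cons (r : measurableTypeR R, v)).
Proof.
move=> mf f0; rewrite /= /lebesgue_row_step (ge0_integral_pushforward (@measurable_row_cons R n))//.
rewrite preimage_setT fubini_tonelli1//; last by move=> x; exact: f0.
by apply: measurableT_comp => //; exact: measurable_row_cons.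
Qed.

(** Induction on the dimension: Tonelli splits off the first coordinate, which is translated by the
    one-dimensional case. *)
Lemma ge0_integral_translate n (v : 'rV[R]_n) (f : 'rV[R]_n -> \bar R) :
  measurable_fun setT f -> (forall x, 0 <= f x) ->
  \int[lebesgue_row R n]_x f (x + v)%R = \int[lebesgue_row R n]_x f x.
Proof.
elim: n v f => [|n IH] v f mf f0.
  by apply: eq_integral => x _; congr f; apply/rowP => -[].
have mt k (w : 'rV[R]_k) : measurable_fun setT (fun x : 'rV[R]_k => (x + w)%R).
  by apply: measurable_rowD.
rewrite (ge0_integral_lebesgue_rowS mf f0) (@ge0_integral_lebesgue_rowS n (fun x => f (x + v)%R))//; last first.
  by apply: (measurableT_comp mf); exact: mt.
have mfc : measurable_fun setT (f \o @row_cons R n).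
  by apply: measurableT_comp => //; exact: measurable_row_cons.
pose F := fubini_F (lebesgue_row R n) (f \o @row_cons R n).
have mF : measurable_fun setT F.
  by apply: measurable_fun_fubini_tonelli_F => // x; exact: f0.
transitivity (\int[lebesgue_measure]_r F (r + v ord0 ord0)%R); last first.
  by apply: ge0_integral_translate1 => // r; apply: integral_ge0 => w _; exact: f0.
apply: eq_integral => r _; rewrite /F /fubini_F.
rewrite -[RHS](IH (\row_j v ord0 (lift ord0 j))%R); first last.
- by move=> x; exact: f0.
- by apply: (measurableT_comp mfc); exact: measurable_pair1.
- by apply: eq_integral => w _; rewrite row_consD.
Qed.

End translation_invariance.

(** * Integration against the Gibbs density *)

Section gibbs_density.
Context {R : realType} {d : nat}.
Variable V : potential R d.
Local Open Scope ereal_scope.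
Import HBNNSimple.

Lemma measurable_gibbs_density : measurable_fun setT (fun x : 'rV[R]_d => expR (- V x)).
Proof. by do 2 apply: measurableT_comp => //; exact: pot_measurable. Qed.

(** The measure is defined through integrals over sets, which settles indicators; simple functions
    follow by linearity and [f] by monotone convergence. *)
Lemma ge0_integral_gibbs (f : 'rV[R]_d -> \bar R) :
  measurable_fun setT f -> (forall x, 0 <= f x) ->
  \int[gibbs V]_x f x = \int[lebesgue_row R d]_x (f x * (expR (- V x))%:E).
Proof.
move=> mf f0; have mD := measurable_gibbs_density.
pose f_ := nnsfun_approx measurableT mf.
transitivity (limn (fun n => \int[gibbs V]_x (f_ n x)%:E)).
  rewrite -monotone_convergence//.
  - apply: eq_integral => y _; apply/esym/cvg_lim => //.
    by apply: cvg_nnsfun_approx => // *; exact: f0.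
  - by move=> n; exact/measurable_EFinP/measurable_funP.
  - by move=> n y _; rewrite lee_fin.
  - by move=> y _ m n mn; rewrite lee_fin; exact/lefP/nd_nnsfun_approx.
rewrite [X in limn X](_ : _ = (fun n => \int[lebesgue_row R d]_x ((f_ n x * expR (- V x))%R)%:E)).
  rewrite -monotone_convergence//; last 3 first.
    - move=> n; apply/measurable_EFinP; apply: measurable_funM => //; exact: measurable_funP.
    - by move=> n x _; rewrite lee_fin mulr_ge0 ?expR_ge0.
    - move=> x _ m n mn; rewrite lee_fin ler_wpM2r ?expR_ge0//; exact/lefP/nd_nnsfun_approx.
  apply: eq_integral => x _; apply/cvg_lim => //.
  under eq_fun do rewrite EFinM.
  apply: cvgeZr => //.
  by apply: cvg_nnsfun_approx => // *; exact: f0.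
apply/funext => n.
transitivity (\sum_(k \in range (f_ n)) \int[gibbs V]_x (k * \1_(f_ n @^-1` [set k]) x)%:E).
  rewrite -ge0_integral_fsum//; last 2 first.
  - by move=> y; exact/measurable_EFinP/measurable_funM.
  - by move=> y x _; rewrite nnfun_muleindic_ge0.
  by apply: eq_integral => x _; rewrite fsumEFin// -fimfunE.
transitivity (\sum_(k \in range (f_ n)) \int[lebesgue_row R d]_x (k * \1_(f_ n @^-1` [set k]) x *
    expR (- V x))%:E); last first.
  rewrite -ge0_integral_fsum//; last 2 first.
  - by move=> y; apply/measurable_EFinP/measurable_funM => //; exact: measurable_funM.
  - by move=> y x _; rewrite EFinM mule_ge0 ?nnfun_muleindic_ge0// lee_fin expR_ge0.
  apply: eq_integral => x _; rewrite fsumEFin//; congr EFin.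
  by rewrite fimfunE mulr_fsuml.
apply: eq_fsbigr => r _.
rewrite (integralZl_indic _ (fun r => f_ n @^-1` [set r]))//; last by move=> r0; rewrite preimage_nnfun0.
rewrite integral_indic// setIT.
have [r0|r0] := leP 0%R r; last first.
  rewrite preimage_nnfun0//= measure0 mule0 integral0_eq// => x _.
  by rewrite indic0 mulr0 mul0r.
under eq_integral do rewrite -mulrA EFinM.
rewrite ge0_integralZl_EFin//; last first.
  by apply/measurable_EFinP/measurable_funM.
congr (_ * _).
rewrite -[LHS]/(\int[lebesgue_row R d]_(x in f_ n @^-1` [set r]) (expR (- V x))%:E).
rewrite [LHS]integral_mkcond.
apply: eq_integral => x _.
by rewrite patchE indicE; case: ifP => _ /=; rewrite ?mul1r ?mul0r.
Qed.

End gibbs_density.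

(** * Expectations of functions of polynomial growth *)

Section expectation.
Context {R : realType} dT {T : measurableType dT} (P : probability T R).
Implicit Types (f g : T -> R) (w : T -> R).

Definition Ex f : R := Rintegral P setT f.

Record weight w : Prop := Weight {
  weight_measurable : measurable_fun setT w;
  weight_ge1 : forall x, 1 <= w x;
  weight_integrable : forall p : nat, P.-integrable setT (EFin \o (fun x => w x ^+ p)) }.

(* Measurable functions of at most polynomial growth in a weight with finite
   moments are integrable, and so are all their sections: Fubini's theorem
   holds for them without exceptional null sets. *)
Definition moderate w f : Prop :=
  measurable_fun setT f /\ exists C (p : nat), 0 <= C /\ forall x, `|f x| <= C * w x ^+ p.

Variable w : T -> R.
Hypothesis ww : weight w.
Local Notation mo := (moderate w).

Lemma weight_gt0 x : 0 < w x.
Proof. exact: lt_le_trans ltr01 (weight_ge1 ww x). Qed.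

Lemma weightX_ge0 x p : 0 <= w x ^+ p.
Proof. by rewrite exprn_ge0// ltW// weight_gt0. Qed.

Lemma moderate_measurable f : mo f -> measurable_fun setT f. Proof. by case. Qed.

Lemma moderate_le f g : measurable_fun setT f -> (forall x, `|f x| <= `|g x|) -> mo g -> mo f.
Proof.
move=> mf fg [_ [C [p [C0 h]]]]; split=> //; exists C, p; split=> // x.
exact: le_trans (fg x) (h x).
Qed.

Lemma moderate_cst a : mo (fun=> a).
Proof.
split; first exact: measurable_cst.
by exists `|a|, 0; split=> // x; rewrite expr0 mulr1.
Qed.

Lemma moderateD f g : mo f -> mo g -> mo (fun x => f x + g x).
Proof.
move=> [mf [C [p [C0 h]]]] [mg [D [q [D0 k]]]]; split; first exact: measurable_funD.
exists (C + D), (p + q)%N; split=> [|x]; first exact: addr_ge0.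
apply: le_trans (ler_normD _ _) _; rewrite mulrDl; apply: lerD.
  by apply: le_trans (h x) _; rewrite ler_wpM2l// ler_weXn2l ?weight_ge1// leq_addr.
by apply: le_trans (k x) _; rewrite ler_wpM2l// ler_weXn2l ?weight_ge1// leq_addl.
Qed.

Lemma moderateM f g : mo f -> mo g -> mo (fun x => f x * g x).
Proof.
move=> [mf [C [p [C0 h]]]] [mg [D [q [D0 k]]]]; split; first exact: measurable_funM.
exists (C * D), (p + q)%N; split=> [|x]; first exact: mulr_ge0.
by rewrite normrM exprD mulrACA ler_pM.
Qed.

Lemma moderateZ a f : mo f -> mo (fun x => a * f x).
Proof. by apply: moderateM; exact: moderate_cst. Qed.

Lemma moderateN f : mo f -> mo (fun x => - f x).
Proof.
move=> h; rewrite (_ : (fun _ => _) = fun x => -1 * f x); first exact: moderateZ.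
by apply/funext => x; rewrite mulN1r.
Qed.

Lemma moderateB f g : mo f -> mo g -> mo (fun x => f x - g x).
Proof. by move=> hf hg; apply: moderateD => //; exact: moderateN. Qed.

Lemma moderate_norm f : mo f -> mo (fun x => `|f x|).
Proof.
move=> hf; apply: moderate_le (hf) => [|x]; last by rewrite normr_id.
by apply: measurableT_comp => //; case: hf.
Qed.

Lemma moderateX f k : mo f -> mo (fun x => f x ^+ k).
Proof.
move=> hf; elim: k => [|k IH]; first exact: moderate_cst.
by under eq_fun do rewrite exprS; exact: moderateM.
Qed.

Lemma moderate_sum (I : finType) (f : I -> T -> R) :
  (forall i, mo (f i)) -> mo (fun x => \sum_i f i x).
Proof.
move=> h; elim: (index_enum I) => [|i s IH].
  by under eq_fun do rewrite big_nil; exact: moderate_cst.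
by under eq_fun do rewrite big_cons; exact: moderateD.
Qed.

Lemma moderate_weight : mo w.
Proof.
split; first exact: weight_measurable.
by exists 1, 1; split=> // x; rewrite expr1 mul1r ger0_norm// ltW// weight_gt0.
Qed.

Lemma moderate_integrable f : mo f -> P.-integrable setT (EFin \o f).
Proof.
move=> [mf [C [p [C0 h]]]].
have iw := integrableZl measurableT C (weight_integrable ww p).
apply: le_integrable iw => //; first exact/measurable_EFinP.
move=> x _ /=; rewrite lee_fin; apply: le_trans (h x) _.
by rewrite ger0_norm// mulr_ge0// weightX_ge0.
Qed.

Lemma ExD f g : mo f -> mo g -> Ex (fun x => f x + g x) = Ex f + Ex g.
Proof. by move=> hf hg; rewrite /Ex RintegralD//; exact: moderate_integrable. Qed.

Lemma ExZ a f : mo f -> Ex (fun x => a * f x) = a * Ex f.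
Proof. by move=> hf; rewrite /Ex RintegralZl//; exact: moderate_integrable. Qed.

Lemma ExN f : mo f -> Ex (fun x => - f x) = - Ex f.
Proof.
move=> hf; rewrite -mulN1r -ExZ//; congr Ex; apply/funext => x.
by rewrite mulN1r.
Qed.

Lemma ExB f g : mo f -> mo g -> Ex (fun x => f x - g x) = Ex f - Ex g.
Proof. by move=> hf hg; rewrite ExD ?ExN//; exact: moderateN. Qed.

Lemma Ex_cst a : Ex (fun=> a) = a.
Proof. by rewrite /Ex Rintegral_cst// [X in fine X]probability_setT mulr1. Qed.

Lemma Ex_sum (I : finType) (f : I -> T -> R) : (forall i, mo (f i)) ->
  Ex (fun x => \sum_i f i x) = \sum_i Ex (f i).
Proof.
move=> h; suff : mo (fun x => \sum_(i <- index_enum I) f i x) /\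
  Ex (fun x => \sum_(i <- index_enum I) f i x) = \sum_(i <- index_enum I) Ex (f i) by case.
elim: (index_enum I) => [|i s [IH1 IH2]].
  under eq_fun do rewrite big_nil; rewrite big_nil; split; first exact: moderate_cst.
  by rewrite Ex_cst.
under eq_fun do rewrite big_cons; rewrite big_cons; split; first exact: moderateD.
by rewrite ExD// IH2.
Qed.

Lemma Ex_le f g : mo f -> mo g -> (forall x, f x <= g x) -> Ex f <= Ex g.
Proof. by move=> hf hg fg; apply: le_Rintegral => //; exact: moderate_integrable. Qed.

Lemma Ex_ge0 f : (forall x, 0 <= f x) -> 0 <= Ex f.
Proof. by move=> f0; apply: Rintegral_ge0. Qed.

Lemma Ex_norm f : mo f -> `|Ex f| <= Ex (fun x => `|f x|).
Proof. by move=> hf; apply: le_normr_Rintegral => //; exact: moderate_integrable. Qed.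

Lemma Ex_norm_le f g : mo f -> mo g -> (forall x, `|f x| <= g x) -> `|Ex f| <= Ex g.
Proof.
move=> hf hg fg; apply: le_trans (Ex_norm hf) _.
by apply: Ex_le => //; exact: moderate_norm.
Qed.

Definition evar f : R := Ex (fun x => (f x - Ex f) ^+ 2).

Lemma evar_ge0 f : 0 <= evar f.
Proof. by apply: Ex_ge0 => x; exact: sqr_ge0. Qed.

Lemma evarE f : mo f -> evar f = Ex (fun x => f x ^+ 2) - Ex f ^+ 2.
Proof.
move=> hf; rewrite /evar.
have -> : (fun x => (f x - Ex f) ^+ 2) = fun x => f x ^+ 2 + ((- 2 * Ex f) * f x + Ex f ^+ 2).
  by apply/funext => x; ring.
have h2 := moderateX 2 hf; have h3 := moderateZ (- 2 * Ex f) hf.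
have h4 := moderate_cst (Ex f ^+ 2).
rewrite ExD//; last exact: moderateD.
by rewrite ExD// ExZ// Ex_cst; ring.
Qed.

Lemma sqr_Ex_le f : mo f -> Ex f ^+ 2 <= Ex (fun x => f x ^+ 2).
Proof. by move=> hf; rewrite -subr_ge0 -evarE// evar_ge0. Qed.

Lemma Ex_sqrD_le f g : mo f -> mo g ->
  Ex (fun x => (f x + g x) ^+ 2) <= 2 * Ex (fun x => f x ^+ 2) + 2 * Ex (fun x => g x ^+ 2).
Proof.
move=> hf hg; have hf2 := moderateX 2 hf; have hg2 := moderateX 2 hg.
rewrite -(ExZ 2 hf2) -(ExZ 2 hg2) -ExD; [|exact: moderateZ|exact: moderateZ].
apply: Ex_le => [||x]; [exact/moderateX/moderateD| |].
  by apply: moderateD; exact/moderateZ/moderateX.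
by have := sqr_ge0 (f x - g x); nra.
Qed.

End expectation.

(** Polynomial growth survives a substitution whose weight grows at most polynomially. Sections,
    coordinates of a sample and replacement of one observation are all instances. *)
Lemma moderate_comp {R : realType} d1 d2 (T1 : measurableType d1) (T2 : measurableType d2)
    (w1 : T1 -> R) (w2 : T2 -> R) (phi : T1 -> T2) (C : R) (k : nat) (f : T2 -> R) :
  measurable_fun setT phi -> 0 <= C -> (forall x, 0 <= w2 x) ->
  (forall x, w2 (phi x) <= C * w1 x ^+ k) ->
  moderate w2 f -> moderate w1 (fun x => f (phi x)).
Proof.
move=> mphi C0 w20 h [mf [D [p [D0 hf]]]]; split; first exact: (measurableT_comp mf).
exists (D * C ^+ p), (k * p)%N; split=> [|x]; first by rewrite mulr_ge0 ?exprn_ge0.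
apply: le_trans (hf _) _; rewrite -mulrA ler_wpM2l// exprM -exprMn.
by apply: lerXn2r => //; rewrite nnegrE// (le_trans _ (h x)).
Qed.

(** * Fubini's theorem for functions of polynomial growth *)

Section product_expectation.
Context {R : realType} d1 d2 {T1 : measurableType d1} {T2 : measurableType d2}
  (P1 : probability T1 R) (P2 : probability T2 R) (w1 : T1 -> R) (w2 : T2 -> R).
Hypotheses (ww1 : weight P1 w1) (ww2 : weight P2 w2).

Definition prod_weight (z : T1 * T2) : R := w1 z.1 * w2 z.2.
Local Notation w12 := prod_weight.

Lemma weight_prod : weight (P1 \x P2)%E w12.
Proof.
have m1 := weight_measurable ww1; have m2 := weight_measurable ww2.
have m12 : measurable_fun setT w12.
  by apply: measurable_funM; [exact: (measurableT_comp m1)|exact: (measurableT_comp m2)].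
split=> // [x|p].
  by rewrite -[1]mulr1 ler_pM// ?(weight_ge1 ww1) ?(weight_ge1 ww2).
apply/integrable12ltyP; first by apply/measurable_EFinP; exact: measurable_funX.
rewrite (eq_integral (fun x => (w1 x ^+ p)%:E * \int[P2]_y (w2 y ^+ p)%:E)%E); last first.
  move=> x _; rewrite -ge0_integralZl_EFin//; last 3 first.
  - by move=> y _; rewrite lee_fin (weightX_ge0 ww2).
  - by apply/measurable_EFinP; exact: measurable_funX.
  - exact: weightX_ge0 ww1 _ _.
  apply: eq_integral => y _ /=; rewrite ger0_norm; last first.
    by rewrite exprn_ge0// mulr_ge0// ltW// ?(weight_gt0 ww1) ?(weight_gt0 ww2).
  by rewrite exprMn.
have h1 := integrable_fin_num measurableT (weight_integrable ww1 p).
have h2 := integrable_fin_num measurableT (weight_integrable ww2 p).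
rewrite ge0_integralZr//.
- by rewrite -(fineK h1) -(fineK h2) -EFinM ltry.
- by apply/measurable_EFinP; exact: measurable_funX.
- by move=> y _; rewrite lee_fin (weightX_ge0 ww1).
- by apply: integral_ge0 => y _; rewrite lee_fin (weightX_ge0 ww2).
Qed.

Lemma moderate_pair1 (y : T2) (f : T1 * T2 -> R) : moderate w12 f -> moderate w1 (fun x => f (x, y)).
Proof.
apply: (@moderate_comp _ _ _ _ _ _ _ _ (w2 y) 1).
- exact: measurable_pair2.
- by rewrite ltW// (weight_gt0 ww2).
- by move=> x; rewrite ltW// (weight_gt0 weight_prod).
- by move=> x; rewrite expr1 mulrC.
Qed.

Lemma moderate_pair2 (x : T1) (f : T1 * T2 -> R) : moderate w12 f -> moderate w2 (fun y => f (x, y)).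
Proof.
apply: (@moderate_comp _ _ _ _ _ _ _ _ (w1 x) 1).
- exact: measurable_pair1.
- by rewrite ltW// (weight_gt0 ww1).
- by move=> z; rewrite ltW// (weight_gt0 weight_prod).
- by move=> z; rewrite expr1.
Qed.

Lemma Ex_fubini1 f : moderate w12 f -> Ex (P1 \x P2)%E f = Ex P1 (fun x => Ex P2 (fun y => f (x, y))).
Proof.
move=> hf; have i12 := moderate_integrable weight_prod hf.
rewrite /Ex /Rintegral -(integral12_prod_meas1 i12); congr fine.
apply: eq_integral => x _; rewrite /fubini_F fineK//.
exact: integrable_fin_num (moderate_integrable ww2 (moderate_pair2 x hf)).
Qed.

Lemma Ex_fubini2 f : moderate w12 f -> Ex (P1 \x P2)%E f = Ex P2 (fun y => Ex P1 (fun x => f (x, y))).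
Proof.
move=> hf; have i12 := moderate_integrable weight_prod hf.
rewrite /Ex /Rintegral -(integral21_prod_meas1 i12); congr fine.
apply: eq_integral => y _; rewrite /fubini_G fineK//.
exact: integrable_fin_num (moderate_integrable ww1 (moderate_pair1 y hf)).
Qed.

Lemma moderate_Ex2 f : moderate w12 f -> moderate w1 (fun x => Ex P2 (fun y => f (x, y))).
Proof.
move=> hf; have i12 := moderate_integrable weight_prod hf; split.
  apply: (measurableT_comp (@fine_measurable R setT measurableT)).
  exact: (measurable_fubini_F i12).
have [_ [C [p [C0 h]]]] := hf.
have mw := moderateX p (moderate_weight ww2).
exists (C * Ex P2 (fun y => w2 y ^+ p)), p; split=> [|x].
  by rewrite mulr_ge0// Ex_ge0// => y; exact: weightX_ge0 ww2 _ _.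
rewrite mulrAC -(ExZ ww2)//.
apply: (Ex_norm_le ww2); [exact: moderate_pair2|exact: moderateZ|].
by move=> y; apply: le_trans (h _) _; rewrite -mulrA -exprMn.
Qed.

Lemma moderate_Ex1 f : moderate w12 f -> moderate w2 (fun y => Ex P1 (fun x => f (x, y))).
Proof.
move=> hf; have i12 := moderate_integrable weight_prod hf; split.
  apply: (measurableT_comp (@fine_measurable R setT measurableT)).
  exact: (measurable_fubini_G i12).
have [_ [C [p [C0 h]]]] := hf.
have mw := moderateX p (moderate_weight ww1).
exists (C * Ex P1 (fun y => w1 y ^+ p)), p; split=> [|x].
  by rewrite mulr_ge0// Ex_ge0// => y; exact: weightX_ge0 ww1 _ _.
rewrite mulrAC -(ExZ ww1)//.
apply: (Ex_norm_le ww1); [exact: moderate_pair1|exact: moderateZ|].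
by move=> y; apply: le_trans (h _) _; rewrite -[leRHS]mulrA -exprMn [w2 _ * _]mulrC.
Qed.

End product_expectation.

(** * Product measures and the Efron-Stein inequality *)

Section iid_sample.
Context {R : realType} dT {T : measurableType dT} (P : probability T R) (w : T -> R).
Hypothesis ww : weight P w.

Definition tcons n (z : T * n.-tuple T) : n.+1.-tuple T := [tuple of z.1 :: z.2].

Lemma measurable_tcons n : measurable_fun setT (@tcons n).
Proof. exact: measurable_cons. Qed.

HB.instance Definition _ n :=
  isMeasurableFun.Build _ _ _ _ (@tcons n) (@measurable_tcons n).

(** Recursive, so that integrating out the first observation is Fubini's theorem on [P \x iid m]. *)
Fixpoint iid n : probability (n.-tuple T) R :=
  if n is m.+1 then distribution (P \x iid m)%E (@tcons m)
  else \d_([tuple] : 0.-tuple T).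

Definition wtuple n (y : n.-tuple T) : R := \prod_(i < n) w (tnth y i).

Lemma wtuple_tcons n z : wtuple (@tcons n z) = prod_weight w (@wtuple n) z.
Proof.
rewrite /wtuple big_ord_recl /prod_weight; congr (_ * _).
by apply: eq_bigr => i _; rewrite tnthS.
Qed.

Lemma measurable_wtuple n : measurable_fun setT (@wtuple n).
Proof.
apply: measurable_prod => i _.
exact: (measurableT_comp (weight_measurable ww) (measurable_tnth i)).
Qed.

Lemma weight_iid n : weight (iid n) (@wtuple n).
Proof.
have w1 k (y : k.-tuple T) : 1 <= wtuple y.
  rewrite /wtuple; elim/big_ind : _ => // [a b a1 b1|i _]; last exact: weight_ge1 ww _.
  by rewrite -[1]mulr1 ler_pM.
elim: n => [|n IH].
  split=> [|y|p]; [exact: measurable_wtuple|exact: w1|].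
  apply: (le_integrable measurableT _ _ (finite_measure_integrable_cst _ 1 measurableT)).
    by apply/measurable_EFinP; apply: measurable_funX; exact: measurable_wtuple.
  by move=> y _ /=; rewrite /wtuple big_ord0 expr1n.
split=> [|y|p]; [exact: measurable_wtuple|exact: w1|].
apply: (integrable_pushforward (@measurable_tcons n)) => //.
  by apply/measurable_EFinP; apply: measurable_funX; exact: measurable_wtuple.
rewrite (_ : _ \o _ = EFin \o (fun z => prod_weight w (@wtuple n) z ^+ p)); last first.
  by apply/funext => z /=; rewrite wtuple_tcons.
exact: weight_integrable (weight_prod ww IH) p.
Qed.

Local Notation mo := (moderate (@wtuple _)).

Lemma moderate_tcons n F : moderate (@wtuple n.+1) F ->
  moderate (prod_weight w (@wtuple n)) (fun z => F (tcons z)).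
Proof.
apply: (@moderate_comp _ _ _ _ _ _ _ _ 1 1) => //.
- by move=> x; rewrite ltW// (weight_gt0 (weight_iid _)).
- by move=> x; rewrite expr1 mul1r wtuple_tcons.
Qed.

Lemma moderate_tnth n (i : 'I_n) (h : T -> R) : moderate w h ->
  moderate (@wtuple n) (fun y => h (tnth y i)).
Proof.
apply: (@moderate_comp _ _ _ _ _ _ _ _ 1 1) => //.
- exact: measurable_tnth.
- by move=> x; rewrite ltW// (weight_gt0 ww).
- move=> y; rewrite expr1 mul1r /wtuple (bigD1 i)//= ler_peMr//.
    by rewrite ltW// (weight_gt0 ww).
  elim/big_ind : _ => // [a b a1 b1|j _]; last exact: weight_ge1 ww _.
  by rewrite -[1]mulr1 ler_pM.
Qed.

Lemma Ex_iid0 F : Ex (iid 0) F = F [tuple].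
Proof.
transitivity (Ex (iid 0) (fun=> F [tuple])); last exact: Ex_cst.
by congr Ex; apply/funext => y; rewrite tuple0.
Qed.

Section recursion.
Variables (n : nat) (F : n.+1.-tuple T -> R).
Hypothesis mF : moderate (@wtuple n.+1) F.

Lemma Ex_iidE : Ex (iid n.+1) F = Ex (P \x iid n)%E (fun z => F (tcons z)).
Proof.
rewrite /Ex /Rintegral; congr fine.
rewrite (integral_pushforward (@measurable_tcons n))//.
- by apply/measurable_EFinP; exact: moderate_measurable mF.
- by have h := moderate_integrable (weight_prod ww (weight_iid n)) (moderate_tcons mF); exact h.
Qed.

Lemma Ex_iidl : Ex (iid n.+1) F = Ex P (fun z => Ex (iid n) (fun y => F (tcons (z, y)))).
Proof. by rewrite Ex_iidE (Ex_fubini1 ww (weight_iid n))//; exact: moderate_tcons. Qed.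

Lemma Ex_iidr : Ex (iid n.+1) F = Ex (iid n) (fun y => Ex P (fun z => F (tcons (z, y)))).
Proof. by rewrite Ex_iidE (Ex_fubini2 ww (weight_iid n))//; exact: moderate_tcons. Qed.

Lemma moderate_iidr : moderate (@wtuple n) (fun y => Ex P (fun z => F (tcons (z, y)))).
Proof. exact (moderate_Ex1 ww (weight_iid n) (moderate_tcons mF)). Qed.

Lemma moderate_tconsl y : moderate w (fun z => F (tcons (z, y))).
Proof. exact: (moderate_pair1 ww (weight_iid n) y (moderate_tcons mF)). Qed.

End recursion.

Lemma Ex_iid_tnth n (i : 'I_n) (h : T -> R) : moderate w h ->
  Ex (iid n) (fun y => h (tnth y i)) = Ex P h.
Proof.
move=> mh; elim: n i => [[]//|n IH] i; rewrite Ex_iidl; last exact: moderate_tnth.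
have [j ->|->] := unliftP ord0 i.
  under eq_fun => z do under eq_fun => y do rewrite tnthS.
  by under eq_fun => z do rewrite [Ex _ _]IH; rewrite Ex_cst.
under eq_fun => z do under eq_fun => y do rewrite tnth0 /=.
by under eq_fun => z do rewrite Ex_cst.
Qed.

Lemma Ex_iid_sum n (h : T -> R) : moderate w h ->
  Ex (iid n) (fun y => \sum_(i < n) h (tnth y i)) = n%:R * Ex P h.
Proof.
move=> mh; rewrite (Ex_sum (weight_iid n)) => [|i]; last exact: moderate_tnth.
rewrite (eq_bigr (fun=> Ex P h)) => [|i _]; last exact: Ex_iid_tnth.
by rewrite sumr_const card_ord mulr_natl.
Qed.

Lemma moderate_iid_sum n (h : T -> R) : moderate w h ->
  moderate (@wtuple n) (fun y => \sum_(i < n) h (tnth y i)).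
Proof. by move=> mh; apply: (moderate_sum (weight_iid n)) => i; exact: moderate_tnth. Qed.

(** Splitting off the first observation leaves a cross term proportional to [Ex P h = 0]. *)
Lemma Ex_iid_sqr_sum n (h : T -> R) : moderate w h -> Ex P h = 0 ->
  Ex (iid n) (fun y => (\sum_(i < n) h (tnth y i)) ^+ 2) = n%:R * Ex P (fun z => h z ^+ 2).
Proof.
move=> mh h0; elim: n => [|n IH]; first by rewrite Ex_iid0 big_ord0 expr0n mul0r.
rewrite Ex_iidl; last exact/moderateX/moderate_iid_sum.
have m1 := moderate_iid_sum n mh.
have m2 := moderateX 2 m1.
rewrite (_ : (fun z => _) = fun z => h z ^+ 2 + n%:R * Ex P (fun z => h z ^+ 2)); last first.
  apply/funext => z; have m3 := moderateZ (2 * h z) m1.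
  transitivity (Ex (iid n) (fun y => h z ^+ 2 + (2 * h z * (\sum_(i < n) h (tnth y i)) +
      (\sum_(i < n) h (tnth y i)) ^+ 2))).
    congr Ex; apply/funext => y; rewrite big_ord_recl tnth0.
    by under eq_bigr do rewrite tnthS; rewrite /=; ring.
  rewrite (ExD (weight_iid n) (moderate_cst _ _) (moderateD (weight_iid n) m3 m2)).
  rewrite (ExD (weight_iid n) m3 m2) (ExZ (weight_iid n) _ m1) (Ex_iid_sum n mh).
  by rewrite h0 IH Ex_cst !mulr0 add0r.
rewrite (ExD ww); [|exact: moderateX|exact: moderate_cst].
by rewrite Ex_cst -natr1; ring.
Qed.

Definition upd n (y : n.-tuple T) (j : 'I_n) (z : T) : n.-tuple T :=
  [tuple if i == j then z else tnth y i | i < n].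

Lemma tnth_upd n (y : n.-tuple T) j z i : tnth (upd y j z) i = if i == j then z else tnth y i.
Proof. by rewrite tnth_mktuple. Qed.

Lemma upd_tcons0 n z (y : n.-tuple T) z' : upd (tcons (z, y)) ord0 z' = tcons (z', y).
Proof.
apply: eq_from_tnth => i; rewrite tnth_upd.
by have [j ->|->] := unliftP ord0 i; rewrite ?eqxx ?tnth0// !tnthS.
Qed.

Lemma upd_tconsS n z (y : n.-tuple T) j z' :
  upd (tcons (z, y)) (lift ord0 j) z' = tcons (z, upd y j z').
Proof.
apply: eq_from_tnth => i; rewrite tnth_upd.
have [k ->|->] := unliftP ord0 i; last by rewrite !tnth0.
by rewrite !tnthS tnth_upd (inj_eq (@lift_inj _ ord0)).
Qed.

Lemma measurable_upd n (y : n.-tuple T) j : measurable_fun setT (upd y j).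
Proof.
apply/measurable_fun_tnthP => i.
rewrite (_ : _ \o _ = fun z => if i == j then z else tnth y i).
  by case: (i == j); [exact: measurable_id|exact: measurable_cst].
by apply/funext => z /=; rewrite tnth_upd.
Qed.

Lemma wtuple_upd n (y : n.-tuple T) j z : wtuple (upd y j z) <= wtuple y * w z.
Proof.
rewrite /wtuple (bigD1 j)//= [in leRHS](bigD1 j)//= tnth_upd eqxx mulrC.
rewrite (eq_bigr (fun i => w (tnth y i))) => [|i /negPf ij]; last by rewrite tnth_upd ij.
apply: ler_wpM2r; first by rewrite ltW// (weight_gt0 ww).
apply: ler_peMl; last exact: weight_ge1 ww _.
by apply: prodr_ge0 => i _; rewrite ltW ?(weight_gt0 ww).
Qed.

Lemma moderate_upd n (y : n.-tuple T) j F : moderate (@wtuple n) F -> moderate w (fun z => F (upd y j z)).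
Proof.
apply: (@moderate_comp _ _ _ _ _ _ _ _ (wtuple y) 1).
- exact: measurable_upd.
- by rewrite ltW// (weight_gt0 (weight_iid _)).
- by move=> x; rewrite ltW// (weight_gt0 (weight_iid _)).
- by move=> x; rewrite expr1 wtuple_upd.
Qed.

(** Averaging reduces variance: after centring [K] in its second argument to [Lf], this is Jensen's
    inequality for the square in [z], followed by an exchange of the integrals. *)
Lemma evar_Ex_le (K : T * T -> R) : moderate (prod_weight w w) K ->
  evar P (fun z' => Ex P (fun z => K (z, z'))) <= Ex P (fun z => evar P (fun z' => K (z, z'))).
Proof.
move=> mK; have w2 := weight_prod ww ww.
pose h z := Ex P (fun z' => K (z, z')).
have mh : moderate w h by exact (moderate_Ex2 ww ww mK).
have mh2 : moderate (prod_weight w w) (fun zz => h zz.1).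
  apply: (@moderate_comp _ _ _ _ _ _ _ _ 1 1 _ _ _ _ _ mh) => //.
  - by move=> x; rewrite ltW// (weight_gt0 ww).
  - move=> x; rewrite expr1 mul1r /prod_weight ler_peMr ?(weight_ge1 ww)//.
    by rewrite ltW// (weight_gt0 ww).
pose Lf zz := K zz - h zz.1.
have mL : moderate (prod_weight w w) Lf by exact (moderateB w2 mK mh2).
have EE : Ex P (fun z' => Ex P (fun z => K (z, z'))) = Ex P h.
  by rewrite -(Ex_fubini2 ww ww mK) -(Ex_fubini1 ww ww mK).
rewrite /evar EE.
have -> : (fun z' => (Ex P (fun z => K (z, z')) - Ex P h) ^+ 2) = (fun z' => Ex P (fun z => Lf (z, z')) ^+ 2).
  apply/funext => z'; rewrite /Lf/= (ExB ww)//; exact (moderate_pair1 ww ww z' mK).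
have mL2 : moderate (prod_weight w w) (fun zz => Lf zz ^+ 2) by exact: moderateX.
rewrite -[leRHS](Ex_fubini1 ww ww mL2) (Ex_fubini2 ww ww mL2).
apply: (Ex_le ww); [exact (moderateX 2 (moderate_Ex1 ww ww mL))|exact (moderate_Ex1 ww ww mL2)|move=> z'].
by apply: (sqr_Ex_le ww); exact (moderate_pair1 ww ww z' mL).
Qed.

(** The conditional variance in observation [j] is bounded by the average over that observation of a
    function [G j] of the whole sample, because the gradient bounds used later involve the deviation
    of the whole sample, observation [j] included. *)
Lemma efron_stein n (F : n.-tuple T -> R) (G : 'I_n -> n.-tuple T -> R) :
  moderate (@wtuple n) F -> (forall j, moderate (@wtuple n) (G j)) ->
  (forall j y, evar P (fun z => F (upd y j z)) <= Ex P (fun z => G j (upd y j z))) ->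
  evar (iid n) F <= \sum_(j < n) Ex (iid n) (G j).
Proof.
elim: n F G => [|n IH] F G mF mG FG.
  rewrite big_ord0 (evarE (weight_iid 0))// !Ex_iid0 subrr//.
have wn := weight_iid n; have mF2 := moderateX 2 mF.
pose h y := Ex P (fun z => F (tcons (z, y))).
have mh : moderate (@wtuple n) h by exact: moderate_iidr.
have mh2 : moderate (@wtuple n) (fun y => h y ^+ 2) by exact: moderateX.
(* Law of total variance; [h] is the conditional mean given all observations but the first. *)
have -> : evar (iid n.+1) F = Ex (iid n) (fun y => evar P (fun z => F (tcons (z, y)))) + evar (iid n) h.
  rewrite (evarE (weight_iid _))// (evarE wn)// !Ex_iidr//.
  have -> : (fun y => evar P (fun z => F (tcons (z, y)))) = fun y => Ex P (fun z => F (tcons (z, y)) ^+ 2) - h y ^+ 2.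
    by apply/funext => y; rewrite (evarE ww)//; exact: moderate_tconsl.
  rewrite (ExB wn)//; first by rewrite -/h; ring.
  exact: moderate_iidr mF2.
rewrite big_ord_recl; apply: lerD.
  rewrite Ex_iidr//; apply: (Ex_le wn) => [||y].
  - have -> : (fun y => evar P (fun z => F (tcons (z, y)))) = fun y => Ex P (fun z => F (tcons (z, y)) ^+ 2) - h y ^+ 2.
      by apply/funext => y; rewrite (evarE ww)//; exact: moderate_tconsl.
    by apply: (moderateB wn) => //; exact: moderate_iidr mF2.
  - exact: moderate_iidr.
  (* [FG] is applied at a full sample, which needs some first entry [z0]; over an empty [T] every
     function is zero. *)
  - have [x0|nox] := pselect (inhabited T).
      have [z0] := x0; have := FG ord0 (tcons (z0, y)).
      by under eq_fun do rewrite upd_tcons0; under [X in Ex P X]eq_fun do rewrite upd_tcons0.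
    have E (k : T -> R) : Ex P k = 0.
      rewrite (_ : k = fun=> 0) ?Ex_cst//.
      by apply/funext => z; exfalso; apply: nox; constructor.
    by rewrite /evar !E.
have {}IH := IH h (fun j y => Ex P (fun z => G (lift ord0 j) (tcons (z, y)))) mh.
rewrite (eq_bigr (fun j => Ex (iid n) (fun y => Ex P (fun z => G (lift ord0 j) (tcons (z, y)))))); last first.
  by move=> j _; rewrite Ex_iidr.
apply: IH => [j|j y]; first exact: moderate_iidr.
(* For a later observation the variance is that of an average over the first one; [evar_Ex_le] moves
   this average outside, where [FG] applies. *)
pose u (zz : T * T) := tcons (zz.1, upd y j zz.2).
have mu (f : n.+1.-tuple T -> R) : moderate (@wtuple n.+1) f -> moderate (prod_weight w w) (fun zz => f (u zz)).
  apply: (@moderate_comp _ _ _ _ _ _ _ _ (wtuple y) 1).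
  - apply: measurable_cons; first exact: measurable_fst.
    exact: (measurableT_comp (measurable_upd y j) measurable_snd).
  - by rewrite ltW// (weight_gt0 wn).
  - by move=> x; rewrite ltW// (weight_gt0 (weight_iid _)).
  - move=> zz; rewrite wtuple_tcons /prod_weight expr1 [leRHS]mulrCA ler_wpM2l ?wtuple_upd//.
    by rewrite ltW// (weight_gt0 ww).
apply: le_trans (evar_Ex_le (mu _ mF)) _.
rewrite -(Ex_fubini2 ww ww (mu _ (mG _))) (Ex_fubini1 ww ww (mu _ (mG _))).
apply: (Ex_le ww) => [||z].
- have mF' := mu _ mF; have mF2' := mu _ mF2.
  have -> : (fun z => evar P (fun z' => F (u (z, z')))) = fun z => Ex P (fun z' => F (u (z, z')) ^+
      2) - Ex P (fun z' => F (u (z, z'))) ^+ 2.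
    by apply/funext => z; rewrite (evarE ww)//; exact: (moderate_pair2 ww ww z mF').
  apply: (moderateB ww); first exact: (moderate_Ex2 ww ww mF2').
  by apply: moderateX; exact: (moderate_Ex2 ww ww mF').
- exact: (moderate_Ex2 ww ww (mu _ (mG _))).
- have := FG (lift ord0 j) (tcons (z, y)).
  by under eq_fun do rewrite upd_tconsS; under [X in Ex P X]eq_fun do rewrite upd_tconsS.
Qed.

End iid_sample.

(** * Sums of independent variables *)

Section law_of_sample.
Context {R : realType} dT {T : measurableType dT} (P : probability T R).
Context dO {Omega : measurableType dO} (Q : probability Omega R).
Local Open Scope ereal_scope.

Definition box n (B : 'I_n -> set T) : set (n.-tuple T) :=
  \bigcap_(j in [set: 'I_n]) ((fun y => tnth y j) @^-1` B j).

Lemma measurable_box n (B : 'I_n -> set T) : (forall j, measurable (B j)) -> measurable (box B).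
Proof.
move=> mB; apply: fin_bigcap_measurable => [|i _]; first exact: finite_finset.
by rewrite -[X in measurable X]setTI; exact: measurable_tnth.
Qed.

Lemma iid_box n (B : 'I_n -> set T) : (forall j, measurable (B j)) ->
  iid P n (box B) = \prod_(j < n) P (B j).
Proof.
elim: n B => [|n IH] B mB.
  by rewrite big_ord0 /= diracE mem_set// => -[].
rewrite big_ord_recl -(IH (fun j => B (lift ord0 j)))//.
rewrite -product_measure1E//; last exact: measurable_box.
rewrite -[LHS]/((P \x iid P n) (@tcons _ T n @^-1` box B)).
congr ((P \x iid P n) _); apply/seteqP; split => [[z y] /= h|[z y] [/= h1 h2] j _ /=].
  split=> [|j _] /=; first by have := h ord0 I; rewrite /= tnth0.
  by have := h (lift ord0 j) I; rewrite /= tnthS.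
by have [k ->|->] := unliftP ord0 j; rewrite ?tnthS ?tnth0//; exact: h2.
Qed.

Lemma measurable_boxE n :
  measurable = <<s [set A | exists2 B : 'I_n -> set T, (forall j, measurable (B j)) & A =
      box B] >> :> set (set (n.-tuple T)).
Proof.
apply/seteqP; split => A; last first.
  move=> hA; have := hA; apply: smallest_sub; first exact: sigma_algebra_measurable.
  by move=> _ [B mB ->]; exact: measurable_box.
move=> hA; have := hA; apply: smallest_sub; first exact: smallest_sigma_algebra.
rewrite -bigcup_seq => C [/= i _ [B mB <-]]; apply: sub_sigma_algebra.
exists (fun j => if j == i then B else setT) => [j|]; first by case: ifP.
apply/seteqP; split => y /=.
  by move=> [_ h] j _ /=; case: eqP => // ->.
by move=> h; split => //; have := h i I; rewrite /= eqxx.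
Qed.

Variables (n : nat) (X : 'I_n -> Omega -> T).
Hypothesis mX : forall j, measurable_fun setT (X j).
Hypothesis QX : forall B : 'I_n -> set T, (forall j, measurable (B j)) ->
  Q (\bigcap_(j in [set: 'I_n]) (X j @^-1` B j)) = \prod_(j < n) P (B j).

Definition sample (o : Omega) : n.-tuple T := [tuple X j o | j < n].

Lemma measurable_sample : measurable_fun setT sample.
Proof.
apply/measurable_fun_tnthP => j.
by rewrite (_ : _ \o _ = X j)//; apply/funext => o /=; rewrite tnth_mktuple.
Qed.

HB.instance Definition _ := isMeasurableFun.Build _ _ _ _ sample measurable_sample.

(** Boxes generate the sigma-algebra and are stable under intersection, and on boxes the two
    measures agree by [QX]. *)
Lemma sample_law A : measurable A -> distribution Q sample A = iid P n A.
Proof.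
apply: (@measure_unique _ R (n.-tuple T) [set A | exists2 B : 'I_n -> set T, (forall j,
    measurable (B j)) & A = box B] (fun=> setT)).
- exact: measurable_boxE.
- move=> _ _ [B mB ->] [C mC ->]; exists (fun j => B j `&` C j) => [j|]; first exact: measurableI.
  by rewrite /box -bigcapI.
- by move=> _; exists (fun=> setT) => //; apply/seteqP; split=> // y _ j _.
- by rewrite bigcup_const//; exists 0%N.
- move=> _ [B mB ->]; transitivity (iid P n (box B)) => //; rewrite iid_box// -QX//.
  rewrite -[LHS]/(Q (sample @^-1` box B)); congr (Q _).
  by apply/seteqP; split => o /= h j _; have := h j I; rewrite /= tnth_mktuple.
- by move=> _; rewrite -[X in (X < _)%E]/(Q (sample @^-1` setT)) preimage_setT probability_setT ltry.
Qed.

Lemma ge0_integral_sample (f : n.-tuple T -> \bar R) :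
  measurable_fun setT f -> (forall y, 0 <= f y) ->
  \int[Q]_o f (sample o) = \int[iid P n]_y f y.
Proof.
move=> mf f0; transitivity (\int[distribution Q sample]_y f y).
  by rewrite /distribution (ge0_integral_pushforward measurable_sample).
by apply: eq_measure_integral => A mA _; exact: sample_law.
Qed.

Lemma Ex_sample (w : T -> R) (f : n.-tuple T -> R) : weight P w -> moderate (wtuple w (n:=n)) f ->
  Ex Q (fun o => f (sample o)) = Ex (iid P n) f.
Proof.
move=> ww mf; have hf := moderate_integrable (weight_iid ww n) mf.
have mfE : measurable_fun setT (EFin \o f) by apply/measurable_EFinP; case: mf.
have hs : Q.-integrable (sample @^-1` setT) ((EFin \o f) \o sample).
  apply/integrableP; split; first exact: (measurableT_comp mfE measurable_sample).
  have [_] := integrableP _ _ _ hf.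
  by rewrite -ge0_integral_sample//; exact: measurableT_comp.
rewrite /Ex /Rintegral; congr fine.
transitivity (\int[distribution Q sample]_y (f y)%:E).
  by rewrite /distribution (integral_pushforward measurable_sample mfE hs).
by apply: eq_measure_integral => A mA _; exact: sample_law.
Qed.

End law_of_sample.

(** * Moment inequalities for sums *)

Section moments.
Context {R : realType}.

(** Chebyshev's sum inequality for similarly ordered families: the double sum of
    [(a i - a j) (b i - b j)] is nonnegative and expands to twice the difference of the two
    sides. *)
Lemma chebyshev_sum d (a b : 'I_d -> R) :
  (forall i j, 0 <= (a i - a j) * (b i - b j)) ->
  (\sum_i a i) * (\sum_i b i) <= d%:R * \sum_i (a i * b i).
Proof.
move=> h.
have : 0 <= \sum_i \sum_j (a i - a j) * (b i - b j).
  by apply: sumr_ge0 => i _; apply: sumr_ge0 => j _.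
have E : \sum_i \sum_j (a i - a j) * (b i - b j) =
  2 * (d%:R * \sum_i (a i * b i)) - 2 * ((\sum_i a i) * (\sum_i b i)).
  transitivity (\sum_i (d%:R * (a i * b i) - a i * (\sum_j b j) - b i * (\sum_j a j) + \sum_j a j * b j)).
    apply: eq_bigr => i _.
    transitivity (\sum_(j < d) (a i * b i - a i * b j - b i * a j + a j * b j)).
      by apply: eq_bigr => j _; ring.
    by rewrite !(big_split, sumrN)/= sumr_const card_ord -!mulr_sumr mulr_natl.
  rewrite !(big_split, sumrN)/= -!mulr_sumr -!mulr_suml sumr_const card_ord -mulr_natl; ring.
by rewrite E; lra.
Qed.

(** Iterated Chebyshev inequality, since [a] and its powers are similarly ordered. It turns moments
    of [d] coordinates into moments of a Euclidean norm. *)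
Lemma power_mean d (a : 'I_d -> R) q : (forall i, 0 <= a i) ->
  (\sum_i a i) ^+ q.+1 <= d%:R ^+ q * \sum_i a i ^+ q.+1.
Proof.
move=> a0; elim: q => [|q IH]; first by rewrite expr0 mul1r.
have s0 : 0 <= \sum_i a i by apply: sumr_ge0.
rewrite exprS; apply: le_trans (ler_wpM2l s0 IH) _.
rewrite mulrCA [d%:R ^+ q.+1]exprSr -mulrA ler_wpM2l ?exprn_ge0//.
under [X in _ <= _ * X]eq_bigr do rewrite exprS.
apply: chebyshev_sum => i j.
have [ij|/ltW ij] := leP (a i) (a j).
  by rewrite mulr_le0// ?subr_le0// lerXn2r ?nnegrE.
by rewrite mulr_ge0// ?subr_ge0// lerXn2r ?nnegrE.
Qed.

(** Raise [z / (2k) <= expR (z / (2k))] to the power [2k]; the two exponentials account for the two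
    signs of [x]. *)
Lemma expr_le_expR k (x : R) : x ^+ (2 * k) <= (2 * k)%:R ^+ (2 * k) * (expR x + expR (- x)).
Proof.
have [->|k0] := posnP k.
  by rewrite muln0 !expr0 mul1r; have := expR_ge1Dx x; have := expR_ge1Dx (- x); lra.
have h (z : R) : 0 <= z -> z ^+ (2 * k) <= (2 * k)%:R ^+ (2 * k) * expR z.
  move=> z0; have k2 : (0 : R) < (2 * k)%:R by rewrite ltr0n muln_gt0.
  have -> : expR z = expR (z / (2 * k)%:R) ^+ (2 * k).
    by rewrite -expRM_natl; congr expR; rewrite mulrC -mulrA mulVf ?mulr1 ?gt_eqF.
  rewrite -exprMn; apply: lerXn2r; rewrite ?nnegrE//.
  rewrite mulrC -ler_pdivrMr//; apply: le_trans (expR_ge1Dx _).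
  by rewrite lerDr.
have c0 : (0 : R) <= (2 * k)%:R ^+ (2 * k) by rewrite exprn_ge0.
have [x0|/ltW x0] := leP 0 x.
  by apply: le_trans (h _ x0) _; rewrite ler_wpM2l// lerDl expR_ge0.
have -> : x ^+ (2 * k) = (- x) ^+ (2 * k) by rewrite !exprM sqrrN.
by apply: le_trans (h (- x) _) _; rewrite ?oppr_ge0// ler_wpM2l// lerDr expR_ge0.
Qed.

Context dT {T : measurableType dT} (P : probability T R) (w : T -> R).
Hypothesis ww : weight P w.

Lemma mgf_iid n (h : T -> R) (a t : R) :
  moderate w (fun z => expR (t * h z)) -> Ex P (fun z => expR (t * h z)) <= expR a ->
  moderate (wtuple w (n:=n)) (fun y => expR (t * \sum_(i < n) h (tnth y i))) /\
  Ex (iid P n) (fun y => expR (t * \sum_(i < n) h (tnth y i))) <= expR (n%:R * a).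
Proof.
move=> mh ha.
have m k : moderate (wtuple w (n:=k)) (fun y => expR (t * \sum_(i < k) h (tnth y i))).
  have -> : (fun y : k.-tuple T => expR (t * \sum_(i < k) h (tnth y i))) = (fun y =>
      \prod_(i < k) expR (t * h (tnth y i))).
    by apply/funext => y; rewrite mulr_sumr expR_sum.
  elim: (index_enum _) => [|i s IH].
    by under eq_fun do rewrite big_nil; exact: moderate_cst.
  by under eq_fun do rewrite big_cons; apply: moderateM => //; exact (moderate_tnth ww i mh).
split=> //; elim: n => [|n IH]; first by rewrite Ex_iid0 big_ord0 mulr0 mul0r expR0.
rewrite (Ex_iidl ww)//.
rewrite (_ : (fun z => _) = fun z => Ex (iid P n) (fun y => expR (t * \sum_(i < n) h (tnth y i))) * expR (t * h z)).
  rewrite (ExZ ww)// -natr1 mulrDl mul1r expRD.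
  by rewrite ler_pM// Ex_ge0// => y; exact: expR_ge0.
apply/funext => z; rewrite [RHS]mulrC -(ExZ (weight_iid ww n) _ (m n)); congr Ex; apply/funext => y.
by rewrite big_ord_recl tnth0 mulrDr expRD; under eq_bigr do rewrite tnthS.
Qed.

Lemma subgaussian_moment n (h : T -> R) (a : R) q : (0 < n)%N -> 0 < a ->
  moderate w h -> (forall t, moderate w (fun z => expR (t * h z))) ->
  (forall t, Ex P (fun z => expR (t * h z)) <= expR (a * t ^+ 2)) ->
  Ex (iid P n) (fun y => (\sum_(i < n) h (tnth y i)) ^+ (2 * q)) <=
  (2 * q)%:R ^+ (2 * q) * (2 * expR 1) * (a * n%:R) ^+ q.
Proof.
move=> n0 a0 mh0 mh hE.
(* With this [t] one has [n a t^2 = 1], so the exponential moments at [t] and at [- t] are both at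
   most [expR 1]. *)
pose t := (Num.sqrt (a * n%:R))^-1.
have an0 : 0 < a * n%:R by rewrite mulr_gt0// ltr0n.
have t0 : 0 < t by rewrite invr_gt0 sqrtr_gt0.
have tE : t ^+ 2 * (a * n%:R) = 1.
  by rewrite exprVn sqr_sqrtr ?(ltW an0)// mulVf ?gt_eqF.
have [m1 h1] := @mgf_iid n h (a * t ^+ 2) t (mh t) (hE t).
have [m2 h2] := @mgf_iid n h (a * (- t) ^+ 2) (- t) (mh _) (hE _).
have E1 : n%:R * (a * t ^+ 2) = 1 by rewrite -[RHS]tE; ring.
rewrite sqrrN E1 in h2; rewrite E1 in h1.
have mS := moderate_iid_sum ww n mh0.
have wn := weight_iid ww n.
have tq : 0 < t ^+ (2 * q) by rewrite exprn_gt0.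
rewrite -(ler_pM2l tq) -(ExZ wn); last exact: moderateX.
set c := (2 * q)%:R ^+ (2 * q).
have -> : t ^+ (2 * q) * (c * (2 * expR 1) * (a * n%:R) ^+ q) = c * (expR 1 + expR 1).
  by rewrite exprM mulrCA -exprMn tE expr1n; ring.
apply: (@le_trans _ _ (Ex (iid P n) (fun y => c * (expR (t * \sum_(i < n) h (tnth y i)) + expR (- t *
    \sum_(i < n) h (tnth y i)))))).
  apply: (Ex_le wn) => [||y].
  - exact/moderateZ/moderateX.
  - exact/moderateZ/(moderateD wn m1 m2).
  - by rewrite -exprMn mulNr; exact: expr_le_expR.
rewrite (ExZ wn _ (moderateD wn m1 m2)) (ExD wn m1 m2) ler_wpM2l ?exprn_ge0//.
exact: lerD.
Qed.

Lemma exprD_le2 q (a b : R) : 0 <= a -> 0 <= b -> (a + b) ^+ q <= 2 ^+ q * (a ^+ q + b ^+ q).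
Proof.
wlog ab : a b / a <= b => [H a0 b0|a0 b0].
  have [ab|/ltW ab] := leP a b; first exact: H.
  by rewrite addrC [a ^+ q + _]addrC; exact: H.
apply: (@le_trans _ _ ((2 * b) ^+ q)).
  by apply: lerXn2r; rewrite ?nnegrE; lra.
by rewrite exprMn ler_wpM2l ?exprn_ge0// lerDr exprn_ge0.
Qed.

(** Remainder constants of [hilbert_increment]: multiplying the expansion by one more factor
    [A + t <= 2 * G] doubles the old remainder, and [t ^+ 2 <= 9 * G * B ^+ 2] produces the new
    one. *)
Fixpoint hilbert_step (q : nat) : R := if q is q'.+1 then 9 * q'.+1%:R + 2 * hilbert_step q' else 0.

Lemma hilbert_step_ge0 q : 0 <= hilbert_step q.
Proof. by elim: q => //= q IH; rewrite addr_ge0// mulr_ge0. Qed.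

(** The part linear in [v] is kept exactly, because it averages to zero for centred [v]. What is
    left is of order [B^2], so that adding one summand increases the moment of order [2 (q + 1)]
    only by terms of order [B^2] times a moment of order [2 q]. *)
Lemma hilbert_increment q D (s v : 'rV[R]_D) (B : R) : enorm v <= B ->
  enorm (v + s) ^+ (2 * q.+1) <=
  enorm s ^+ (2 * q.+1) + q.+1%:R * enorm s ^+ (2 * q) * (2 * dot v s + enorm v ^+ 2)
  + hilbert_step q * B ^+ 2 * (enorm s ^+ 2 + B ^+ 2) ^+ q.
Proof.
move=> vB; rewrite !exprM.
have B0 : 0 <= B := le_trans (enorm_ge0 v) vB.
have E : enorm (v + s) ^+ 2 = enorm s ^+ 2 + (2 * dot v s + enorm v ^+ 2).
  by rewrite !sqr_enorm !(dotDl, dotDr) (dotC s v); ring.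
have cs := cauchy_schwarz v s; have v0 := enorm_ge0 v; have s0 := enorm_ge0 s.
set t := 2 * _ + _ in E *.
have tB : `|t| <= 2 * enorm s * B + B ^+ 2.
  apply: le_trans (ler_normD _ _) _; rewrite normrM ger0_norm// [`|_ ^+ 2|]ger0_norm ?sqr_ge0//.
  by move: cs; nra.
have A'0 : 0 <= enorm s ^+ 2 + t by rewrite -E sqr_ge0.
rewrite E; move: tB A'0; set A := enorm s ^+ 2 => tB A'0.
have A0 : 0 <= A by exact: sqr_ge0.
set G := A + B ^+ 2.
have B20 : 0 <= B ^+ 2 by exact: sqr_ge0.
have G0 : 0 <= G by rewrite addr_ge0.
have A2G : A + t <= 2 * G.
  have := ler_norm t; have := sqr_ge0 (enorm s - B); rewrite /G /A; nra.
have t2 : t ^+ 2 <= 9 * G * B ^+ 2.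
  rewrite -real_normK ?num_real//.
  apply: (@le_trans _ _ ((2 * enorm s * B + B ^+ 2) ^+ 2)).
    by rewrite lerXn2r ?nnegrE// addr_ge0// !mulr_ge0.
  have -> : (2 * enorm s * B + B ^+ 2) ^+ 2 = (2 * enorm s + B) ^+ 2 * B ^+ 2 by ring.
  rewrite ler_wpM2r// /G /A; have := sqr_ge0 (enorm s - B); have := sqr_ge0 B; have := sqr_ge0 (enorm s); nra.
elim: q => [|q IH]; first by rewrite !expr1 !expr0 /= mul1r mul0r mul0r addr0 mul1r.
rewrite exprS; apply: le_trans (ler_wpM2l A'0 IH) _ => /=.
have c0 := hilbert_step_ge0 q; set c := hilbert_step q in c0 *.
have AG : A ^+ q <= G ^+ q by rewrite lerXn2r ?nnegrE// lerDl.
have Aq0 : 0 <= A ^+ q by rewrite exprn_ge0.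
have Gq0 : 0 <= G ^+ q by rewrite exprn_ge0.
have h1 : q.+1%:R * A ^+ q * t ^+ 2 <= q.+1%:R * G ^+ q * (9 * G * B ^+ 2).
  by rewrite -[leLHS]mulrA -[leRHS]mulrA ler_wpM2l// ler_pM// sqr_ge0.
have h2 : (A + t) * (c * B ^+ 2 * G ^+ q) <= (2 * G) * (c * B ^+ 2 * G ^+ q).
  by rewrite ler_wpM2r// !mulr_ge0.
have -> : (A + t) * (A ^+ q.+1 + q.+1%:R * A ^+ q * t + c * B ^+ 2 * G ^+ q) =
   A * A ^+ q.+1 + (A ^+ q.+1 * t + q.+1%:R * (A * A ^+ q) * t) + q.+1%:R * A ^+ q * t ^+ 2 + (A + t) *
       (c * B ^+ 2 * G ^+ q) by ring.
rewrite -!exprS -[q.+2%:R]natr1 [G ^+ q.+1]exprS.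
apply: le_trans (lerD (lerD (lexx _) h1) h2) _; rewrite le_eqVlt; apply/orP; left; apply/eqP; ring.
Qed.

(** The recursion that closes the induction on [q] in [hilbert_moment]; the factor [2 ^+ q'] comes
    from [exprD_le2]. *)
Fixpoint hilbert_const (q : nat) : R :=
  if q is q'.+1 then q'.+1%:R * hilbert_const q' + hilbert_step q' * (2 ^+ q' * (hilbert_const q' + 1)) else 1.

Lemma hilbert_const_ge0 q : 0 <= hilbert_const q.
Proof.
elim: q => //= q IH; apply: addr_ge0; first exact: mulr_ge0.
by rewrite mulr_ge0 ?hilbert_step_ge0// mulr_ge0 ?exprn_ge0 ?addr_ge0.
Qed.

Section vector_sums.
Variables (D : nat) (h : T -> 'rV[R]_D) (B : R).
Hypothesis mh : forall i, moderate w (fun z => h z ord0 i).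
Hypothesis h0 : forall i, Ex P (fun z => h z ord0 i) = 0.
Hypothesis hB : forall z, enorm (h z) <= B.
Hypothesis B_ge0 : 0 <= B.

Lemma moderate_sum_coord n i : moderate (wtuple w (n:=n)) (fun y => (\sum_(j < n) h (tnth y j)) ord0 i).
Proof.
under eq_fun do rewrite summxE.
by apply: (moderate_sum (weight_iid ww n)) => j; exact: (moderate_tnth ww j (mh i)).
Qed.

Lemma moderate_enorm_sum n q : moderate (wtuple w (n:=n)) (fun y => enorm (\sum_(j < n) h (tnth y j)) ^+ (2 * q)).
Proof.
under eq_fun do rewrite exprM sqr_enorm.
apply: moderateX; apply: (moderate_sum (weight_iid ww n)) => i.
by apply: moderateM; exact: moderate_sum_coord.
Qed.

(** The constant does not depend on the dimension [D]: only the norm bound [B] and the inner product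
    structure enter. Outer induction on the power, inner induction on the number of summands. *)
Lemma hilbert_moment q n :
  Ex (iid P n) (fun y => enorm (\sum_(j < n) h (tnth y j)) ^+ (2 * q)) <=
  hilbert_const q * (n%:R * B ^+ 2) ^+ q.
Proof.
elim: q n => [|q IHq] n.
  by under eq_fun do rewrite muln0 expr0; rewrite Ex_cst mul1r.
have B2 : 0 <= B ^+ 2 by exact: sqr_ge0.
(* Written as [n * n^q], the bound grows by at least [(n + 1)^q] from [n] to [n + 1], which is the
   size of the increment supplied by the outer induction. *)
suff H : Ex (iid P n) (fun y => enorm (\sum_(j < n) h (tnth y j)) ^+ (2 * q.+1)) <=
    hilbert_const q.+1 * B ^+ 2 ^+ q.+1 * (n%:R * n%:R ^+ q).
  apply: le_trans H _; rewrite [(n%:R * _) ^+ _]exprMn [n%:R ^+ q.+1]exprS.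
  by rewrite le_eqVlt; apply/orP; left; apply/eqP; ring.
elim: n => [|n IH].
  by rewrite Ex_iid0 big_ord0 enorm0 mul0r mulr0 expr0n muln_eq0.
have wn := weight_iid ww n.
rewrite (Ex_iidr ww); last exact: moderate_enorm_sum.
pose S (y : n.-tuple T) := \sum_(j < n) h (tnth y j).
have mS k : moderate (wtuple w (n:=n)) (fun y => enorm (S y) ^+ (2 * k)) by exact: moderate_enorm_sum.
have mG : moderate (wtuple w (n:=n)) (fun y => (enorm (S y) ^+ 2 + B ^+ 2) ^+ q).
  apply: moderateX; apply: (moderateD wn); last exact: moderate_cst.
  by have := mS 1; rewrite muln1.
pose K := fun y => enorm (S y) ^+ (2 * q.+1) + (q.+1%:R * B ^+ 2 * enorm (S y) ^+ (2 * q) +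
    hilbert_step q * B ^+ 2 * (enorm (S y) ^+ 2 + B ^+ 2) ^+ q).
have mK2 : moderate (wtuple w (n:=n)) (fun y => q.+1%:R * B ^+ 2 * enorm (S y) ^+ (2 * q) +
    hilbert_step q * B ^+ 2 * (enorm (S y) ^+ 2 + B ^+ 2) ^+ q).
  by apply: (moderateD wn); exact: moderateZ.
have mK : moderate (wtuple w (n:=n)) K by exact (moderateD wn (mS q.+1) mK2).
apply: (@le_trans _ _ (Ex (iid P n) K)).
  apply: (Ex_le wn) => //; first exact: (moderate_iidr ww (moderate_enorm_sum _ _)).
  move=> y; rewrite /K.
  have E1 : Ex P (fun z => 2 * dot (h z) (S y)) = 0.
    rewrite (ExZ ww); last by apply: (moderate_sum ww) => i; apply: moderateM => //; exact: moderate_cst.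
    rewrite (Ex_sum ww) => [|i]; last by apply: moderateM => //; exact: moderate_cst.
    rewrite big1 ?mulr0// => i _.
    by under eq_fun do rewrite mulrC; rewrite (ExZ ww)// h0 mulr0.
  have mdot : moderate w (fun z => 2 * dot (h z) (S y)).
    by apply: moderateZ; apply: (moderate_sum ww) => i; apply: moderateM => //; exact: moderate_cst.
  have mB2 : moderate w (fun z : T => B ^+ 2) by exact: moderate_cst.
  pose c1 := q.+1%:R * enorm (S y) ^+ (2 * q).
  have c10 : 0 <= c1 by rewrite mulr_ge0// exprn_ge0// enorm_ge0.
  pose c2 := hilbert_step q * B ^+ 2 * (enorm (S y) ^+ 2 + B ^+ 2) ^+ q.
  have mt : moderate w (fun z => 2 * dot (h z) (S y) + B ^+ 2) by exact: (moderateD ww mdot mB2).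
  have mtc : moderate w (fun z => c1 * (2 * dot (h z) (S y) + B ^+ 2) + c2).
    by apply: (moderateD ww); [exact: moderateZ|exact: moderate_cst].
  apply: (@le_trans _ _ (Ex P (fun z => enorm (S y) ^+ (2 * q.+1) + (c1 * (2 * dot (h z) (S y) + B ^+ 2) + c2)))).
    apply: (Ex_le ww).
    - exact: (moderate_tconsl ww (moderate_enorm_sum _ _)).
    - by apply: (moderateD ww) => //; exact: moderate_cst.
    - move=> z; rewrite big_ord_recl tnth0; under eq_bigr do rewrite tnthS.
      apply: le_trans (hilbert_increment q _ (hB z)) _.
      rewrite -/(S y) -/c1 -/c2 -addrA lerD2l lerD2r ler_wpM2l// lerD2l.
      by rewrite lerXn2r ?nnegrE ?enorm_ge0.
  rewrite (ExD ww (moderate_cst _ _) mtc) Ex_cst lerD2l.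
  rewrite (ExD ww (moderateZ _ mt) (moderate_cst _ _)) Ex_cst lerD2r (ExZ ww _ mt).
  by rewrite (ExD ww mdot mB2) E1 Ex_cst add0r /c1; rewrite le_eqVlt; apply/orP; left; apply/eqP; ring.
rewrite /K (ExD wn (mS _) mK2) (ExD wn (moderateZ _ (mS _)) (moderateZ _ mG)).
rewrite (ExZ wn _ (mS _)) (ExZ wn _ mG).
have G2 : Ex (iid P n) (fun y => (enorm (S y) ^+ 2 + B ^+ 2) ^+ q) <= 2 ^+ q * (hilbert_const q + 1) *
    (n.+1%:R * B ^+ 2) ^+ q.
  apply: (@le_trans _ _ (Ex (iid P n) (fun y => 2 ^+ q * (enorm (S y) ^+ (2 * q) + (B ^+ 2) ^+ q)))).
    apply: (Ex_le wn) => // [|y]; first by apply: moderateZ; apply: (moderateD wn) => //; exact: moderate_cst.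
    by rewrite exprM; apply: exprD_le2; exact: sqr_ge0.
  have mSB : moderate (wtuple w (n:=n)) (fun y => enorm (S y) ^+ (2 * q) + (B ^+ 2) ^+ q).
    by apply: (moderateD wn) => //; exact: moderate_cst.
  rewrite (ExZ wn _ mSB) (ExD wn (mS _) (moderate_cst _ _)) Ex_cst -[leRHS]mulrA ler_wpM2l ?exprn_ge0// mulrDl mul1r.
  apply: lerD.
    apply: le_trans (IHq n) _; rewrite ler_wpM2l ?hilbert_const_ge0//.
    by rewrite lerXn2r ?nnegrE ?mulr_ge0// ler_wpM2r// ler_nat.
  by rewrite lerXn2r ?nnegrE ?mulr_ge0// ler_peMl// ler1n.
have IHq' : Ex (iid P n) (fun y => enorm (S y) ^+ (2 * q)) <= hilbert_const q * (n.+1%:R * B ^+ 2) ^+ q.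
  apply: le_trans (IHq n) _; rewrite ler_wpM2l ?hilbert_const_ge0//.
  by rewrite lerXn2r ?nnegrE ?mulr_ge0// ler_wpM2r// ler_nat.
have hs := hilbert_step_ge0 q.
have hc := hilbert_const_ge0 q.+1.
have b1 : q.+1%:R * B ^+ 2 * Ex (iid P n) (fun y => enorm (S y) ^+ (2 * q)) <= q.+1%:R * B ^+ 2 *
    (hilbert_const q * (n.+1%:R * B ^+ 2) ^+ q).
  by rewrite ler_wpM2l// mulr_ge0.
have b2 := ler_wpM2l (mulr_ge0 hs B2) G2.
apply: le_trans (lerD IH (lerD b1 b2)) _.
have -> : q.+1%:R * B ^+ 2 * (hilbert_const q * (n.+1%:R * B ^+ 2) ^+ q) +
  hilbert_step q * B ^+ 2 * (2 ^+ q * (hilbert_const q + 1) * (n.+1%:R * B ^+ 2) ^+ q) =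
  hilbert_const q.+1 * B ^+ 2 ^+ q.+1 * n.+1%:R ^+ q.
  by rewrite /= ![(n.+1%:R * _) ^+ q]exprMn [(B ^+ 2) ^+ q.+1]exprS; ring.
rewrite -mulrDr ler_wpM2l//; first by rewrite mulr_ge0// exprn_ge0.
have -> : n.+1%:R * n.+1%:R ^+ q = n%:R * n.+1%:R ^+ q + n.+1%:R ^+ q :> R.
  by rewrite -{1}natr1 mulrDl mul1r.
rewrite lerD2r ler_wpM2l//.
by rewrite lerXn2r ?nnegrE// ler_nat.
Qed.

End vector_sums.
End moments.

(** * The Gibbs measure and its Fisher information *)

Lemma eq_ler {R : realType} (a b : R) : a = b -> a <= b.
Proof. by move=> ->. Qed.

Lemma expR_taylor1 {R : realType} (a : R) : `|expR a - 1 - a| <= a ^+ 2 * expR `|a|.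
Proof.
have h1 := expR_ge1Dx a; have h2 := expR_ge1Dx (- a); have p := expR_gt0 a.
have e1 : expR a * expR (- a) = 1 by rewrite -expRD subrr expR0.
rewrite ger0_norm; last by lra.
have q := expR_gt0 (- a).
have le : expR a - 1 <= a * expR a by have := ler_wpM2l (ltW p) h2; nra.
have [a0|a0] := leP 0 a.
  rewrite ger0_norm//; have : expR a - 1 - a <= a * (expR a - 1) by lra.
  move/le_trans; apply; rewrite expr2 -mulrA ler_wpM2l//.
rewrite ltr0_norm//.
have : expR a - 1 - a <= a * (expR a - 1) by lra.
move/le_trans; apply.
have : 0 <= (- a) * (expR a - 1 - a) by rewrite mulr_ge0//; lra.
have : 1 <= expR (- a) by lra.
by nra.
Qed.

(** First-order coefficients are read off from expansions with error [t^2 C]; this stands in for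
    differentiation under the integral sign. *)
Lemma eq0_of_quadratic {R : realType} (a C : R) :
  (forall t, 0 < t -> t <= 1 -> `|t * a| <= t ^+ 2 * C) -> a = 0.
Proof.
move=> h; apply/eqP; rewrite -normr_le0; apply/ler_addgt0Pr => e e0; rewrite add0r.
have C0 : 0 <= C by have := h 1 ltr01 (lexx _); rewrite expr1n !mul1r => /(le_trans (normr_ge0 _)).
pose t := Num.min 1 (e / (C + 1)).
have t0 : 0 < t by rewrite /t lt_min ltr01/= divr_gt0// ltr_wpDl.
have t1 : t <= 1 by rewrite /t ge_min lexx.
have te : t * (C + 1) <= e by rewrite -ler_pdivlMr ?ltr_wpDl// /t ge_min lexx orbT.
have := h t t0 t1; rewrite normrM gtr0_norm// expr2 -mulrA ler_pM2l//.
by move/le_trans; apply; apply: le_trans te; rewrite (ler_wpM2l (ltW t0))// lerDl.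
Qed.

Section potential_expectations.
Context {R : realType} {d : nat}.
Variables (V : potential R d) (M L m : R).
Hypotheses (M_gt0 : 0 < M) (L_gt0 : 0 < L) (m_gt0 : 0 < m).
Hypothesis hV : assumption1 M L m V.
Local Notation P := (gibbs V : probability 'rV[R]_d R).
Local Notation G := (gradient V).
Local Notation H := (hessian V).
Implicit Types (u v x y : 'rV[R]_d).

Let Vsc := a1_strictly_convex hV.
Let Vd := a1_twice_differentiable hV.
Let VM := a1_hessian_bounded hV.
Let VL := a1_hessian_lipschitz hV.

Lemma measurable_gradient : measurable_fun setT G.
Proof.
apply: measurable_fun_row => i; apply: continuous_measurable_row => x.
have -> : (fun t => G t ord0 i) = 'D_(delta_mx ord0 i) V by apply/funext => y; rewrite mxE.
by apply: differentiable_continuous; exact: differentiable_potential2 Vd _ _.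
Qed.

Lemma measurable_hessian u v : measurable_fun setT (fun x => dot (u *m H x) v).
Proof.
apply: measurable_sum => j; apply: measurable_funM => //.
rewrite (_ : (fun x => _) = fun x => \sum_i u ord0 i * H x i j); last by apply/funext => x; rewrite mxE.
apply: measurable_sum => i; apply: measurable_funM => //.
apply: continuous_measurable_row => x.
apply: (@continuous_comp _ _ _ H (fun A : 'M[R]_d => A i j)); first exact: (a1_continuous_hessian hV).
exact: coord_continuous.
Qed.

Lemma measurable_potential_shift u : measurable_fun setT (fun x => V (x + u)).
Proof. by apply: (measurableT_comp (pot_measurable V)); exact: measurable_rowD. Qed.

(** Translation invariance of Lebesgue measure, rewritten as a change of density of the Gibbs
    measure. *)
Lemma gibbs_shift u (F : 'rV[R]_d -> \bar R) :
  measurable_fun setT F -> (forall x, 0 <= F x)%E ->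
  (\int[P]_x F x = \int[P]_x (F (x + u)%R * (expR (V x - V (x + u)))%:E))%E.
Proof.
move=> mF F0.
have mu : measurable_fun setT (fun x => x + u) by exact: measurable_rowD.
have mE : measurable_fun setT (fun x => expR (V x - V (x + u))).
  apply: measurableT_comp => //; apply: measurable_funB; first exact: pot_measurable.
  exact: measurable_potential_shift.
have mD := measurable_gibbs_density V.
rewrite ge0_integral_gibbs// [RHS]ge0_integral_gibbs; last 2 first.
- by apply: emeasurable_funM; [exact: (measurableT_comp mF)|exact/measurable_EFinP].
- by move=> x; rewrite mule_ge0// lee_fin expR_ge0.
rewrite -(ge0_integral_translate u); last 2 first.
- by apply: emeasurable_funM => //; exact/measurable_EFinP.
- by move=> x; rewrite mule_ge0// lee_fin expR_ge0.
apply: eq_integral => x _; rewrite -muleA; congr (_ * _)%E.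
by rewrite -EFinM -expRD; congr (expR _)%:E; ring.
Qed.

Lemma mgf_pointwise u x :
  expR (dot (G x) (- u)) <= expR (M * enorm u ^+ 2) * expR (V x - V (x + u)).
Proof.
rewrite -expRD ler_expR dotNr.
by have := potential_taylor M_gt0 Vd VM x u; rewrite ler_norml => /andP[_]; lra.
Qed.

(** The score is sub-Gaussian: by Taylor's formula [<G x, u> <= M |u|^2 + V x - V (x - u)], and the
    density ratio [expR (V x - V (x - u))] integrates to 1. *)
Lemma mgf_integral u : (\int[P]_x (expR (dot (G x) u))%:E <= (expR (M * enorm u ^+ 2))%:E)%E.
Proof.
have mG u' : measurable_fun setT (fun x => expR (dot (G x) u')).
  by apply: measurableT_comp => //; apply: measurable_dot => //; exact: measurable_gradient.
have mE : measurable_fun setT (fun x => expR (V x - V (x - u))).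
  apply: measurableT_comp => //; apply: measurable_funB; first exact: pot_measurable.
  exact: measurable_potential_shift.
apply: (@le_trans _ _ (\int[P]_x ((expR (M * enorm u ^+ 2))%:E * (expR (V x - V (x - u)))%:E))%E).
  apply: ge0_le_integral => //.
  - exact/measurable_EFinP.
  - by apply/measurable_EFinP; exact: measurable_funM.
  - by move=> x _; rewrite -EFinM lee_fin -{1}(opprK u) -enormN; exact: mgf_pointwise.
rewrite ge0_integralZl_EFin ?expR_ge0//; last exact/measurable_EFinP.
rewrite (_ : (\int[P]_x _ = 1)%E) ?mule1//.
have := @gibbs_shift (- u) (fun=> 1%E) (measurable_cst _) (fun=> lee01).
under [in RHS]eq_integral do rewrite mul1e.
by move=> <-; rewrite integral_cst// mul1e [LHS]probability_setT.
Qed.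

(** The exponential of the l1 norm of the score has all moments by [mgf_integral] and dominates
    every polynomial and every exponential of linear forms in the score. *)
Definition gibbs_weight x : R := expR (\sum_i `|G x ord0 i|).
Local Notation w := gibbs_weight.

Lemma measurable_gibbs_weight : measurable_fun setT w.
Proof.
apply: measurableT_comp => //; apply: measurable_sum => i.
by apply: measurableT_comp => //; apply: measurable_row_comp; exact: measurable_gradient.
Qed.

(** The sum of the [|a i|] is at most [d] times the largest of them, and the exponential of the
    latter is bounded by one pair of terms on the right. The summand 1 covers [d = 0]. *)
Lemma expR_sum_norm_le (a : 'I_d -> R) (p : R) : 0 <= p ->
  expR (p * \sum_i `|a i|) <= 1 + \sum_i (expR (p * d%:R * a i) + expR (- (p * d%:R * a i))).
Proof.
move=> p0; have s0 : 0 <= \sum_i (expR (p * d%:R * a i) + expR (- (p * d%:R * a i))).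
  by apply: sumr_ge0 => i _; rewrite addr_ge0// expR_ge0.
have [i0 _|no] := pickP (fun _ : 'I_d => true); last first.
  by rewrite [X in p * X]big_pred0// mulr0 expR0 lerDl.
case: (@arg_maxP _ R 'I_d i0 xpredT (fun i => `|a i|) isT) => i _ hi.
apply: (@le_trans _ _ (expR (p * d%:R * a i) + expR (- (p * d%:R * a i)))); last first.
  rewrite (bigD1 i)//= addrCA lerDl addr_ge0// sumr_ge0//.
apply: (@le_trans _ _ (expR (`|p * d%:R * a i|))).
  rewrite ler_expR normrM ger0_norm ?mulr_ge0// -mulrA ler_wpM2l//.
  rewrite mulr_natl -[d in leRHS]card_ord -sumr_const ler_sum// => j _; exact: hi.
by case: (ger0P (p * d%:R * a i)) => _; rewrite ?lerDl ?lerDr expR_ge0.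
Qed.

Lemma weight_gibbs : weight P w.
Proof.
have iE u : P.-integrable setT (EFin \o (fun x => expR (dot (G x) u))).
  apply/integrableP; split.
    by apply/measurable_EFinP/measurableT_comp => //; apply: measurable_dot => //; exact: measurable_gradient.
  apply: le_lt_trans (ltry (expR (M * enorm u ^+ 2))); apply: le_trans (mgf_integral u).
  by rewrite le_eqVlt; apply/orP; left; apply/eqP/eq_integral => x _ /=; rewrite ger0_norm ?expR_ge0.
split=> [|x|p]; first exact: measurable_gibbs_weight.
  by rewrite -[1]expR0 ler_expR sumr_ge0.
pose b x := 1 + \sum_i (expR (dot (G x) ((p%:R * d%:R) *: delta_mx ord0 i)) + expR (dot (G x) (- (p%:R *
    d%:R) *: delta_mx ord0 i))).
have ib : P.-integrable setT (EFin \o b).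
  rewrite (_ : EFin \o b = (cst 1 \+ (fun x => \sum_(i < d) ((expR (dot (G x) ((p%:R *
      d%:R) *: delta_mx ord0 i)))%:E + (expR (dot (G x) (- (p%:R * d%:R) *: delta_mx ord0 i)))%:E)))%E); last first.
    apply/funext => x /=; rewrite /b EFinD; congr (_ + _)%E.
    by rewrite -sumEFin; apply: eq_bigr => i _; rewrite EFinD.
  apply: integrableD => //; first exact: finite_measure_integrable_cst.
  apply: integrable_sum => // i _.
  by apply: integrableD => //; exact: iE.
apply: le_integrable ib => //.
  by apply/measurable_EFinP/measurable_funX; exact: measurable_gibbs_weight.
move=> x _ /=; rewrite lee_fin ger0_norm ?exprn_ge0 ?expR_ge0// (le_trans _ (ler_norm _))//.
rewrite /w /b -expRM_natl; apply: le_trans (expR_sum_norm_le _ _) _ => //.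
rewrite lerD2l le_eqVlt; apply/orP; left; apply/eqP; apply: eq_bigr => i _.
by rewrite !dotZr (dotC (G x)) dot_delta mulNr.
Qed.

Local Notation mo := (moderate w).
Local Notation ww := weight_gibbs.

Lemma moderate_expG u : mo (fun x => expR (dot (G x) u)).
Proof.
split.
  by apply: measurableT_comp => //; apply: measurable_dot => //; exact: measurable_gradient.
exists 1, (Num.truncn (enorm u)).+1; split=> // x; rewrite mul1r ger0_norm ?expR_ge0//.
rewrite -expRM_natl ler_expR; apply: le_trans (ler_norm _) _; apply: le_trans (cauchy_schwarz _ _) _.
rewrite mulrC; apply: ler_pM; rewrite ?enorm_ge0//; last exact: enorm_le_coord.
exact/ltW/truncnS_gt.
Qed.

Lemma moderate_dotG u : mo (fun x => dot (G x) u).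
Proof.
have h : mo (fun x => expR (dot (G x) u) + expR (dot (G x) (- u))).
  by apply: (moderateD ww); exact: moderate_expG.
apply: moderate_le h => [|x]; first by apply: measurable_dot => //; exact: measurable_gradient.
rewrite [leRHS]ger0_norm ?addr_ge0 ?expR_ge0// dotNr.
have := expR_ge1Dx (dot (G x) u); have := expR_ge1Dx (- dot (G x) u).
have := expR_gt0 (dot (G x) u); have := expR_gt0 (- dot (G x) u).
by rewrite ler_norml => ? ? ? ?; apply/andP; split; lra.
Qed.

Lemma moderate_G i : mo (fun x => G x ord0 i).
Proof.
have := moderate_dotG (delta_mx ord0 i).
by under eq_fun do rewrite dotC dot_delta.
Qed.

Lemma moderate_hessian u v : mo (fun x => dot (u *m H x) v).
Proof.
apply: (moderate_le (g := fun=> M * enorm u * enorm v)); last exact: moderate_cst.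
  exact: measurable_hessian.
move=> x; apply: le_trans (cauchy_schwarz _ _) _.
rewrite [leRHS]ger0_norm; last by rewrite !mulr_ge0 ?enorm_ge0// ltW.
rewrite ler_wpM2r ?enorm_ge0//.
exact: hessian_bounded M_gt0 VM _ _.
Qed.

Lemma gibbs_mgf u : Ex P (fun x => expR (dot (G x) u)) <= expR (M * enorm u ^+ 2).
Proof.
have /integrable_fin_num h := moderate_integrable ww (moderate_expG u).
by rewrite -lee_fin fineK ?h//; exact: mgf_integral.
Qed.

(** * Score identities from infinitesimal translations *)

Section shift_expansion.
Variable u : 'rV[R]_d.

(** [psi t] is the density ratio of the translate by [t u]. For [t] in [(0, 1]] its logarithm is at
    most [b], it is dominated by [S] uniformly in [t], and [psi t = 1 - t a] up to [t^2 K]. *)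
Let psi (t : R) x := expR (V x - V (x + t *: u)).
Let a x := dot (G x) u.
Let S x := expR (M * enorm u ^+ 2) * (expR (dot (G x) u) + expR (dot (G x) (- u))).
Let b x := `|a x| + M * enorm u ^+ 2.
Let K x := b x ^+ 2 * S x + M * enorm u ^+ 2.

Let mS : mo S.
Proof. by apply: moderateZ; apply: (moderateD ww); exact: moderate_expG. Qed.

Let mb : mo b.
Proof. by apply: (moderateD ww); [apply: moderate_norm; exact: moderate_dotG|exact: moderate_cst]. Qed.

Let mK : mo K.
Proof.
by apply: (moderateD ww); [apply: moderateM => //; exact: moderateX|exact: moderate_cst].
Qed.

Let S_ge0 x : 0 <= S x.
Proof. by rewrite mulr_ge0 ?addr_ge0 ?expR_ge0. Qed.

Let expb x : expR (b x) <= S x.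
Proof.
rewrite /b /S addrC expRD ler_wpM2l ?expR_ge0// dotNr -/(a x).
by case: (ger0P (a x)) => _; rewrite ?lerDl ?lerDr expR_ge0.
Qed.

Let increment_le t x : 0 < t -> t <= 1 ->
  `|V x - V (x + t *: u) + t * a x| <= t ^+ 2 * (M * enorm u ^+ 2).
Proof.
move=> t0 t1; have := potential_taylor M_gt0 Vd VM x (t *: u).
rewrite dotZr enormZ (gtr0_norm t0) exprMn mulrCA -/(a x) -normrN; congr (`|_| <= _); ring.
Qed.

Let increment_le_b t x : 0 < t -> t <= 1 -> `|V x - V (x + t *: u)| <= t * b x.
Proof.
move=> t0 t1; have h := increment_le x t0 t1.
have -> : V x - V (x + t *: u) = (V x - V (x + t *: u) + t * a x) - t * a x by ring.
apply: le_trans (ler_normB _ _) _; rewrite normrM (gtr0_norm t0) /b mulrDr addrC lerD2l.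
by apply: le_trans h _; rewrite expr2 -mulrA (ler_wpM2l (ltW t0))// ler_piMl// mulr_ge0 ?sqr_ge0 ?(ltW M_gt0).
Qed.

Let b_ge0 x : 0 <= b x.
Proof. by rewrite addr_ge0// mulr_ge0 ?sqr_ge0 ?ltW. Qed.

Let psi_le t x : 0 < t -> t <= 1 -> psi t x <= S x.
Proof.
move=> t0 t1; apply: le_trans (expb x); rewrite ler_expR; apply: le_trans (ler_norm _) _.
by apply: le_trans (increment_le_b x t0 t1) _; rewrite ler_piMl.
Qed.

Let psi_expansion t x : 0 < t -> t <= 1 -> `|psi t x - 1 + t * a x| <= t ^+ 2 * K x.
Proof.
move=> t0 t1; set c := V x - V (x + t *: u).
have -> : psi t x - 1 + t * a x = (expR c - 1 - c) + (c + t * a x) by rewrite /psi; ring.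
apply: le_trans (ler_normD _ _) _; rewrite /K mulrDr; apply: lerD; last exact: increment_le.
have h := increment_le_b x t0 t1.
apply: le_trans (expR_taylor1 c) _; rewrite mulrA; apply: ler_pM; rewrite ?sqr_ge0 ?expR_ge0//.
  by rewrite -exprMn -real_normK ?num_real// lerXn2r ?nnegrE ?mulr_ge0// ltW.
apply: le_trans (expb x); rewrite ler_expR; apply: le_trans h _.
by rewrite ler_piMl.
Qed.

Let mpsi t : 0 < t -> t <= 1 -> mo (psi t).
Proof.
move=> t0 t1; apply: moderate_le mS => [|x].
  apply: measurableT_comp => //; apply: measurable_funB; first exact: pot_measurable.
  exact: measurable_potential_shift.
by rewrite !ger0_norm ?expR_ge0//; exact: psi_le.
Qed.

(** The nonnegative case is [gibbs_shift]; a signed [F] is the difference of [|F|] and [|F| - F]. *)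
Lemma Ex_shift t (F : 'rV[R]_d -> R) : 0 < t -> t <= 1 -> mo F -> mo (fun x => F (x + t *: u)) ->
  Ex P F = Ex P (fun x => F (x + t *: u) * expR (V x - V (x + t *: u))).
Proof.
move=> t0 t1.
have pos (g : 'rV[R]_d -> R) : (forall x, 0 <= g x) -> mo g ->
    Ex P g = Ex P (fun x => g (x + t *: u) * psi t x).
  move=> g0 mg; rewrite /Ex /Rintegral; congr fine.
  rewrite (gibbs_shift (t *: u))//; last by apply/measurable_EFinP; exact: moderate_measurable mg.
move=> mF mFt.
have E : F = fun x => `|F x| - (`|F x| - F x) by apply/funext => x; ring.
have mF1 := moderate_norm mF; have mF2 := moderateB ww mF1 mF.
have mFt1 := moderate_norm mFt; have mFt2 := moderateB ww mFt1 mFt.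
rewrite {1}E (ExB ww)// (pos _ _ mF1)// (pos _ _ mF2)//; last by move=> x; rewrite subr_ge0 ler_norm.
have mp := mpsi t0 t1.
rewrite -(ExB ww (moderateM mFt1 mp) (moderateM mFt2 mp)); congr Ex; apply/funext => x.
by rewrite /psi; ring.
Qed.

(** First order in [t] of the normalization [Ex P (psi t) = 1]. *)
Lemma Ex_dotG : Ex P (fun x => dot (G x) u) = 0.
Proof.
apply: (@eq0_of_quadratic _ _ (Ex P K)) => t t0 t1.
have mp := mpsi t0 t1.
have h : 1 = Ex P (psi t).
  have := Ex_shift t0 t1 (moderate_cst _ 1) (moderate_cst _ 1); rewrite Ex_cst => ->.
  by congr Ex; apply/funext => x; rewrite mul1r.
have ma := moderate_dotG u.
have mr : mo (fun x => psi t x - 1 + t * a x).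
  by apply: (moderateD ww); [apply: (moderateB ww) => //; exact: moderate_cst|exact: moderateZ].
have : Ex P (fun x => psi t x - 1 + t * a x) = t * Ex P a.
  have m1 : mo (fun x => psi t x - 1) by apply: (moderateB ww) => //; exact: moderate_cst.
  by rewrite (ExD ww m1 (moderateZ t ma)) (ExB ww mp (moderate_cst _ _)) Ex_cst -h subrr add0r (ExZ ww).
move=> <-; rewrite -(ExZ ww)//; apply: (Ex_norm_le ww) => //; first exact: moderateZ.
by move=> x; exact: psi_expansion.
Qed.

(** First order in [t] of [E <G (x + t u), v> psi t = E <G x, v> = 0]: the derivative of the score
    contributes the Hessian, that of the density the product of scores. *)
Lemma Ex_hessian_aux v : Ex P (fun x => dot (G x) v) = 0 ->
  Ex P (fun x => dot (u *m H x) v - dot (G x) v * a x) = 0.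
Proof.
move=> Ev0.
pose A x := dot (G x) v; pose B x := dot (u *m H x) v.
pose c0 := L * enorm u ^+ 2 * enorm v.
have c00 : 0 <= c0 by rewrite !mulr_ge0 ?sqr_ge0 ?enorm_ge0// ltW.
pose K2 x := `|B x| * `|a x| + (c0 * S x + (`|A x| + `|B x|) * K x).
have mA : mo A by exact: moderate_dotG.
have mB : mo B by exact: moderate_hessian.
have ma : mo a by exact: moderate_dotG.
have mK2 : mo K2.
  apply: (moderateD ww); first by apply: moderateM; exact: moderate_norm.
  apply: (moderateD ww); first exact: moderateZ.
  by apply: moderateM => //; apply: (moderateD ww); exact: moderate_norm.
have mBA : mo (fun x => B x - A x * a x) by apply: (moderateB ww) => //; exact: moderateM.
apply: (@eq0_of_quadratic _ _ (Ex P K2)) => t t0 t1.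
have mp := mpsi t0 t1.
have At x : `|dot (G (x + t *: u)) v - (A x + t * B x)| <= t ^+ 2 * c0.
  have -> : dot (G (x + t *: u)) v - (A x + t * B x) = dot (G (x + t *: u) - G x - (t *: u) *m H x) v.
    by rewrite !dotBl -scalemxAl dotZl /A /B; ring.
  apply: le_trans (cauchy_schwarz _ _) _; rewrite /c0 mulrA ler_wpM2r ?enorm_ge0//.
  apply: le_trans (gradient_taylor L_gt0 Vd VL _ _) _.
  by rewrite enormZ gtr0_norm// exprMn mulrCA.
have mAt : mo (fun x => dot (G (x + t *: u)) v).
  have mb1 : mo (fun x => `|A x| + t * `|B x| + t ^+ 2 * c0).
    apply: (moderateD ww); last exact: moderate_cst.
    by apply: (moderateD ww); [exact: moderate_norm|apply: moderateZ; exact: moderate_norm].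
  apply: moderate_le mb1 => [|x].
    apply: measurable_dot => //; apply: (measurableT_comp measurable_gradient).
    exact: measurable_rowD.
  rewrite [leRHS]ger0_norm; last first.
    apply: addr_ge0; last by apply: mulr_ge0 => //; exact: sqr_ge0.
    by apply: addr_ge0 => //; apply: mulr_ge0 => //; exact: ltW.
  rewrite -[X in `|X| <= _](subrK (A x + t * B x)).
  apply: le_trans (ler_normD _ _) _; rewrite addrC; apply: lerD => //.
  by apply: le_trans (ler_normD _ _) _; rewrite normrM (gtr0_norm t0).
have E0 : Ex P (fun x => dot (G (x + t *: u)) v * psi t x) = 0.
  by rewrite -(Ex_shift (F := fun x => dot (G x) v) t0 t1).
have m1 : mo (fun x => dot (G (x + t *: u)) v * psi t x) by exact: moderateM.
have m2 : mo (fun x => dot (G (x + t *: u)) v * psi t x - A x) by exact (moderateB ww m1 mA).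
have m3 : mo (fun x => dot (G (x + t *: u)) v * psi t x - A x - t * (B x - A x * a x)).
  by apply: (moderateB ww) => //; exact: moderateZ.
have : Ex P (fun x => dot (G (x + t *: u)) v * psi t x - A x - t * (B x - A x * a x)) = - (t *
    Ex P (fun x => B x - A x * a x)).
  by rewrite (ExB ww m2 (moderateZ t mBA)) (ExB ww m1 mA) E0 Ev0 (ExZ ww)// subrr sub0r.
move/(congr1 Num.norm); rewrite normrN => <-; rewrite -(ExZ ww)//.
apply: (Ex_norm_le ww) => //; first exact: moderateZ.
move=> x; have h1 := At x; have h2 := psi_expansion x t0 t1; have h3 := psi_le x t0 t1.
have p0 : 0 <= psi t x by rewrite expR_ge0.
set At' := dot (G (x + t *: u)) v in h1 *; set ps := psi t x in h2 h3 p0 *.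
have -> : At' * ps - A x - t * (B x - A x * a x) =
   - (t ^+ 2 * (B x * a x)) + ((At' - (A x + t * B x)) * ps + (A x + t * B x) * (ps - 1 + t * a x)) by ring.
apply: le_trans (ler_normD _ _) _; rewrite /K2 [leRHS]mulrDr; apply: lerD.
  by rewrite normrN normrM ger0_norm ?sqr_ge0// normrM.
apply: le_trans (ler_normD _ _) _; rewrite [leRHS]mulrDr; apply: lerD.
  rewrite normrM (ger0_norm p0) mulrA; apply: ler_pM => //.
rewrite normrM mulrCA; apply: ler_pM => //.
apply: le_trans (ler_normD _ _) _; rewrite lerD2l normrM (gtr0_norm t0) ler_piMl//.
Qed.

End shift_expansion.

Lemma Ex_hessian u v :
  Ex P (fun x => dot (u *m H x) v) = Ex P (fun x => dot (G x) u * dot (G x) v).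
Proof.
have mB := moderate_hessian u v.
have mAC := moderateM (moderate_dotG v) (moderate_dotG u).
have := Ex_hessian_aux u (Ex_dotG v); rewrite (ExB ww mB mAC) => /subr0_eq ->.
by congr Ex; apply/funext => x; rewrite mulrC.
Qed.

Lemma fisherE i j : fisher V i j = Ex P (fun x => G x ord0 i * G x ord0 j).
Proof.
rewrite mxE unlock /Ex /Rintegral; congr fine; apply: eq_integral => x _; congr EFin.
by rewrite mxE big_ord1 mxE.
Qed.

Lemma dot_fisher u v : dot (u *m fisher V) v = Ex P (fun x => dot (G x) u * dot (G x) v).
Proof.
have m2 i j : mo (fun x => (u ord0 i * v ord0 j) * (G x ord0 i * G x ord0 j)).
  by apply: moderateZ; apply: moderateM; exact: moderate_G.
transitivity (Ex P (fun x => \sum_j \sum_i (u ord0 i * v ord0 j) * (G x ord0 i * G x ord0 j))).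
  rewrite (Ex_sum ww) => [|j]; last by apply: (moderate_sum ww) => i.
  apply: eq_bigr => j _; rewrite (Ex_sum ww)// mxE mulr_suml; apply: eq_bigr => i _.
  by rewrite (ExZ ww); [rewrite fisherE; ring|apply: moderateM; exact: moderate_G].
congr Ex; apply/funext => x; rewrite /dot big_distrlr/= [RHS]exchange_big/=; apply: eq_bigr => j _.
by apply: eq_bigr => i _; ring.
Qed.

Lemma Ex_hessian_fisher u v : Ex P (fun x => dot (u *m H x) v) = dot (u *m fisher V) v.
Proof. by rewrite Ex_hessian dot_fisher. Qed.

Lemma fisher_le u : enorm (u *m fisher V) <= M * enorm u.
Proof.
apply: enorm_dual_le => [|v]; first by rewrite mulr_ge0 ?enorm_ge0 ?ltW.
rewrite -Ex_hessian_fisher -[leRHS](Ex_cst P).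
apply: (Ex_le ww) => [||x]; [exact: moderate_hessian|exact: moderate_cst|].
apply: le_trans (dot_le _ _) _; rewrite ler_wpM2r ?enorm_ge0//.
exact: hessian_bounded M_gt0 VM _ _.
Qed.

End potential_expectations.

(** * Newton approximations of the minimizer *)

Section empirical_process.
Context {R : realType} {d : nat}.
Variables (V : potential R d) (M L m : R).
Hypotheses (M_gt0 : 0 < M) (L_gt0 : 0 < L) (m_gt0 : 0 < m).
Hypothesis hV : assumption1 M L m V.
Local Notation G := (gradient V).
Local Notation H := (hessian V).
Local Notation I := (fisher V).
Implicit Types (u v h : 'rV[R]_d).

Let Vsc := a1_strictly_convex hV.
Let Vd := a1_twice_differentiable hV.
Let VM := a1_hessian_bounded hV.
Let VL := a1_hessian_lipschitz hV.

Lemma fisher_dot_ge u : m * enorm u ^+ 2 <= dot (u *m I) u.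
Proof. exact: (psd_dot_ge (a1_fisher hV)). Qed.

Lemma fisher_unit : I \in unitmx.
Proof. exact: (psd_unitmx m_gt0 (a1_fisher hV)). Qed.

Lemma enorm_fisherV u : enorm (u *m invmx I) <= m^-1 * enorm u.
Proof. exact: (enorm_invmx m_gt0 (a1_fisher hV)). Qed.

Lemma gradient_monotone x y : 0 <= dot (G x - G y) (x - y).
Proof.
have h1 := potential_tangent M_gt0 Vsc Vd VM x (y - x).
have h2 := potential_tangent M_gt0 Vsc Vd VM y (x - y).
rewrite [x + _]addrC subrK in h1; rewrite [y + _]addrC subrK in h2.
by move: h1 h2; rewrite dotBl !dotBr; lra.
Qed.

(** Every point of the segment from [x - h] to [x - h'] lies within [|h| + |h'|] of [x], where the
    Hessian is frozen. *)
Lemma gradient_increment_hessian x h h' :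
  enorm (G (x - h') - G (x - h) + (h' - h) *m H x) <= L * (enorm h + enorm h') * enorm (h' - h).
Proof.
apply: enorm_dual_le => [|w].
  by rewrite mulr_ge0 ?enorm_ge0// mulr_ge0 ?addr_ge0 ?enorm_ge0// ltW.
have := gradient_increment Vd w (x - h) (h - h').
have -> : x - h + (h - h') = x - h' by apply/rowP => i; rewrite !mxE; ring.
move=> [t /andP[t0 t1] E]; rewrite addrC dotDl E -dotDl.
have -> : (h' - h) *m H x + (h - h') *m H (x - h + t *: (h - h')) =
  (h' - h) *m H x - (h' - h) *m H (x - h + t *: (h - h')).
  by rewrite -[h - h']opprB mulNmx.
apply: le_trans (dot_le _ _) _; rewrite ler_wpM2r ?enorm_ge0//.
apply: le_trans (hessian_lipschitz L_gt0 VL _ _ _) _.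
rewrite ler_wpM2r ?enorm_ge0// (ler_wpM2l (ltW L_gt0))//.
have -> : x - (x - h + t *: (h - h')) = (1 - t) *: h + t *: h'.
  by apply/rowP => i; rewrite !mxE; ring.
apply: enormD_le; rewrite enormZ ger0_norm ?subr_ge0 ?(ltW t0) ?(ltW t1)//.
  by rewrite ler_piMl ?enorm_ge0// lerBlDr lerDl ltW.
by rewrite ler_piMl ?enorm_ge0// ltW.
Qed.

Section sample.
Variable n : nat.
Hypothesis n_gt0 : (0 < n)%N.
Implicit Types (x : 'I_n -> 'rV[R]_d).

Let n0 : (0 : R) < n%:R. Proof. by rewrite ltr0n. Qed.

Definition empirical_gradient x h : 'rV[R]_d := n%:R^-1 *: \sum_j G (x j - h).
Definition empirical_hessian x : 'M[R]_d := n%:R^-1 *: \sum_j H (x j).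
Definition empirical_risk x h : R := n%:R^-1 * \sum_j V (x j - h).
Local Notation Gm := empirical_gradient.
Local Notation Hm := empirical_hessian.
Local Notation F := empirical_risk.

(* Newton-type steps with the Fisher information in place of the empirical
   Hessian: globally Lipschitz proxies of the maximum likelihood estimator. *)
Fixpoint newton_iter x (i : nat) : 'rV[R]_d :=
  if i is i'.+1 then newton_iter x i' + Gm x (newton_iter x i') *m invmx I else 0.
Local Notation it := newton_iter.

(** Samples are centred here, so the true parameter is 0: under the model [Gm x 0] has mean zero and
    [Hm x] has mean [I]. *)
Definition deviation x : R := fnorm (I - Hm x) + enorm (Gm x 0).
Local Notation Z := deviation.

Lemma deviation_ge0 x : 0 <= Z x.
Proof. by rewrite addr_ge0 ?fnorm_ge0 ?enorm_ge0. Qed.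

Lemma average_le (a : 'I_n -> 'rV[R]_d) (C : R) : (forall j, enorm (a j) <= C) ->
  enorm (n%:R^-1 *: \sum_j a j) <= C.
Proof.
move=> h; rewrite enormZ ger0_norm ?invr_ge0// ler_pdivrMl//.
apply: le_trans (enorm_sum _ _ _) _.
by rewrite mulr_natl -[n in leRHS]card_ord -sumr_const ler_sum.
Qed.

Lemma empirical_gradientB x x' h h' :
  Gm x h - Gm x' h' = n%:R^-1 *: \sum_j (G (x j - h) - G (x' j - h')).
Proof. by rewrite -scalerBr -sumrB. Qed.

Lemma empirical_gradient_lipschitz x h h' : enorm (Gm x h - Gm x h') <= M * enorm (h - h').
Proof.
rewrite empirical_gradientB; apply: average_le => j.
apply: le_trans (gradient_lipschitz M_gt0 Vd VM _ _) _.
rewrite -enormN; apply: eq_ler; congr (M * enorm _).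
by apply/rowP => i; rewrite !mxE; ring.
Qed.

(** [Gm x h] averages [G (x j - h)], so its derivative in [h] is minus a Hessian, hence the plus
    sign. Replacing that Hessian by [I] costs the deviation of [Hm x] and the Lipschitz error of
    moving to [h] and [h']. *)
Lemma empirical_gradient_linear x h h' :
  enorm (Gm x h' - Gm x h + (h' - h) *m I) <=
  (fnorm (I - Hm x) + L * (enorm h + enorm h')) * enorm (h' - h).
Proof.
have -> : Gm x h' - Gm x h + (h' - h) *m I =
   (h' - h) *m (I - Hm x) + n%:R^-1 *: \sum_j (G (x j - h') - G (x j - h) + (h' - h) *m H (x j)).
  rewrite big_split/= scalerDr -empirical_gradientB mulmxBr /empirical_hessian -scalemxAr.
  rewrite mulmx_sumr; set S := _ *: _; set T := _ *m I; set g1 := Gm x h'; set g2 := Gm x h.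
  by apply/rowP => i; rewrite !mxE; ring.
rewrite mulrDl; apply: enormD_le.
  by rewrite mulrC; exact: enorm_mulmx.
apply: average_le => j; exact: gradient_increment_hessian.
Qed.

Fixpoint newton_bound i : R := if i is i'.+1 then newton_bound i' * (1 + M / m) + m^-1 else 0.

Lemma newton_bound_ge0 i : 0 <= newton_bound i.
Proof.
elim: i => //= i IH; rewrite addr_ge0 ?invr_ge0 ?(ltW m_gt0)// mulr_ge0//.
by rewrite addr_ge0// divr_ge0 ?ltW.
Qed.

Lemma empirical_gradient_growth x h : enorm (Gm x h) <= enorm (Gm x 0) + M * enorm h.
Proof.
rewrite -[Gm x h](subrK (Gm x 0)) addrC; apply: enormD_le => //.
by apply: le_trans (empirical_gradient_lipschitz _ _ _) _; rewrite subr0.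
Qed.

Lemma newton_iter_le x i : enorm (it x i) <= newton_bound i * enorm (Gm x 0).
Proof.
elim: i => [|i IH] /=; first by rewrite enorm0 mul0r.
apply: le_trans (enormD_le IH (enorm_fisherV _)) _.
have mi : 0 < m^-1 by rewrite invr_gt0.
have h := empirical_gradient_growth x (it x i).
apply: (@le_trans _ _ (newton_bound i * enorm (Gm x 0) + m^-1 * (enorm (Gm x 0) + M * (newton_bound i *
    enorm (Gm x 0))))).
  rewrite lerD2l (ler_wpM2l (ltW mi))//; apply: le_trans h _; rewrite lerD2l.
  exact: (ler_wpM2l (ltW M_gt0)).
by apply: eq_ler; ring.
Qed.

Lemma newton_iter_le_deviation x i : enorm (it x i) <= newton_bound i * Z x.
Proof.
apply: le_trans (newton_iter_le x i) _; rewrite ler_wpM2l ?newton_bound_ge0//.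
by rewrite lerDr fnorm_ge0.
Qed.

Lemma risk_tangent x h u : F x h - dot (Gm x h) u <= F x (h + u).
Proof.
rewrite /F /Gm dotZl -mulrBr ler_pM2l ?invr_gt0// dot_suml -sumrB.
apply: ler_sum => j _; have := potential_tangent M_gt0 Vsc Vd VM (x j - h) (- u).
by rewrite dotNr -addrA -opprD.
Qed.

Lemma risk_taylor x h u : `|F x (h + u) - F x h + dot (Gm x h) u| <= M * enorm u ^+ 2.
Proof.
have -> : F x (h + u) - F x h + dot (Gm x h) u =
  n%:R^-1 * \sum_j (V (x j - h + (- u)) - V (x j - h) - dot (G (x j - h)) (- u)).
  rewrite /F /Gm dotZl dot_suml -mulrBr -mulrDr -sumrB -big_split/=; congr (_ * _).
  by apply: eq_bigr => j _; rewrite dotNr opprK opprD addrA.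
rewrite normrM ger0_norm ?invr_ge0// ler_pdivrMl//.
apply: le_trans (ler_norm_sum _ _ _) _.
rewrite mulr_natl -[n in leRHS]card_ord -sumr_const; apply: ler_sum => j _.
by rewrite -(enormN u); exact: potential_taylor.
Qed.

Lemma continuous_risk x : continuous (F x).
Proof.
move=> h; apply: differentiable_continuous.
have -> : F x = n%:R^-1 \*: (\sum_j (fun h => V (x j - h))).
  by apply/funext => u; rewrite /= fct_sumE.
apply: differentiableZ; apply: differentiable_sum => j.
apply: (@differentiable_comp _ _ _ _ (fun h => x j - h) V); last exact: differentiable_potential.
by apply: differentiableB => //; exact: differentiable_cst.
Qed.

Lemma risk_strictly_convex x h h' : h != h' -> F x (2^-1 *: (h + h')) < 2^-1 * (F x h + F x h').
Proof.
move=> hh; rewrite /F -mulrDr mulrCA ltr_pM2l ?invr_gt0// -big_split/= mulr_sumr.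
have n' : exists j : 'I_n, true by exists (Ordinal n_gt0).
apply: ltr_sum => [|j _]; first by apply/hasP; exists (Ordinal n_gt0) => //; exact: mem_index_enum.
have xx : x j - h != x j - h' by rewrite (inj_eq (addrI _)) eqr_opp.
have := Vsc xx (_ : 0 < 2^-1 < 1); rewrite invr_gt0 ltr0n invf_lt1 ?ltr1n// => /(_ isT).
have -> : 1 - 2^-1 = 2^-1 :> R by field.
rewrite -scalerDr -mulrDr; congr (V _ < _).
by apply/rowP => i; rewrite !mxE; field.
Qed.

Definition risk_minimizer x h := forall h', F x h <= F x h'.

Lemma risk_minimizer_unique x h h' : risk_minimizer x h -> risk_minimizer x h' -> h = h'.
Proof.
move=> m1 m2; apply/eqP; apply/negPn/negP => /(risk_strictly_convex x).
have := m1 (2^-1 *: (h + h')); have := m2 (2^-1 *: (h + h')); lra.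
Qed.

(** [Gm x h] is minus the gradient of the risk, so a step [t] along it would lower the risk by
    [t |Gm x h|^2] up to second order. *)
Lemma risk_minimizer_critical x h : risk_minimizer x h -> Gm x h = 0.
Proof.
move=> mh; apply/eqP; rewrite -enorm_eq0 -sqrf_eq0; apply/eqP.
apply: (@eq0_of_quadratic _ _ (M * enorm (Gm x h) ^+ 2)) => t t0 t1.
have := risk_taylor x h (t *: Gm x h); have := mh (h + t *: Gm x h).
rewrite dotZr -sqr_enorm [enorm (t *: _)]enormZ (gtr0_norm t0) exprMn mulrCA ler_norml ger0_norm; last first.
  by rewrite !mulr_ge0 ?enorm_ge0// ltW.
by move=> h1 /andP[_]; lra.
Qed.

(** The bound [m / 4] keeps the linearised gradient coercive with constant [m / 2] on the ball of
    radius [m / (4 * L)]; the bound [m ^+ 2 / (16 * L)] makes the gradient at 0 too small for a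
    minimizer outside that ball. *)
Definition small_deviation : R := Num.min (m / 4) (m ^+ 2 / (16 * L)).
Local Notation kappa := small_deviation.

Lemma small_deviation_gt0 : 0 < kappa.
Proof. by rewrite lt_min !divr_gt0 ?exprn_gt0// mulr_gt0. Qed.

(** The linearisation at 0 is useful only near 0, while the minimizer may a priori be anywhere. It
    is therefore pulled back along its ray, and convexity transfers information from [h] to
    [s *: h]. *)
Lemma risk_minimizer_le x h : risk_minimizer x h -> Z x <= kappa ->
  enorm h <= 2 / m * enorm (Gm x 0).
Proof.
move=> mh; rewrite le_min => /andP[Z1 Z2].
have crit := risk_minimizer_critical mh.
have D1 : fnorm (I - Hm x) <= m / 4.
  by apply: le_trans Z1; rewrite lerDl enorm_ge0.
have g1 : enorm (Gm x 0) <= m ^+ 2 / (16 * L).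
  by apply: le_trans Z2; rewrite lerDr fnorm_ge0.
have [->|hn0] := eqVneq h 0; first by rewrite enorm0 mulr_ge0 ?enorm_ge0// divr_ge0// ltW.
have h0 : 0 < enorm h by rewrite lt_def enorm_eq0 hn0 enorm_ge0.
(* The largest scaling, at most 1, that puts [s *: h] in the ball of radius [m / (4 * L)]. *)
pose s := Num.min 1 (m / (4 * L) / enorm h).
have q0 : 0 < m / (4 * L) by rewrite divr_gt0// mulr_gt0.
have s0 : 0 < s by rewrite lt_min ltr01 divr_gt0.
have s1 : s <= 1 by rewrite ge_min lexx.
have sh : s * enorm h <= m / (4 * L) by rewrite -ler_pdivlMr// ge_min lexx orbT.
(* By convexity the risk does not increase along the ray before reaching [h]; since [Gm] is minus
   its gradient, the sign is nonnegative. *)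
have mono : 0 <= dot (Gm x (s *: h)) h.
  have [s1'|s1'] := eqVneq s 1; first by rewrite s1' scale1r crit dot0l.
  have s1s : 0 < 1 - s by rewrite subr_gt0 lt_neqAle s1' s1.
  rewrite -(pmulr_rge0 _ s1s) -dotZr -[Gm _ _]subr0 -crit empirical_gradientB dotZl dot_suml.
  rewrite mulr_ge0 ?invr_ge0// sumr_ge0// => j _.
  have -> : (1 - s) *: h = (x j - s *: h) - (x j - h) by apply/rowP => i; rewrite !mxE; ring.
  exact: gradient_monotone.
have := empirical_gradient_linear x 0 (s *: h).
rewrite subr0 enorm0 add0r enormZ (gtr0_norm s0) => lin.
have up : dot (Gm x (s *: h)) h <= enorm (Gm x 0) * enorm h - s * (m * enorm h ^+ 2)
    + (fnorm (I - Hm x) + L * (s * enorm h)) * (s * enorm h) * enorm h.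
  have E r : dot (Gm x (r *: h)) h = dot (Gm x 0) h - r * dot (h *m I) h
      + dot (Gm x (r *: h) - Gm x 0 + (r *: h) *m I) h.
    by rewrite dotDl dotBl -scalemxAl dotZl; ring.
  rewrite E.
  apply: lerD; last by apply: le_trans (dot_le _ _) _; rewrite ler_wpM2r ?enorm_ge0.
  apply: lerB; first exact: dot_le.
  by rewrite ler_pM2l//; exact: fisher_dot_ge.
have e2 : (fnorm (I - Hm x) + L * (s * enorm h)) * (s * enorm h) * enorm h <= m / 2 * (s * enorm h ^+ 2).
  have -> : m / 2 * (s * enorm h ^+ 2) = m / 2 * (s * enorm h) * enorm h by ring.
  rewrite ler_pM2r// ler_pM2r ?mulr_gt0//.
  have : L * (s * enorm h) <= m / 4.
    by apply: le_trans (ler_wpM2l (ltW L_gt0) sh) _; apply: eq_ler; field; rewrite gt_eqF.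
  by lra.
have fin : m / 2 * (s * enorm h) <= enorm (Gm x 0).
  by rewrite -(ler_pM2r h0); move: mono up e2; rewrite expr2; lra.
(* If [s < 1], then [s |h| = m / (4 L)], and [fin] would make the gradient at 0 at least
   [m^2 / (8 L)], twice what [kappa] allows. *)
have sE : s = 1.
  apply/eqP; rewrite eq_le s1 /= leNgt; apply/negP => slt.
  have : s * enorm h = m / (4 * L).
    have [c1|c1] := leP 1 (m / (4 * L) / enorm h); first by move: slt; rewrite /s (min_l c1) ltxx.
    by rewrite /s (min_r (ltW c1)) divfK ?gt_eqF.
  move=> E; rewrite E in fin.
  have : m / 2 * (m / (4 * L)) <= m ^+ 2 / (16 * L) by exact: le_trans fin g1.
  have -> : m / 2 * (m / (4 * L)) = 2 * (m ^+ 2 / (16 * L)) by field; rewrite gt_eqF.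
  have : 0 < m ^+ 2 / (16 * L) by rewrite divr_gt0 ?exprn_gt0// mulr_gt0.
  by lra.
move: fin; rewrite sE mul1r -ler_pdivlMl ?divr_gt0// invf_div.
exact.
Qed.

Fixpoint newton_error i : R :=
  if i is i'.+1 then m^-1 * (1 + L * (newton_bound i' + 2 / m)) * newton_error i' else 2 / m.

Lemma newton_error_ge0 i : 0 <= newton_error i.
Proof.
elim: i => [|i IH] /=; first by rewrite divr_ge0// ltW.
rewrite mulr_ge0// mulr_ge0 ?invr_ge0 ?(ltW m_gt0)// addr_ge0// mulr_ge0 ?(ltW L_gt0)//.
by rewrite addr_ge0 ?newton_bound_ge0// divr_ge0// ltW.
Qed.

(** Because [Gm x h = 0], the error of the next iterate is [I^-1] applied to the linearisation error
    between [h] and [it x i], which is a factor of order [Z x] smaller than the current error. *)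
Lemma risk_minimizer_iter x h i : risk_minimizer x h -> Z x <= kappa ->
  enorm (h - it x i) <= newton_error i * Z x ^+ i.+1.
Proof.
move=> mh Zk; have hle := risk_minimizer_le mh Zk.
have gZ : enorm (Gm x 0) <= Z x by rewrite lerDr fnorm_ge0.
have hZ : enorm h <= 2 / m * Z x.
  by apply: le_trans hle _; rewrite ler_wpM2l// divr_ge0// ltW.
have Z0 := deviation_ge0 x.
elim: i => [|i IH]; first by rewrite /= subr0 expr1.
have crit := risk_minimizer_critical mh.
have -> : h - it x i.+1 = (Gm x h - Gm x (it x i) + (h - it x i) *m I) *m invmx I.
  rewrite crit sub0r mulmxDl mulmxK ?fisher_unit//= mulNmx opprD addrA [RHS]addrC.
  by [].
apply: le_trans (enorm_fisherV _) _ => /=.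
rewrite -!mulrA ler_wpM2l ?invr_ge0 ?(ltW m_gt0)//.
apply: le_trans (empirical_gradient_linear _ _ _) _.
apply: (@le_trans _ _ ((Z x * (1 + L * (newton_bound i + 2 / m))) * (newton_error i * Z x ^+ i.+1))); last first.
  by apply: eq_ler; rewrite [Z x ^+ i.+2]exprS; ring.
apply: ler_pM; rewrite ?enorm_ge0//.
  by rewrite addr_ge0 ?fnorm_ge0// mulr_ge0 ?(ltW L_gt0)// addr_ge0 ?enorm_ge0.
rewrite [leRHS]mulrDr mulr1; apply: lerD; first by rewrite lerDl enorm_ge0.
rewrite [leRHS]mulrCA (ler_wpM2l (ltW L_gt0))// [leRHS]mulrDr; apply: lerD; rewrite [leRHS]mulrC //.
exact: newton_iter_le_deviation.
Qed.

End sample.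
End empirical_process.

(** * The maximum likelihood estimator *)

Lemma holder_continuous {R : realType} {d : nat} (f : 'rV[R]_d -> R) (K a : R) : 0 < a ->
  (forall x y, `|f x - f y| <= K * enorm (x - y) `^ a) -> continuous f.
Proof.
move=> a0 h x; apply/(@cvgrPdist_le R R^o _ (nbhs x)) => e e0.
have K1 : 0 < `|K| + 1 by rewrite ltr_wpDl.
have d1 : (0 : R) < d%:R + 1 by rewrite ltr_wpDl.
pose c := (d%:R + 1)^-1 * (e / (`|K| + 1)) `^ a^-1.
have c0 : 0 < c.
  by apply: mulr_gt0; [rewrite invr_gt0|apply: powR_gt0; exact: divr_gt0].
have nb : nbhs x [set y | `|x - y| <= c].
  by apply/(@nbhs_normP R 'rV[R]_d); exists c => // y /=; exact: ltW.
near=> y; apply: le_trans (h x y) _.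
have ud : enorm (x - y) <= (e / (`|K| + 1)) `^ a^-1.
  apply: le_trans (enorm_le_normr _) _.
  apply: (@le_trans _ _ ((d%:R + 1) * `|x - y|)); first by rewrite ler_wpM2r// lerDl.
  by rewrite -ler_pdivlMl ?ltr_wpDl//; near: y.
have ha : enorm (x - y) `^ a <= e / (`|K| + 1).
  apply: le_trans (ge0_ler_powR (ltW a0) _ _ ud) _; rewrite ?nnegrE ?enorm_ge0 ?powR_ge0//.
  by rewrite -powRrM mulVf ?gt_eqF// powRr1// divr_ge0// ltW// ltr_wpDl.
have K1' : 0 < `|K| + 1 by rewrite ltr_wpDl.
apply: (@le_trans _ _ ((`|K| + 1) * enorm (x - y) `^ a)).
  by rewrite ler_wpM2r ?powR_ge0// (le_trans (ler_norm _))// lerDl.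
by rewrite -ler_pdivlMl// mulrC.
Unshelve. all: by end_near. Qed.

(** * Continuity and compactness in the Euclidean norm *)

Section enorm_topology.
Context {R : realType} {d : nat}.

Lemma enorm_lipschitz (x y : 'rV[R]_d) : `|enorm x - enorm y| <= enorm (x - y).
Proof.
have h1 := enormD (x - y) y; have h2 := enormD (y - x) x.
rewrite subrK in h1; rewrite subrK [enorm (y - x)]enormB in h2.
by rewrite ler_norml; apply/andP; split; lra.
Qed.

Lemma continuous_enorm : continuous (@enorm R d).
Proof.
apply: (@holder_continuous _ _ _ 1 1) => // x y; rewrite mul1r powRr1 ?enorm_ge0//.
exact: enorm_lipschitz.
Qed.

Lemma continuous_dot (p : 'rV[R]_d) : continuous (dot p).
Proof.
apply: (@holder_continuous _ _ _ (enorm p) 1) => // x y.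
by rewrite powRr1 ?enorm_ge0// -dotBr cauchy_schwarz.
Qed.

Lemma compact_enorm_closed (A : set 'rV[R]_d) (r : R) : closed A -> (forall h, A h -> enorm h <= r) -> compact A.
Proof.
move=> cA h; apply: bounded_closed_compact => //.
exists r; split; first exact: num_real.
by move=> s rs x Ax; apply: le_trans (normr_le_enorm x) _; exact: le_trans (h x Ax) (ltW rs).
Qed.

Lemma compact_enorm_ball (r : R) : compact [set h : 'rV[R]_d | enorm h <= r].
Proof.
apply: (@compact_enorm_closed _ r) => //.
by apply: (@closed_comp _ _ (@enorm R d) [set x | x <= r]) => [x _|]; [exact: continuous_enorm|exact: closed_le].
Qed.

End enorm_topology.

(** * Existence and measurability of the minimizer *)

Section maximum_likelihood.
Context {R : realType} {d : nat}.
Variables (V : potential R d) (M L m : R).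
Hypotheses (M_gt0 : 0 < M) (L_gt0 : 0 < L) (m_gt0 : 0 < m).
Hypothesis hV : assumption1 M L m V.
Local Notation P := (gibbs V : probability 'rV[R]_d R).
Local Notation G := (gradient V).

Let Vsc := a1_strictly_convex hV.
Let Vd := a1_twice_differentiable hV.
Let VM := a1_hessian_bounded hV.
Let VL := a1_hessian_lipschitz hV.
Let ww := weight_gibbs M_gt0 hV.

(** Otherwise the centred variable [<G, u>] would be nonpositive, so its absolute value would have
    mean zero, and its variance, at least [m |u|^2], would vanish. *)
Lemma gradient_direction (u : 'rV[R]_d) : u != 0 -> exists x, 0 < dot (G x) u.
Proof.
move=> u0; apply/not_existsP => h.
have neg x : dot (G x) u <= 0 by rewrite leNgt; apply/negP => hx; exact: (h x).
pose a x := dot (G x) u.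
have ma := moderate_dotG M_gt0 hV u.
have E1 : Ex P (fun x => `|a x|) = 0.
  rewrite (_ : (fun x => _) = fun x => - a x); last by apply/funext => x; rewrite ler0_norm//; exact: neg.
  by rewrite (ExN ww)// (Ex_dotG M_gt0 hV) oppr0.
have m2 := moderateX 2 ma; have m3 := moderateX 3 (moderate_norm ma).
(* The inequality [t b^2 <= b + t^2 b^3] with [b = |a x|] passes from the first to the second moment
   without an almost-everywhere argument. *)
have : Ex P (fun x => a x ^+ 2) = 0.
  apply: (@eq0_of_quadratic _ _ (Ex P (fun x => `|a x| ^+ 3))) => t t0 t1.
  rewrite ger0_norm; last by rewrite mulr_ge0 ?(ltW t0)// Ex_ge0// => x; exact: sqr_ge0.
  rewrite -(ExZ ww _ m2) -(ExZ ww _ m3) -[leRHS]add0r -E1 -(ExD ww (moderate_norm ma) (moderateZ _ m3)).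
  apply: (Ex_le ww) => [||x]; [exact: moderateZ|exact (moderateD ww (moderate_norm ma) (moderateZ _ m3))|].
  rewrite -[a x ^+ 2]real_normK ?num_real//.
  have a0 : 0 <= `|a x| by []; set b := `|a x| in a0 *.
  have : 0 <= b * (1 - t * b + (t * b) ^+ 2).
    by rewrite mulr_ge0//; have := sqr_ge0 (t * b - 2^-1); lra.
  by rewrite !exprS expr0; lra.
have := dot_fisher M_gt0 hV u u; rewrite (_ : (fun x => _) = fun x => a x ^+ 2); last first.
  by apply/funext => x; rewrite expr2.
move=> <-; apply/eqP; rewrite gt_eqF//; apply: lt_le_trans (fisher_dot_ge hV u).
by rewrite mulr_gt0// exprn_gt0// lt_def enorm_eq0 u0 enorm_ge0.
Qed.

(** Every direction [u] has a tangent plane of [V] with positive slope along [u]. The open sets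
    [O N], where some plane has slope above [1 / (N + 1)] and intercept at most [N], cover the unit
    sphere, and a finite subcover makes both uniform. *)
Lemma potential_coercive : exists2 K : R, 0 < K & forall z, enorm z / K - K <= V z.
Proof.
pose O (N : nat) : set 'rV[R]_d := \bigcup_(x in [set x | `|V x - dot (G x) x| <=
    N%:R]) [set u | N.+1%:R^-1 < dot (G x) u].
have oO N : open (O N).
  apply: bigcup_open => x _.
  by apply: (@open_comp _ _ (dot (G x)) [set r | N.+1%:R^-1 < r]) => [u _|]; [exact: continuous_dot|exact: open_gt].
have cS : compact [set u : 'rV[R]_d | enorm u = 1].
  apply: (@compact_enorm_closed _ _ _ 1) => [|h /= ->//].
  by apply: (@closed_comp _ _ (@enorm R d) [set x | x = 1]) => [x _|]; [exact: continuous_enorm|exact: closed_eq].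
move: cS; rewrite compact_cover => /(_ nat setT O (fun i _ => oO i)).
case=> [u /= u1|D _ cov].
  have u0 : u != 0 by rewrite -enorm_eq0 u1 oner_neq0.
  have [x hx] := gradient_direction u0.
  pose N1 := Num.truncn (dot (G x) u)^-1; pose N2 := Num.truncn `|V x - dot (G x) x|.
  exists (N1 + N2).+1 => //; exists x => /=.
    apply: le_trans (ltW (truncnS_gt _)) _; rewrite ler_nat -/N2 ltnS leq_addl//.
  rewrite invf_plt ?posrE//; apply: lt_le_trans (truncnS_gt _) _.
  by rewrite ler_nat -/N1 ltnS -addnS leq_addr.
pose K := (\sum_(N <- finmap.enum_fset D) N.+1).+1.
have K0 : (0 : R) < K%:R by rewrite ltr0n.
have KD N : N \in finmap.enum_fset D -> (N.+1 <= K)%N.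
  by move=> ND; rewrite /K ltnW// ltnS (big_rem N)//= leq_addr.
have [v0 hv0] : exists v : R, forall z, z = 0 -> v <= V z.
  by exists (V 0) => z ->.
exists (K%:R + `|v0|); first by rewrite ltr_wpDr.
move=> z; have K1 : 0 < K%:R + `|v0| by rewrite ltr_wpDr.
have [z0|z0] := eqVneq z 0.
  rewrite z0 enorm0 mul0r sub0r; apply: le_trans (hv0 0 erefl).
  by rewrite lerNl (le_trans (ler_norm _))// normrN lerDr ltW.
have ez : 0 < enorm z by rewrite lt_def enorm_eq0 z0 enorm_ge0.
have /cov[N ND [x /= hx]] : [set u | enorm u = 1] ((enorm z)^-1 *: z).
  by rewrite /= enormZ ger0_norm ?invr_ge0 ?enorm_ge0// mulVf ?gt_eqF.
rewrite dotZr => hN.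
have := potential_tangent M_gt0 Vsc Vd VM x (z - x).
rewrite [x + _]addrC subrK dotBr; apply: le_trans.
have h1 : enorm z / (K%:R + `|v0|) <= dot (G x) z.
  apply: (@le_trans _ _ (enorm z / N.+1%:R)).
    rewrite ler_wpM2l ?enorm_ge0// lef_pV2 ?posrE//.
    by rewrite (le_trans (_ : _ <= K%:R)) ?lerDl// ler_nat; exact: KD.
  by rewrite mulrC -ler_pdivlMr// mulrC ltW.
have h2 : - (K%:R + `|v0|) <= V x - dot (G x) x.
  rewrite lerNl; apply: le_trans (ler_norm _) _; rewrite normrN; apply: le_trans hx _.
  by rewrite (le_trans (_ : _ <= K%:R)) ?lerDl// ler_nat ltnW//; exact: KD.
by move: h1 h2; lra.
Qed.

Section existence.
Variable n : nat.
Hypothesis n_gt0 : (0 < n)%N.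
Implicit Types (x : 'I_n -> 'rV[R]_d).
Local Notation F := (empirical_risk V).
Local Notation Gm := (empirical_gradient V).

Lemma risk_coercive x : exists K c : R, 0 < K /\ forall h, enorm h <= K * (F x h + c).
Proof.
have [K K0 hK] := potential_coercive.
have n0 : (0 : R) < n%:R by rewrite ltr0n.
exists K, (n%:R^-1 * (\sum_j enorm (x j)) / K + K); split=> // h.
rewrite mulrC -ler_pdivrMr// -lerBlDr.
apply: (@le_trans _ _ (n%:R^-1 * \sum_(j < n) (enorm h / K - enorm (x j) / K - K))).
  rewrite !sumrB !sumr_const card_ord -mulr_suml.
  rewrite -[X in _ <= n%:R^-1 * (X - _ - _)]mulr_natl -[X in _ <= n%:R^-1 * (_ - X)]mulr_natl.
  by apply: eq_ler; field; rewrite !gt_eqF.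
rewrite ler_pM2l ?invr_gt0//; apply: ler_sum => j _.
apply: le_trans (hK _); rewrite lerB// -mulrBl ler_wpM2r ?invr_ge0 ?(ltW K0)//.
by rewrite lerBlDr enormB; apply: le_trans (enormD _ _); rewrite subrK.
Qed.

Lemma risk_minimizer_exists x : exists h, risk_minimizer V x h.
Proof.
have [K [c [K0 hK]]] := risk_coercive x.
pose r := K * (F x 0 + c).
have r0 : 0 <= r by have := hK 0; rewrite enorm0.
have cF : continuous (F x) by exact (@continuous_risk _ _ _ _ _ _ hV n x).
have A0 : [set h : 'rV[R]_d | enorm h <= r] !=set0 by exists 0; rewrite /= enorm0.
have cB : compact [set h : 'rV[R]_d | enorm h <= r] by exact (@compact_enorm_ball R d r).
have [t] := compact_EVT_min A0 cB (continuous_subspaceT cF).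
rewrite inE /= => tr tmin; exists t => h.
have [hr|/ltW hr] := leP (enorm h) r; first by apply: tmin; rewrite inE.
apply: (@le_trans _ _ (F x 0)); first by apply: tmin; rewrite inE /= enorm0.
by have := le_trans hr (hK h); rewrite /r ler_pM2l// lerD2r.
Qed.

(** A minimizer exists, so [xget] returns one rather than its default value 0. *)
Lemma mleP x : risk_minimizer V x (mle V x).
Proof.
have [h hh] := risk_minimizer_exists x.
exact: (@xgetPex _ 0 [set t | risk_minimizer V x t]) (ex_intro _ h hh).
Qed.

(** Translating the data translates the risk, and the minimizer is unique. This makes the law of the
    estimation error independent of the parameter. *)
Lemma mle_shift x h : mle V (fun j => x j + h) = mle V x + h.
Proof.
apply: (risk_minimizer_unique hV n_gt0 (mleP _)) => h'.
have E t : F (fun j => x j + h) t = F x (t - h).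
  by rewrite /empirical_risk; congr (_ * _); apply: eq_bigr => j _; rewrite opprB addrA.
by rewrite !E addrK; exact: mleP.
Qed.

(** These measurable iterates converge pointwise to the minimizer, which is how the estimator is
    shown to be measurable. The step has a plus sign because [Gm] is minus the gradient of the
    risk. *)
Fixpoint gradient_descent x (k : nat) : 'rV[R]_d :=
  if k is k'.+1 then gradient_descent x k' + (2 * M)^-1 *: Gm x (gradient_descent x k') else 0.
Local Notation gd := gradient_descent.

Lemma descent_step x k : F x (gd x k.+1) + enorm (Gm x (gd x k)) ^+ 2 / (4 * M) <= F x (gd x k).
Proof.
have := risk_taylor M_gt0 hV n_gt0 x (gd x k) ((2 * M)^-1 *: Gm x (gd x k)).
have c0 : 0 <= (2 * M)^-1 by rewrite invr_ge0 mulr_ge0// ltW.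
set g := Gm x (gd x k); rewrite dotZr -sqr_enorm [enorm ((2 * M)^-1 *: g)]enormZ (ger0_norm c0).
rewrite ler_norml => /andP[_]; rewrite exprMn.
have -> : M * ((2 * M)^-1 ^+ 2 * enorm g ^+ 2) = enorm g ^+ 2 / (4 * M) by field; rewrite gt_eqF.
have -> : (2 * M)^-1 * enorm g ^+ 2 = 2 * (enorm g ^+ 2 / (4 * M)) by field; rewrite gt_eqF.
rewrite /= -/g; set E := enorm g ^+ 2 / _; lra.
Qed.

Lemma descent_le x k l : (k <= l)%N -> F x (gd x l) <= F x (gd x k).
Proof.
move=> /subnKC <-; elim: (l - k)%N => [|j IH]; first by rewrite addn0.
rewrite addnS; apply: le_trans IH; apply: le_trans (descent_step x (k + j)).
by rewrite lerDl divr_ge0 ?sqr_ge0// mulr_ge0// ltW.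
Qed.

(** Otherwise every step would lower the risk by at least [c], and the risk would eventually fall
    below its minimum. *)
Lemma descent_gradient x (e : R) : 0 < e -> exists k, enorm (Gm x (gd x k)) < e.
Proof.
move=> e0; apply/not_existsP => h.
have lb k : e <= enorm (Gm x (gd x k)) by rewrite leNgt; apply/negP => hk; exact: (h k).
pose c := e ^+ 2 / (4 * M).
have c0 : 0 < c by rewrite divr_gt0 ?exprn_gt0// mulr_gt0.
have dec k : F x (gd x k) <= F x 0 - k%:R * c.
  elim: k => [|k IH]; first by rewrite mul0r subr0.
  have := descent_step x k.
  have : c <= enorm (Gm x (gd x k)) ^+ 2 / (4 * M).
    rewrite ler_wpM2r ?invr_ge0 ?mulr_ge0 ?(ltW M_gt0)// lerXn2r ?nnegrE ?enorm_ge0//.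
    exact: ltW.
  rewrite -natr1; lra.
pose k := (Num.truncn ((F x 0 - F x (mle V x)) / c)).+1.
have : (F x 0 - F x (mle V x)) / c < k%:R by exact: truncnS_gt.
rewrite ltr_pdivrMr//; have := dec k; have := mleP x (gd x k).
by rewrite /risk_minimizer; lra.
Qed.

(** On the compact set of points of the sublevel ball at distance at least [e] from the minimizer,
    the risk exceeds its minimum by a positive gap; by convexity a small gradient at one iterate
    puts it and all later iterates below that gap. *)
Lemma gradient_descent_cvg x (e : R) : 0 < e ->
  exists k0, forall k, (k0 <= k)%N -> enorm (gd x k - mle V x) < e.
Proof.
move=> e0; have [K [c [K0 hK]]] := risk_coercive x.
pose r := K * (F x 0 + c).
set t := mle V x.
have tmin : forall h, F x t <= F x h by exact: mleP.
have gr k : enorm (gd x k) <= r.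
  by apply: le_trans (hK _) _; rewrite ler_pM2l// lerD2r; exact: (@descent_le x 0 k).
have tr : enorm t <= r.
  by apply: le_trans (hK _) _; rewrite ler_pM2l// lerD2r.
have r0 : 0 <= r by apply: le_trans tr; exact: enorm_ge0.
pose A := [set h : 'rV[R]_d | enorm h <= r /\ e <= enorm (h - t)].
have cA : compact A.
  apply: (@compact_enorm_closed _ _ _ r) => [|h []//].
  apply: closedI.
    by apply: (@closed_comp _ _ (@enorm R d) [set x | x <= r]) => [y _|]; [exact: continuous_enorm|exact: closed_le].
  apply: (@closed_comp 'rV[R]_d R (fun h => enorm (h - t)) [set x | e <= x]) => [y _|]; last exact: closed_ge.
  apply: (@holder_continuous _ _ _ 1 1) => // u v; rewrite mul1r powRr1 ?enorm_ge0//.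
  have -> : u - v = (u - t) - (v - t) by apply/rowP => i; rewrite !mxE; ring.
  exact: enorm_lipschitz.
have [A0|/set0P An0] := eqVneq A set0.
  exists 0%N => k _; rewrite ltNge; apply/negP => h.
  by have : A (gd x k) by []; rewrite A0.
have [|h0] := @compact_EVT_min 'rV[R]_d R (F x) A An0 cA.
  by apply: continuous_subspaceT; exact (@continuous_risk _ _ _ _ _ _ hV n x).
rewrite inE => -[h0r h0e] h0min.
have gap : F x t < F x h0.
  rewrite lt_neqAle tmin andbT; apply/eqP => E.
  have : t = h0.
    apply: (risk_minimizer_unique hV n_gt0 (x := x)) => // h; rewrite -E; exact: tmin.
  by move=> th; move: h0e; rewrite th subrr enorm0 leNgt e0.
(* The iterates and the minimizer lie within [2 * r] of each other, so a gradient below [dl] leaves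
   an excess risk of at most [dl * (2 * r)], less than the gap. *)
pose dl := (F x h0 - F x t) / (2 * r + 1).
have dl0 : 0 < dl by rewrite divr_gt0 ?subr_gt0// ltr_wpDl// mulr_ge0.
have [k0 hk0] := descent_gradient x dl0.
exists k0 => k kk0; rewrite ltNge; apply/negP => h.
have Ak : gd x k \in A by rewrite inE.
have h1 := h0min _ Ak.
have h2 := descent_le x kk0.
have h3 := risk_tangent M_gt0 hV n_gt0 x (gd x k0) (t - gd x k0).
rewrite [gd x k0 + _]addrC subrK in h3.
have h4 := dot_le (Gm x (gd x k0)) (t - gd x k0).
have h5 : enorm (t - gd x k0) <= 2 * r.
  by rewrite mulr_natl mulr2n; apply: enormD_le => //; rewrite enormN; exact: gr.
have h6 : enorm (Gm x (gd x k0)) * enorm (t - gd x k0) <= dl * (2 * r).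
  by apply: ler_pM; rewrite ?enorm_ge0// ltW.
have h7 : dl * (2 * r + 1) = F x h0 - F x t.
  by rewrite /dl divfK// gt_eqF// ltr_wpDl// mulr_ge0.
by move: h1 h2 h3 h4 h6 h7 dl0; rewrite mulrDr mulr1; lra.
Qed.

Lemma measurable_empirical_gradient (g : n.-tuple 'rV[R]_d -> 'rV[R]_d) : measurable_fun setT g ->
  measurable_fun setT (fun y : n.-tuple 'rV[R]_d => Gm (tnth y) (g y)).
Proof.
move=> mg; apply: measurable_row_scale; apply: measurable_row_sum => j.
apply: (measurableT_comp (measurable_gradient hV)).
by apply: measurable_rowB => //; exact: measurable_tnth.
Qed.

Lemma measurable_mle : measurable_fun setT (fun y : n.-tuple 'rV[R]_d => mle V (tnth y)).
Proof.
have mgd k : measurable_fun setT (fun y : n.-tuple 'rV[R]_d => gd (tnth y) k).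
  elim: k => [|k IH] /=; first exact: measurable_cst.
  by apply: measurable_rowD => //; apply: measurable_row_scale; exact: measurable_empirical_gradient.
apply: measurable_fun_row => i.
apply: (@measurable_fun_cvg _ _ R setT (fun k y => gd (tnth y) k ord0 i)) => [k|y _].
  exact: measurable_row_comp (mgd k).
apply/cvgrPdist_lt => e e0; have [k0 hk0] := gradient_descent_cvg (tnth y) e0.
near=> k; have := hk0 k; rewrite enormB => /(_ _) h.
apply: le_lt_trans (h _); last by near: k; exact: nbhs_infty_ge.
have -> : mle V (tnth y) ord0 i - gd (tnth y) k ord0 i = (mle V (tnth y) - gd (tnth y) k) ord0 i by rewrite !mxE.
exact: coord_le_enorm.
Unshelve. all: by end_near. Qed.

Lemma measurable_newton_iter i : measurable_fun setT (fun y : n.-tuple 'rV[R]_d => newton_iter V (tnth y) i).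
Proof.
elim: i => [|i IH] /=; first exact: measurable_cst.
by apply: measurable_rowD => //; apply: measurable_mulmx; exact: measurable_empirical_gradient.
Qed.

End existence.
End maximum_likelihood.

(** * Moments of the empirical deviation *)

Lemma dot_delta_mulmx {R : realType} {d : nat} (A : 'M[R]_d) i j :
  dot (delta_mx ord0 i *m A) (delta_mx ord0 j) = A i j.
Proof. by rewrite dotC dot_delta -rowE mxE. Qed.

Lemma moderate_enorm {R : realType} dT (T : measurableType dT) (P : probability T R) (w : T -> R) d (f : T -> 'rV[R]_d) :
  weight P w -> (forall i, moderate w (fun t => f t ord0 i)) -> moderate w (fun t => enorm (f t)).
Proof.
move=> ww mf; apply: (moderate_le (g := fun t => \sum_i `|f t ord0 i|)).
- by apply: measurable_enorm; apply: measurable_fun_row => i; case: (mf i).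
- move=> t; rewrite !ger0_norm ?enorm_ge0 ?sumr_ge0//; exact: enorm_le_coord.
- by apply: (moderate_sum ww) => i; exact: moderate_norm.
Qed.

Section deviation_moments.
Context {R : realType} {d : nat}.
Variables (V : potential R d) (M L m : R).
Hypotheses (M_gt0 : 0 < M) (L_gt0 : 0 < L) (m_gt0 : 0 < m).
Hypothesis hV : assumption1 M L m V.
Local Notation P := (gibbs V : probability 'rV[R]_d R).
Local Notation G := (gradient V).
Local Notation H := (hessian V).
Local Notation w := (gibbs_weight V).
Let ww := weight_gibbs M_gt0 hV.
Variable n : nat.
Hypothesis n_gt0 : (0 < n)%N.
Local Notation Q := (iid P n).
Local Notation mo := (moderate (wtuple w (n:=n))).
Let wn := weight_iid ww n.
Implicit Type y : n.-tuple 'rV[R]_d.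

Lemma moderate_empirical_gradient0 i : mo (fun y => empirical_gradient V (tnth y) 0 ord0 i).
Proof.
under eq_fun do rewrite mxE summxE.
apply: moderateZ; apply: (moderate_sum wn) => j.
under eq_fun do rewrite subr0.
exact (moderate_tnth ww j (moderate_G M_gt0 hV i)).
Qed.

Lemma empirical_gradient0E y : empirical_gradient V (tnth y) 0 = n%:R^-1 *: \sum_j G (tnth y j).
Proof. by congr (_ *: _); apply: eq_bigr => j _; rewrite subr0. Qed.

(** Each coordinate of the sum of scores is sub-Gaussian with variance proxy of order [M n];
    [power_mean] assembles the [d] coordinates. *)
Lemma gradient_moment q :
  Ex Q (fun y => enorm (empirical_gradient V (tnth y) 0) ^+ (2 * q.+1)) <=
  (2 * q.+1)%:R ^+ (2 * q.+1) * (2 * expR 1) * M ^+ q.+1 * (d%:R / n%:R) ^+ q.+1.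
Proof.
have n0 : (0 : R) < n%:R by rewrite ltr0n.
pose S i y := \sum_(j < n) G (tnth y j) ord0 i.
have mS i : mo (S i) by exact (moderate_iid_sum ww n (moderate_G M_gt0 hV i)).
set K := _ * (2 * expR 1).
have hS i : Ex Q (fun y => S i y ^+ (2 * q.+1)) <= K * (M * n%:R) ^+ q.+1.
  have E t : (fun z => expR (t * G z ord0 i)) = (fun z => expR (dot (G z) (t *: delta_mx ord0 i))).
    by apply/funext => z; rewrite dotZr (dotC (G z)) dot_delta.
  apply: (subgaussian_moment (h := fun z => G z ord0 i) ww) => // [|t|t].
  - exact: moderate_G M_gt0 hV i.
  - by rewrite E; exact (moderate_expG hV (t *: delta_mx ord0 i)).
  - rewrite E; apply: le_trans (gibbs_mgf M_gt0 hV _) _.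
    by rewrite enormZ enorm_delta mulr1 real_normK ?num_real.
have mS2 i : mo (fun y => S i y ^+ (2 * q.+1)) by exact: moderateX.
have mT : mo (fun y => \sum_i S i y ^+ (2 * q.+1)) by apply: (moderate_sum wn).
apply: (@le_trans _ _ (Ex Q (fun y => (n%:R^-1 ^+ (2 * q.+1) * d%:R ^+ q) * \sum_i S i y ^+ (2 * q.+1)))).
  apply: (Ex_le wn) => [||y].
  - by apply: moderateX; apply: (moderate_enorm wn) => i; exact: moderate_empirical_gradient0.
  - exact: moderateZ.
  - rewrite empirical_gradient0E enormZ ger0_norm ?invr_ge0// exprMn -mulrA ler_wpM2l ?exprn_ge0 ?invr_ge0//.
    rewrite exprM sqr_enorm.
    have -> : dot (\sum_j G (tnth y j)) (\sum_j G (tnth y j)) = \sum_i S i y ^+ 2.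
      by apply: eq_bigr => i _; rewrite !summxE expr2.
    apply: le_trans (power_mean q (fun i => sqr_ge0 (S i y))) _.
    by under eq_bigr do rewrite -exprM.
rewrite (ExZ wn _ mT) (Ex_sum wn)//.
apply: (@le_trans _ _ (n%:R^-1 ^+ (2 * q.+1) * d%:R ^+ q * (d%:R * (K * (M * n%:R) ^+ q.+1)))).
  rewrite ler_wpM2l ?mulr_ge0 ?exprn_ge0 ?invr_ge0//.
  by rewrite -[d in d%:R]card_ord mulr_natl -sumr_const ler_sum.
apply: eq_ler; rewrite exprM ![(_ * _) ^+ q.+1]exprMn [d%:R ^+ q.+1]exprS.
have : n%:R^-1 ^+ q.+1 * n%:R ^+ q.+1 = 1 :> R by rewrite -exprMn mulVf ?expr1n ?gt_eqF.
set a := n%:R^-1 ^+ q.+1; set b := n%:R ^+ q.+1 => ab.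
by transitivity (d%:R * d%:R ^+ q * K * M ^+ q.+1 * a * (a * b)); [ring|rewrite ab; ring].
Qed.

Lemma moderate_fnorm : mo (fun y => fnorm (fisher V - empirical_hessian V (tnth y))).
Proof.
apply: (moderate_le (g := fun=> Num.sqrt (d%:R * (2 * M) ^+ 2))); last exact: moderate_cst.
  apply: (measurableT_comp (continuous_measurable_fun (@sqrt_continuous R))).
  apply: measurable_sum => i; apply: measurable_sum => j; apply: measurable_funX.
  rewrite (_ : (fun y => _) = fun y => fisher V i j - n%:R^-1 *
      \sum_(k < n) dot (delta_mx ord0 i *m H (tnth y k)) (delta_mx ord0 j)).
    apply: measurable_funB => //; apply: measurable_funM => //; apply: measurable_sum => k.
    exact: (measurableT_comp (measurable_hessian hV _ _) (measurable_tnth k)).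
  apply/funext => y; rewrite !mxE summxE; congr (_ - _ * _).
  by apply: eq_bigr => k _; rewrite dot_delta_mulmx.
move=> y; rewrite !ger0_norm ?fnorm_ge0 ?sqrtr_ge0//.
rewrite -[leLHS]ger0_norm ?fnorm_ge0// -sqrtr_sqr ler_sqrt ?mulr_ge0 ?sqr_ge0//.
apply: fnorm_le => x; rewrite mulmxBr (_ : 2 * M * enorm x = M * enorm x + M * enorm x); last by ring.
apply: enormD_le; first exact: fisher_le M_gt0 L_gt0 hV x.
rewrite enormN /empirical_hessian -scalemxAr mulmx_sumr.
apply: (average_le n_gt0) => j; exact: hessian_bounded M_gt0 (a1_hessian_bounded hV) _ _.
all: exact: ltW.
Qed.

(** Row by row: each row of [I - Hm] is an average of centred vectors of norm at most [2 * M], whose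
    moments carry no dimension factor, so the [d] rows give [d / n]. Bounding the [d^2] entries
    separately would give [d^2 / n]. *)
Lemma hessian_moment q :
  Ex Q (fun y => fnorm (fisher V - empirical_hessian V (tnth y)) ^+ (2 * q.+1)) <=
  hilbert_const q.+1 * (4 * M ^+ 2) ^+ q.+1 * (d%:R / n%:R) ^+ q.+1.
Proof.
have n0 : (0 : R) < n%:R by rewrite ltr0n.
pose h (i : 'I_d) (z : 'rV[R]_d) : 'rV[R]_d := delta_mx ord0 i *m (fisher V - H z).
have hE i z k : h i z ord0 k = fisher V i k - dot (delta_mx ord0 i *m H z) (delta_mx ord0 k).
  by rewrite /h mulmxBr [LHS]mxE [X in _ + X]mxE [in RHS]dot_delta_mulmx -!rowE; congr (_ - _); rewrite mxE.
have mh i k : moderate w (fun z => h i z ord0 k).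
  under eq_fun do rewrite hE.
  by apply: (moderateB ww); [exact: moderate_cst|exact: moderate_hessian M_gt0 hV _ _].
have h0 i k : Ex P (fun z => h i z ord0 k) = 0.
  under eq_fun do rewrite hE.
  rewrite (ExB ww (moderate_cst _ _) (moderate_hessian M_gt0 hV _ _)) Ex_cst (Ex_hessian_fisher M_gt0 L_gt0 hV).
  by rewrite dot_delta_mulmx subrr.
have hB i z : enorm (h i z) <= 2 * M.
  rewrite /h mulmxBr mulr_natl mulr2n; apply: enormD_le.
    by apply: le_trans (fisher_le M_gt0 L_gt0 hV _) _; rewrite enorm_delta mulr1 ?lexx.
  rewrite enormN; apply: le_trans (hessian_bounded M_gt0 (a1_hessian_bounded hV) _ _) _.
  by rewrite enorm_delta mulr1 ?lexx.
have M2 : 0 <= 2 * M by rewrite mulr_ge0// ltW.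
pose S i y := enorm (\sum_(j < n) h i (tnth y j)).
have mS i : mo (fun y => S i y ^+ (2 * q.+1)) by exact: (moderate_enorm_sum ww (mh i)).
have hS i := hilbert_moment ww (mh i) (h0 i) (hB i) M2 q.+1 n.
have mT : mo (fun y => \sum_i S i y ^+ (2 * q.+1)) by apply: (moderate_sum wn).
set K := hilbert_const _ in hS *.
apply: (@le_trans _ _ (Ex Q (fun y => (n%:R^-1 ^+ (2 * q.+1) * d%:R ^+ q) * \sum_i S i y ^+ (2 * q.+1)))).
  apply: (Ex_le wn) => [||y].
  - by apply: moderateX; exact: moderate_fnorm.
  - exact: moderateZ.
  - rewrite exprM sqr_fnorm.
    have -> : \sum_i enorm (row i (fisher V - empirical_hessian V (tnth y))) ^+ 2 =
        \sum_i (n%:R^-1 ^+ 2 * S i y ^+ 2).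
      apply: eq_bigr => i _; rewrite -exprMn; congr (_ ^+ 2).
      rewrite -[n%:R^-1]ger0_norm ?invr_ge0// -enormZ; congr enorm.
      rewrite rowE /h -mulmx_sumr scalemxAr; congr (_ *m _).
      rewrite sumrB sumr_const card_ord scalerBr; congr (_ - _).
      by rewrite -[fisher V *+ n]scaler_nat scalerA mulVf ?scale1r ?gt_eqF.
    rewrite -mulr_sumr exprMn -exprM -mulrA ler_wpM2l ?exprn_ge0 ?invr_ge0//.
    apply: le_trans (power_mean q (fun i => sqr_ge0 (S i y))) _.
    by under eq_bigr do rewrite -exprM.
rewrite (ExZ wn _ mT) (Ex_sum wn)//.
apply: (@le_trans _ _ (n%:R^-1 ^+ (2 * q.+1) * d%:R ^+ q * (d%:R * (K * (n%:R * (2 * M) ^+ 2) ^+ q.+1)))).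
  rewrite ler_wpM2l ?mulr_ge0 ?exprn_ge0 ?invr_ge0//.
  have -> (c : R) : d%:R * c = \sum_(i < d) c by rewrite sumr_const card_ord mulr_natl.
  by apply: ler_sum => i _; exact: hS.
have -> : (2 * M) ^+ 2 = 4 * M ^+ 2 by ring.
apply: eq_ler; rewrite exprM [(d%:R / _) ^+ q.+1]exprMn [(n%:R * _) ^+ q.+1]exprMn [d%:R ^+ q.+1]exprS.
rewrite [n%:R^-1 ^+ 2]expr2 [(n%:R^-1 * _) ^+ q.+1]exprMn.
have : n%:R^-1 ^+ q.+1 * n%:R ^+ q.+1 = 1 :> R by rewrite -exprMn mulVf ?expr1n ?gt_eqF.
set a := n%:R^-1 ^+ q.+1; set b := n%:R ^+ q.+1 => ab; set c := (4 * _) ^+ q.+1.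
by transitivity (d%:R * d%:R ^+ q * K * c * a * (a * b)); [ring|rewrite ab; ring].
Qed.

Lemma moderate_deviation : mo (fun y => deviation V (tnth y)).
Proof.
apply: (moderateD wn); first exact: moderate_fnorm.
by apply: (moderate_enorm wn) => i; exact: moderate_empirical_gradient0.
Qed.

Definition deviation_const q : R :=
  2 ^+ (2 * q.+1) * (hilbert_const q.+1 * (4 * M ^+ 2) ^+ q.+1 +
    (2 * q.+1)%:R ^+ (2 * q.+1) * (2 * expR 1) * M ^+ q.+1).

Lemma deviation_const_ge0 q : 0 <= deviation_const q.
Proof.
rewrite mulr_ge0 ?exprn_ge0// addr_ge0 ?mulr_ge0 ?hilbert_const_ge0 ?exprn_ge0 ?mulr_ge0 ?sqr_ge0 ?expR_ge0 ?(ltW M_gt0)//.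
Qed.

Lemma deviation_moment q :
  Ex Q (fun y => deviation V (tnth y) ^+ (2 * q.+1)) <= deviation_const q * (d%:R / n%:R) ^+ q.+1.
Proof.
have mf : mo (fun y => fnorm (fisher V - empirical_hessian V (tnth y)) ^+ (2 * q.+1)).
  by apply: moderateX; exact: moderate_fnorm.
have mg : mo (fun y => enorm (empirical_gradient V (tnth y) 0) ^+ (2 * q.+1)).
  by apply: moderateX; apply: (moderate_enorm wn) => i; exact: moderate_empirical_gradient0.
have mfg := moderateD wn mf mg.
apply: (@le_trans _ _ (Ex Q (fun y => 2 ^+ (2 * q.+1) * (fnorm (fisher V - empirical_hessian V (tnth y)) ^+ (2 * q.+1)
    + enorm (empirical_gradient V (tnth y) 0) ^+ (2 * q.+1))))).
  apply: (Ex_le wn) => [||y]; [exact/moderateX/moderate_deviation|exact: moderateZ|].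
  by apply: exprD_le2; [exact: fnorm_ge0|exact: enorm_ge0].
rewrite (ExZ wn _ mfg) (ExD wn mf mg) /deviation_const -mulrA ler_wpM2l ?exprn_ge0// mulrDl.
by apply: lerD; [exact: hessian_moment|exact: gradient_moment].
Qed.

End deviation_moments.

(** * Smoothness classes and bias reduction *)

Lemma powR_ge1 {R : realType} (t r : R) : 0 <= r -> 1 <= t -> 1 <= t `^ r.
Proof. by move=> r0 t1; rewrite -(powRr0 t) ler_powR. Qed.

Lemma powR_le1 {R : realType} (t r : R) : 0 <= r -> 0 <= t -> t <= 1 -> t `^ r <= 1.
Proof.
move=> r0 t0 t1; apply: (@le_trans _ _ (1 `^ r)); last by rewrite powR1.
by rewrite ge0_ler_powR ?nnegrE.
Qed.

Section smooth_class.
Context {R : realType} {d : nat}.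
Variable rho : R.
Hypotheses (rho_gt0 : 0 < rho) (rho_le1 : rho <= 1).
Implicit Types (g : 'rV[R]_d -> R) (x y u v : 'rV[R]_d) (N : R).

(* The ball of radius N of C^(l + rho), for the norm of the l-th derivative as a multilinear form. *)
Fixpoint smooth l N g : Prop :=
  if l is l'.+1 then
    [/\ forall x, `|g x| <= N, forall x, differentiable g x &
        forall u, smooth l' (N * enorm u) ('D_u g)]
  else (forall x, `|g x| <= N) /\ forall x y, `|g x - g y| <= N * enorm (x - y) `^ rho.

Lemma smooth_bound l N g x : smooth l N g -> `|g x| <= N.
Proof. by case: l => [[h _]|l [h _ _]]; exact: h. Qed.

Lemma smooth_ge0 l N g : smooth l N g -> 0 <= N.
Proof. by move=> /(smooth_bound 0); exact: le_trans. Qed.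

Lemma smooth_le l N N' g : N <= N' -> smooth l N g -> smooth l N' g.
Proof.
elim: l N N' g => [|l IH] N N' g NN /=.
  move=> [h1 h2]; split=> [x|x y]; first exact: le_trans (h1 x) NN.
  by apply: le_trans (h2 x y) _; rewrite ler_wpM2r ?powR_ge0.
move=> [h1 h2 h3]; split=> // [x|u]; first exact: le_trans (h1 x) NN.
by apply: IH (h3 u); rewrite ler_wpM2r ?enorm_ge0.
Qed.

Lemma smoothD l N N' g g' : smooth l N g -> smooth l N' g' -> smooth l (N + N') (fun x => g x + g' x).
Proof.
elim: l N N' g g' => [|l IH] N N' g g' /=.
  move=> [h1 h2] [k1 k2]; split=> [x|x y].
    by apply: le_trans (ler_normD _ _) _; exact: lerD.
  rewrite (_ : _ - _ = (g x - g y) + (g' x - g' y)); last by ring.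
  by apply: le_trans (ler_normD _ _) _; rewrite mulrDl; exact: lerD.
move=> [h1 h2 h3] [k1 k2 k3]; split=> [x|x|u].
- by apply: le_trans (ler_normD _ _) _; exact: lerD.
- exact: differentiableD.
- have -> : 'D_u (fun x => g x + g' x) = fun x => 'D_u g x + 'D_u g' x.
    by apply/funext => x; rewrite -deriveD//; exact: diff_derivable.
  by rewrite mulrDl; exact: IH.
Qed.

Lemma smoothZ l N a g : smooth l N g -> smooth l (`|a| * N) (fun x => a * g x).
Proof.
elim: l N g => [|l IH] N g /=.
  move=> [h1 h2]; split=> [x|x y]; first by rewrite normrM ler_wpM2l.
  by rewrite -mulrBr normrM -mulrA ler_wpM2l.
move=> [h1 h2 h3]; split=> [x|x|u].
- by rewrite normrM ler_wpM2l.
- exact: differentiableZ.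
- have -> : 'D_u (fun x => a * g x) = fun x => a * 'D_u g x.
    by apply/funext => x; apply: deriveZ; exact: diff_derivable.
  by rewrite -mulrA; exact: IH.
Qed.

Lemma smooth0 l : smooth l 0 (fun=> 0).
Proof.
elim: l => [|l IH] /=; first by split=> [x|x y]; rewrite ?subrr normr0 ?mul0r.
split=> [x||u]; [by rewrite normr0|by []|].
rewrite mul0r (_ : 'D_u _ = fun=> 0)//; apply/funext => x; exact: derive_cst.
Qed.

Lemma smooth_sum (I : Type) (s : seq I) l (N : I -> R) (g : I -> 'rV[R]_d -> R) :
  (forall i, smooth l (N i) (g i)) ->
  smooth l (\sum_(i <- s) N i) (fun x => \sum_(i <- s) g i x).
Proof.
move=> h; elim: s => [|i s IH].
  by rewrite big_nil; under eq_fun do rewrite big_nil; exact: smooth0.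
rewrite big_cons (_ : (fun x => _) = fun x => g i x + \sum_(j <- s) g j x); first exact: smoothD.
by apply/funext => x; rewrite big_cons.
Qed.

Lemma smooth_differentiable l N g x : smooth l.+1 N g -> differentiable g x.
Proof. by case. Qed.

Lemma smooth_derive l N g u : smooth l.+1 N g -> smooth l (N * enorm u) ('D_u g).
Proof. by case=> _ _; apply. Qed.

Lemma smooth_lipschitz l N g x v : smooth l.+1 N g -> `|g (x + v) - g x| <= N * enorm v.
Proof.
move=> h; have [t _ ->] := mean_value x v (fun y => smooth_differentiable y h).
exact: (smooth_bound _ (smooth_derive v h)).
Qed.

(** For points at distance at most 1 the Lipschitz bound implies the Holder bound as [rho <= 1]; for
    distant points the sup norm gives [2 N], the origin of the factor. *)
Lemma smooth_drop l N g : smooth l.+1 N g -> smooth l (2 * N) g.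
Proof.
elim: l N g => [|l IH] N g h; have N0 := smooth_ge0 h; have b x := smooth_bound x h.
  have b2 x : `|g x| <= 2 * N by have := b x; lra.
  split=> // x y.
  have := enorm_ge0 (x - y); set t := enorm (x - y) => t0.
  have h1 : `|g x - g y| <= N * t by have := smooth_lipschitz y (x - y) h; rewrite [y + _]addrC subrK.
  have [t1|t1] := leP t 1.
    apply: le_trans h1 _; apply: (@le_trans _ _ (N * t `^ rho)).
      rewrite ler_wpM2l//; have [->|tp] := eqVneq t 0; first by rewrite powR_ge0.
      by rewrite -[leLHS](powRr1 t0) ger_powR// lt_neqAle eq_sym tp t0.
    rewrite ler_wpM2r ?powR_ge0//; lra.
  apply: (@le_trans _ _ (2 * N)).
    by apply: le_trans (ler_normB _ _) _; have := b x; have := b y; lra.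
  by rewrite ler_peMr ?mulr_ge0// powR_ge1//; exact: ltW.
case: (h) => h1 h2 h3; split=> [x||u]//.
  by have := b x; lra.
by rewrite -mulrA; exact: IH.
Qed.

Lemma smooth_drop1 l N g : smooth l.+1 N g -> smooth 1 (2 ^+ l * N) g.
Proof.
elim: l N => [|l IH] N; first by rewrite expr0 mul1r.
by move=> /smooth_drop/IH; rewrite exprSr mulrA.
Qed.

Lemma smooth_taylor N g x v : smooth 1 N g ->
  `|g (x + v) - g x - 'D_v g x| <= N * (enorm v * enorm v `^ rho).
Proof.
move=> h; have N0 := smooth_ge0 h.
have [t /andP[t0 t1] ->] := mean_value x v (fun y => smooth_differentiable y h).
have [_ k] := smooth_derive v h; apply: le_trans (k _ _) _; rewrite -mulrA ler_wpM2l//.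
rewrite ler_wpM2l ?enorm_ge0// ge0_ler_powR ?nnegrE ?enorm_ge0//; first exact: ltW.
rewrite addrAC subrr add0r enormZ gtr0_norm// ler_piMl ?enorm_ge0//; exact: ltW.
Qed.

Lemma smooth_continuous l N g : smooth l N g -> continuous g.
Proof.
case: l => [[_ h]|l h]; first exact: holder_continuous rho_gt0 h.
by move=> x; apply: differentiable_continuous; exact: smooth_differentiable h.
Qed.

End smooth_class.

Lemma moderate_powR {R : realType} dT (T : measurableType dT) (w f : T -> R) (P : probability T R) (r : R) :
  weight P w -> 0 <= r <= 1 -> (forall t, 0 <= f t) -> moderate w f -> moderate w (fun t => f t `^ r).
Proof.
move=> ww /andP[r0 r1] f0 mf; apply: (moderate_le (g := fun t => 1 + f t)).
- by apply: (measurableT_comp (measurable_powR r)); case: mf.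
- move=> t; rewrite (ger0_norm (powR_ge0 _ _)) ger0_norm ?addr_ge0//.
  have [t1|t1] := leP (f t) 1.
    apply: (@le_trans _ _ 1); last by rewrite lerDl.
    exact: powR_le1.
  apply: (@le_trans _ _ (f t)); last by rewrite lerDr.
  by rewrite -[leRHS](powRr1 (f0 t)) ler_powR// ltW.
- by apply: (moderateD ww) => //; exact: moderate_cst.
Qed.

(** * The bias operator of a random translation *)

Section random_shift.
Context {R : realType} {d : nat}.
Variable rho : R.
Hypotheses (rho_gt0 : 0 < rho) (rho_le1 : rho <= 1).
Context dT {T : measurableType dT} (Q : probability T R) (w : T -> R).
Hypothesis ww : weight Q w.
Variable tau : T -> 'rV[R]_d.
Hypothesis mtau : measurable_fun setT tau.
Implicit Types (g f : 'rV[R]_d -> R) (x y u v : 'rV[R]_d) (N : R).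
Local Notation smooth := (smooth rho).
Local Notation mo := (moderate w).

Definition shift_mean g x : R := Ex Q (fun t => g (x + tau t)).
Definition shift_bias g x : R := shift_mean g x - g x.
Definition neumann k f x : R := \sum_(j < k.+1) (-1) ^+ j * iter j shift_bias f x.
Local Notation E := shift_mean.
Local Notation B := shift_bias.

Lemma moderate_shift l N g x : smooth l N g -> mo (fun t => g (x + tau t)).
Proof.
move=> h; apply: (moderate_le (g := fun=> N)); last exact: moderate_cst.
  apply: (measurableT_comp (continuous_measurable_row (smooth_continuous rho_gt0 h))).
  by apply: measurable_rowD => //; exact: measurable_cst.
by move=> t; rewrite [leRHS]ger0_norm ?(smooth_ge0 h)//; exact: smooth_bound h.
Qed.

Lemma shift_bias_Ex l N g x : smooth l N g -> B g x = Ex Q (fun t => g (x + tau t) - g x).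
Proof. by move=> h; rewrite (ExB ww (moderate_shift x h) (moderate_cst _ _)) Ex_cst. Qed.

(** The Taylor remainder of [g] is bounded uniformly in the base point, hence survives the average
    over the shift, and [holder_differentiable] applies. *)
Lemma derive_shift_mean N g x : smooth 1 N g ->
  differentiable (E g) x /\ forall u, 'D_u (E g) x = E ('D_u g) x.
Proof.
move=> h; have N0 := smooth_ge0 h.
have md u := moderate_shift x (smooth_derive u h).
pose p : 'rV[R]_d := \row_i E ('D_(delta_mx ord0 i) g) x.
have pE u : dot p u = E ('D_u g) x.
  transitivity (\sum_i u ord0 i * Ex Q (fun t => 'D_(delta_mx ord0 i) g (x + tau t))).
    by apply: eq_bigr => i _; rewrite mxE mulrC.
  under eq_bigr => i _ do rewrite -(ExZ ww _ (md _)).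
  rewrite -(Ex_sum ww); last by move=> i; exact: moderateZ.
  congr Ex; apply/funext => t; rewrite derive_gradient; last exact: smooth_differentiable h.
  by apply: eq_bigr => i _; rewrite mxE mulrC.
have [] := @holder_differentiable _ _ (E g) x p N rho rho_gt0 N0.
  move=> u; rewrite pE /E.
  rewrite -(ExB ww (moderate_shift _ h) (moderate_shift _ h)).
  rewrite -(ExB ww _ (md u)); last by apply: (moderateB ww); exact: moderate_shift h.
  rewrite -[leRHS](Ex_cst Q); apply: (Ex_norm_le ww); last first.
  - by move=> t; rewrite [x + u + _]addrAC; exact: (smooth_taylor rho_gt0 _ _ h).
  - exact: moderate_cst.
  - by apply: (moderateB ww) => //; apply: (moderateB ww); exact: moderate_shift h.
by move=> dg D; split=> // u; rewrite D pE.
Qed.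

Lemma shift_mean_smooth l N g : smooth l N g -> smooth l N (E g).
Proof.
have eb l' N' g' x : smooth l' N' g' -> `|E g' x| <= N'.
  move=> h; rewrite -[leRHS](Ex_cst Q); apply: (Ex_norm_le ww) => [||t].
  - exact: moderate_shift h.
  - exact: moderate_cst.
  - exact: smooth_bound h.
elim: l N g => [|l IH] N g h.
  split=> [x|x y]; first exact: eb h.
  rewrite -(ExB ww (moderate_shift _ h) (moderate_shift _ h)) -[leRHS](Ex_cst Q).
  apply: (Ex_norm_le ww) => [||t].
  - by apply: (moderateB ww); exact: moderate_shift h.
  - exact: moderate_cst.
  - by case: h => _ h; apply: le_trans (h _ _) _; rewrite opprD addrACA subrr addr0.
have D x := derive_shift_mean x (smooth_drop1 rho_gt0 rho_le1 h).
split=> [x|x|u]; first exact: eb h.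
  by case: (D x).
have -> : 'D_u (E g) = E ('D_u g) by apply/funext => x; case: (D x) => _ ->.
by apply: IH; exact: smooth_derive.
Qed.

Lemma derive_shift_bias N g u x : smooth 1 N g -> 'D_u (B g) x = B ('D_u g) x.
Proof.
move=> h; have [dE D] := derive_shift_mean x h.
rewrite -[B g]/(E g - g) deriveB ?D//; apply: diff_derivable => //.
exact: smooth_differentiable h.
Qed.

(** Abstract form of the estimator: [tau] is its error, controlled on the event [Z t <= kappa], and
    [w1] is a centred linear approximation of [tau], controlled everywhere. *)
Variables (Z : T -> R) (a b kappa K1 K2 Delta : R) (w1 : T -> 'rV[R]_d).
Hypotheses (Z_ge0 : forall t, 0 <= Z t) (mZ : mo Z).
Hypotheses (a_ge0 : 0 <= a) (b_ge0 : 0 <= b) (kappa_gt0 : 0 < kappa).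
Hypothesis tau_le : forall t, Z t <= kappa -> enorm (tau t) <= a * Z t.
Hypothesis tau_w1 : forall t, Z t <= kappa -> enorm (tau t - w1 t) <= b * Z t ^+ 2.
Hypothesis w1_le : forall t, enorm (w1 t) <= a * Z t.
Hypothesis mw1 : forall i, mo (fun t => w1 t ord0 i).
Hypothesis Ex_w1 : forall i, Ex Q (fun t => w1 t ord0 i) = 0.
Hypotheses (Delta_ge0 : 0 <= Delta) (Delta_le1 : Delta <= 1) (K1_ge0 : 0 <= K1) (K2_ge0 : 0 <= K2).
Hypothesis Z_mean : Ex Q Z <= K1 * Delta.
Hypothesis Z_moment : Ex Q (fun t => Z t * Z t `^ rho) <= K2 * (Delta * Delta `^ rho).

(** The constant [a] serves on the event [Z <= kappa]; off it [1 <= Z / kappa] turns the trivial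
    bounds, with constants 2 and 4, into multiples of [Z]. *)
Definition shift_const : R := a + 4 / kappa.

Lemma shift_const_ge0 : 0 <= shift_const.
Proof. by rewrite addr_ge0// divr_ge0// ltW. Qed.

Lemma shift_increment l N g x t : smooth l.+1 N g ->
  `|g (x + tau t) - g x| <= N * (shift_const * Z t).
Proof.
move=> h; have N0 := smooth_ge0 h.
have [Zk|Zk] := leP (Z t) kappa.
  apply: le_trans (smooth_lipschitz x (tau t) h) _; rewrite ler_wpM2l//.
  apply: le_trans (tau_le Zk) _; rewrite ler_wpM2r// lerDl divr_ge0//; exact: ltW.
apply: (@le_trans _ _ (2 * N)).
  apply: le_trans (ler_normB _ _) _; have := smooth_bound (x + tau t) h; have := smooth_bound x h; lra.
rewrite mulrC ler_wpM2l// mulrDl; apply: ler_wpDl; first exact: mulr_ge0.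
have : 4 / kappa * kappa <= 4 / kappa * Z t by rewrite ler_wpM2l ?divr_ge0//; exact: ltW.
by rewrite divfK ?gt_eqF//; lra.
Qed.

(** The mean value theorem along the shift, applied to the difference [e] of [g] and a translate,
    whose derivative is Holder small in [x - y]. This controls the Holder seminorm of the bias, as
    [shift_increment] controls its size. *)
Lemma shift_increment2 N g x y t : smooth 1 N g ->
  `|(g (x + tau t) - g x) - (g (y + tau t) - g y)| <= N * enorm (x - y) `^ rho * (shift_const * Z t).
Proof.
move=> h; have N0 := smooth_ge0 h; have p0 := powR_ge0 (enorm (x - y)) rho.
have hx := shift_increment.
have [Zk|Zk] := leP (Z t) kappa.
  pose e z := g (x - y + z) - g z.
  have dg z : differentiable g z := smooth_differentiable z h.
  have dgs z : differentiable (fun z => g (x - y + z)) z.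
    by apply: (@differentiable_comp _ _ _ _ (fun z => x - y + z) g) => //; apply: differentiableD.
  have de z : differentiable e z by exact: differentiableB.
  have [s _ E2] := mean_value y (tau t) de.
  have -> : (g (x + tau t) - g x) - (g (y + tau t) - g y) = e (y + tau t) - e y.
    by rewrite /e addrA subrK; ring.
  have Ds z v : 'D_v (fun z => g (x - y + z)) z = 'D_v g (x - y + z).
    rewrite /derive; set F1 := (X in lim (X @ _) = _); set F2 := (X in _ = lim (X @ _)).
    suff -> : F1 = F2 by []; apply/funext => r; rewrite /F1 /F2 /=.
    by rewrite addrCA.
  rewrite E2 deriveB; [|exact: diff_derivable|exact: diff_derivable].
  have [_ k] := smooth_derive (tau t) h; rewrite Ds; apply: le_trans (k _ _) _.
  rewrite addrK mulrAC ler_wpM2l ?mulr_ge0//.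
  apply: le_trans (tau_le Zk) _; rewrite ler_wpM2r// lerDl divr_ge0//; exact: ltW.
have [_ k] := smooth_drop rho_gt0 rho_le1 h.
have k1 := k x y; have k2 := k (x + tau t) (y + tau t).
rewrite opprD addrACA subrr addr0 in k2.
apply: (@le_trans _ _ (N * enorm (x - y) `^ rho * 4)).
  rewrite (_ : _ - _ = (g (x + tau t) - g (y + tau t)) - (g x - g y)); last by ring.
  apply: le_trans (ler_normB _ _) _; lra.
rewrite ler_wpM2l ?mulr_ge0// mulrDl; apply: ler_wpDl; first exact: mulr_ge0.
have : 4 / kappa * kappa <= 4 / kappa * Z t by rewrite ler_wpM2l ?divr_ge0//; exact: ltW.
by rewrite divfK ?gt_eqF//; lra.
Qed.

Local Notation c1 := (shift_const * K1).

Lemma shift_bias_smooth l N g : smooth l.+1 N g -> smooth l (N * (c1 * Delta)) (B g).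
Proof.
have Zc N' : 0 <= N' -> Ex Q (fun t => N' * (shift_const * Z t)) <= N' * (c1 * Delta).
  move=> N0; rewrite (ExZ ww _ (moderateZ _ mZ)) (ExZ ww _ mZ) ler_wpM2l// -mulrA ler_wpM2l//.
  exact: shift_const_ge0.
have hb l' N' g' x : smooth l'.+1 N' g' -> `|B g' x| <= N' * (c1 * Delta).
  move=> h; rewrite (shift_bias_Ex x h); apply: le_trans (Zc _ (smooth_ge0 h)).
  apply: (Ex_norm_le ww) => [||t]; last exact: shift_increment h.
  - by apply: (moderateB ww); [exact: moderate_shift h|exact: moderate_cst].
  - exact/moderateZ/moderateZ.
elim: l N g => [|l IH] N g h.
  split=> [x|x y]; first exact: hb h.
  rewrite (shift_bias_Ex x h) (shift_bias_Ex y h).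
  have m1 z : mo (fun t => g (z + tau t) - g z).
    by apply: (moderateB ww); [exact: moderate_shift h|exact: moderate_cst].
  rewrite -(ExB ww (m1 x) (m1 y)) mulrAC.
  apply: le_trans (Zc _ _); last by rewrite mulr_ge0 ?powR_ge0 ?(smooth_ge0 h).
  apply: (Ex_norm_le ww) => [||t]; last exact: shift_increment2.
  - exact: (moderateB ww).
  - exact/moderateZ/moderateZ.
have h1 := smooth_drop1 rho_gt0 rho_le1 h.
split=> [x|x|u]; first exact: hb h.
  have [dE _] := derive_shift_mean x h1; rewrite -[B g]/(E g - g).
  by apply: differentiableB => //; exact: smooth_differentiable h.
have -> : 'D_u (B g) = B ('D_u g) by apply/funext => x; exact: derive_shift_bias h1.
by rewrite mulrAC; apply: IH; exact: smooth_derive.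
Qed.

Lemma shift_bias_iter j l N g : smooth (j + l) N g -> smooth l (N * (c1 * Delta) ^+ j) (iter j B g).
Proof.
elim: j l => [|j IH] l; first by rewrite expr0 mulr1.
by rewrite addSnnS exprSr mulrA => /IH; exact: shift_bias_smooth.
Qed.

(** The first term is the Taylor remainder at [tau]; the second replaces [tau] by [w1], using
    [Z <= (1 + kappa) Z^rho] when [Z <= kappa]; the third bounds everything off this event, where
    [1 <= (Z / kappa)^rho]. *)
Definition shift_const2 : R := a * a `^ rho + b * (1 + kappa) + (2 / kappa + a) / kappa `^ rho.

Lemma shift_const2_ge0 : 0 <= shift_const2.
Proof.
have k0 := ltW kappa_gt0.
by rewrite !addr_ge0 ?mulr_ge0 ?addr_ge0 ?divr_ge0 ?invr_ge0 ?powR_ge0.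
Qed.

(** The derivative is taken along [w1] rather than [tau] because [w1] is centred, so the first-order
    term drops out of the bias in [shift_bias_top]. *)
Lemma shift_taylor N g x t : smooth 1 N g ->
  `|g (x + tau t) - g x - 'D_(w1 t) g x| <= N * (shift_const2 * (Z t * Z t `^ rho)).
Proof.
move=> h; have N0 := smooth_ge0 h; have k0 := ltW kappa_gt0; have Z0 := Z_ge0 t.
have y0 := powR_ge0 (Z t) rho; have q0 := powR_ge0 kappa rho; have a0 := powR_ge0 a rho.
have [Zk|Zk] := leP (Z t) kappa.
  have Zy : Z t <= (1 + kappa) * Z t `^ rho.
    have [Z1|Z1] := leP (Z t) 1.
      apply: (@le_trans _ _ (Z t `^ rho)); last by rewrite mulrDl mul1r lerDl mulr_ge0.
      have [->|Zn] := eqVneq (Z t) 0; first exact: powR_ge0.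
      by rewrite -[leLHS](powRr1 Z0) ger_powR// lt_neqAle eq_sym Zn Z0.
    apply: le_trans Zk _; rewrite mulrDl; apply: ler_wpDl; first by rewrite mul1r.
    by rewrite ler_peMr// powR_ge1//; exact: ltW.
  have D : 'D_(w1 t) g x = 'D_(tau t) g x - 'D_(tau t - w1 t) g x.
    by rewrite deriveBdir ?subKr//; exact: smooth_differentiable h.
  rewrite D (_ : _ - _ = 'D_(tau t - w1 t) g x + (g (x + tau t) - g x - 'D_(tau t) g x)); last by ring.
  apply: le_trans (ler_normD _ _) _.
  have e1 : `|'D_(tau t - w1 t) g x| <= N * (b * (1 + kappa) * (Z t * Z t `^ rho)).
    apply: le_trans (smooth_bound x (smooth_derive _ h)) _; rewrite ler_wpM2l//.
    apply: le_trans (tau_w1 Zk) _; rewrite -mulrA ler_wpM2l// expr2 mulrCA ler_wpM2l//.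
  have e2 : `|g (x + tau t) - g x - 'D_(tau t) g x| <= N * (a * a `^ rho * (Z t * Z t `^ rho)).
    apply: le_trans (smooth_taylor rho_gt0 _ _ h) _; rewrite ler_wpM2l// mulrACA.
    apply: ler_pM; rewrite ?enorm_ge0 ?powR_ge0 ?tau_le//.
    rewrite -powRM// ge0_ler_powR ?nnegrE ?enorm_ge0 ?mulr_ge0 ?tau_le//; exact: ltW.
  apply: le_trans (lerD e1 e2) _; rewrite -mulrDr (ler_wpM2l N0)// -mulrDl ler_wpM2r ?mulr_ge0//.
  by rewrite /shift_const2 [b * _ + _]addrC lerDl divr_ge0// addr_ge0// divr_ge0.
have kp : 0 < kappa `^ rho by rewrite powR_gt0.
apply: (@le_trans _ _ (N * (2 + a * Z t))).
  rewrite mulrDr; apply: le_trans (ler_normB _ _) _; apply: lerD.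
    apply: le_trans (ler_normB _ _) _; have := smooth_bound (x + tau t) h; have := smooth_bound x h; lra.
  by apply: le_trans (smooth_bound x (smooth_derive _ h)) _; rewrite ler_wpM2l.
rewrite ler_wpM2l//; apply: (@le_trans _ _ ((2 / kappa + a) / kappa `^ rho * (Z t * Z t `^ rho))); last first.
  by rewrite ler_wpM2r ?mulr_ge0// /shift_const2 lerDr addr_ge0// mulr_ge0// addr_ge0.
apply: (@le_trans _ _ ((2 / kappa + a) * Z t)).
  rewrite mulrDl lerD2r; have : 2 / kappa * kappa <= 2 / kappa * Z t by rewrite ler_wpM2l ?divr_ge0//; exact: ltW.
  by rewrite divfK ?gt_eqF.
have A0 : 0 <= (2 / kappa + a) * Z t by rewrite mulr_ge0// addr_ge0// divr_ge0.
rewrite [leRHS](_ : _ = (2 / kappa + a) * Z t * (Z t `^ rho / kappa `^ rho)); last by ring.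
rewrite ler_peMr// ler_pdivlMr// mul1r.
by rewrite ge0_ler_powR ?nnegrE// ltW.
Qed.

Lemma shift_bias_top N g x : smooth 1 N g ->
  `|B g x| <= N * (shift_const2 * K2 * (Delta * Delta `^ rho)).
Proof.
move=> h; have N0 := smooth_ge0 h.
have mD : mo (fun t => 'D_(w1 t) g x).
  under eq_fun do rewrite (derive_gradient _ (smooth_differentiable x h)).
  by apply: (moderate_sum ww) => i; exact: moderateZ.
have ED : Ex Q (fun t => 'D_(w1 t) g x) = 0.
  under eq_fun do rewrite (derive_gradient _ (smooth_differentiable x h)).
  rewrite (Ex_sum ww) => [|i]; last exact: moderateZ.
  by apply: big1 => i _; rewrite (ExZ ww _ (mw1 i)) Ex_w1 mulr0.
have mg : mo (fun t => g (x + tau t) - g x).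
  by apply: (moderateB ww); [exact: moderate_shift h|exact: moderate_cst].
have mZr : mo (fun t => Z t * Z t `^ rho).
  by apply: moderateM => //; apply: (moderate_powR ww) => //; rewrite rho_le1 ltW.
rewrite (shift_bias_Ex x h) -[Ex Q _]subr0 -ED -(ExB ww mg mD).
apply: (@le_trans _ _ (Ex Q (fun t => N * (shift_const2 * (Z t * Z t `^ rho))))).
  apply: (Ex_norm_le ww) => [||t]; last exact: shift_taylor.
  - exact: (moderateB ww).
  - exact/moderateZ/moderateZ.
rewrite (ExZ ww _ (moderateZ _ mZr)) (ExZ ww _ mZr) ler_wpM2l// -mulrA ler_wpM2l//.
exact: shift_const2_ge0.
Qed.

Hypothesis c1_ge0 : 0 <= c1.

Lemma normr_alternate j r : `|(-1) ^+ j * r| = `|r| :> R.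
Proof. by rewrite normrM normrX normrN1 expr1n mul1r. Qed.

Let bias_term j k N f : (j <= k)%N -> smooth k.+1 N f ->
  smooth (k - j).+1 (N * (c1 * Delta) ^+ j) (iter j B f).
Proof. by move=> jk h; apply: shift_bias_iter; rewrite addnS subnKC. Qed.

Lemma smooth_neumann k N f : smooth k.+1 N f ->
  smooth 1 (N * (\sum_(j < k.+1) 2 ^+ (k - j) * c1 ^+ j)) (neumann k f).
Proof.
move=> h; have N0 := smooth_ge0 h; rewrite mulr_sumr; apply: smooth_sum => j.
have jk : (j <= k)%N by rewrite -ltnS.
have := smoothZ ((-1) ^+ j) (smooth_drop1 rho_gt0 rho_le1 (bias_term jk h)).
apply: smooth_le; rewrite -[_ ^+ j]mulr1 normr_alternate normr1 mul1r mulrCA ler_wpM2l//.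
apply: ler_wpM2l; first exact: exprn_ge0.
by rewrite lerXn2r ?nnegrE ?(mulr_ge0 c1_ge0)// ler_piMr.
Qed.

(** Since the mean operator is [1 + B], applying it to the sum of the [(-B)^j] telescopes to
    [1 - (-B)^(k+1)]. *)
Lemma neumann_mean k N f x : smooth k.+1 N f ->
  E (neumann k f) x - f x = (-1) ^+ k * iter k.+1 B f x.
Proof.
move=> h.
have hj (j : nat) : (j <= k)%N -> exists N', smooth 1 N' (iter j B f).
  by move=> jk; eexists; exact: (smooth_drop1 rho_gt0 rho_le1 (bias_term jk h)).
have mj (j : 'I_k.+1) : mo (fun t => (-1) ^+ j * iter j B f (x + tau t)).
  by have [|N' h'] := hj j; rewrite -1?ltnS//; apply: moderateZ; exact: moderate_shift h'.
rewrite {1}/shift_mean /neumann (Ex_sum ww mj).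
pose e j := - ((-1) ^+ j * iter j B f x).
have -> : \sum_(j < k.+1) Ex Q (fun t => (-1) ^+ j * iter j B f (x + tau t)) =
    \sum_(j < k.+1) (e j.+1 - e j).
  apply: eq_bigr => j _; have [|N' h'] := hj j; first by rewrite -ltnS.
  have E1 : iter j.+1 B f x = Ex Q (fun t => iter j B f (x + tau t)) - iter j B f x by [].
  rewrite (ExZ ww _ (moderate_shift x h')) /e E1 exprS.
  by move: (Ex Q _) (iter j B f x) ((-1) ^+ j) => p q r; ring.
rewrite -(big_mkord xpredT (fun j => e j.+1 - e j)) telescope_sumr// /e exprS expr0 /=.
by move: (B _ x) (_ ^+ k) => p q; ring.
Qed.

Lemma neumann_mean_le k N f x : smooth k.+1 N f ->
  `|E (neumann k f) x - f x| <= N * (c1 ^+ k * (shift_const2 * K2)) * (Delta ^+ k * (Delta * Delta `^ rho)).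
Proof.
move=> h; rewrite (neumann_mean x h) normr_alternate iterS.
have hk : smooth 1 (N * (c1 * Delta) ^+ k) (iter k B f) by apply: shift_bias_iter; rewrite addn1.
by apply: le_trans (shift_bias_top x hk) _; apply: eq_ler; rewrite exprMn; ring.
Qed.

(** The terms with [j >= 1] each carry at least one factor [Delta]; as [Delta <= 1], higher powers
    are bounded by the first. *)
Lemma neumann_derive_le k N f x u : smooth k.+1 N f ->
  `|'D_u (neumann k f) x - 'D_u f x| <= N * (\sum_(j < k) c1 ^+ j.+1) * Delta * enorm u.
Proof.
move=> h; have N0 := smooth_ge0 h.
have hb (j : nat) y : (j <= k)%N -> differentiable (iter j B f) y.
  by move=> jk; apply: smooth_differentiable (bias_term jk h).
have -> : neumann k f = (fun y => f y + \sum_(j < k) (-1) ^+ j.+1 * iter j.+1 B f y).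
  by apply/funext => y; rewrite /neumann big_ord_recl expr0 mul1r.
pose g (j : 'I_k) y := (-1) ^+ j.+1 * iter j.+1 B f y.
have hg (j : 'I_k) : smooth 1 (2 ^+ (k - j.+1) * (N * (c1 * Delta) ^+ j.+1)) (g j).
  have := smoothZ ((-1) ^+ j.+1) (smooth_drop1 rho_gt0 rho_le1 (bias_term (ltn_ord j) h)).
  by apply: smooth_le; rewrite -[_ ^+ j.+1]mulr1 normr_alternate normr1 mul1r.
have -> : 'D_u (fun y => f y + \sum_(j < k) (-1) ^+ j.+1 * iter j.+1 B f y) x = 'D_u f x + \sum_(j < k) 'D_u (g j) x.
  rewrite -[fun y => _]/(f + fun y => \sum_(j < k) g j y).
  rewrite (_ : (fun y => \sum_(j < k) g j y) = \sum_(j < k) g j); last by apply/funext => y; rewrite fct_sumE.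
  have dg j : derivable (g j) x u by apply: diff_derivable; exact: smooth_differentiable (hg j).
  rewrite deriveD ?derive_sum//; last exact: derivable_sum.
  by apply: diff_derivable; exact: (hb 0).
rewrite addrAC subrr add0r mulr_sumr !mulr_suml; apply: le_trans (ler_norm_sum _ _ _) _; apply: ler_sum => j _.
rewrite /g deriveZ; last by apply: diff_derivable; exact: hb.
rewrite [_ *: _]/(_ * _) normr_alternate.
apply: le_trans (smooth_bound x (smooth_derive u (bias_term (ltn_ord j) h))) _.
rewrite ler_wpM2r ?enorm_ge0// -[leRHS]mulrA; apply: ler_wpM2l => //.
rewrite exprMn; apply: ler_wpM2l; first exact: exprn_ge0.
by rewrite exprS ler_piMr// exprn_ile1.
Qed.

End random_shift.

(** * Dependence of the Newton approximations on one observation *)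

(** The integral of a nonnegative function is a supremum over simple functions below it, so
    monotonicity holds without measurability. It is applied to gradient norms of functions that are
    only locally Lipschitz. *)
Lemma ge0_le_integral_any {R : realType} dT (T : measurableType dT) (mu : {measure set T -> \bar R})
    (f g : T -> \bar R) :
  (forall x, (0 <= f x)%E) -> (forall x, (f x <= g x)%E) -> (\int[mu]_x f x <= \int[mu]_x g x)%E.
Proof.
move=> f0 fg; have g0 x : (0 <= g x)%E by exact: le_trans (f0 x) (fg x).
rewrite !ge0_integralTE//; apply: le_ereal_sup => _ [h hf <-].
by exists h => // x; exact: le_trans (hf x) (fg x).
Qed.

(** Apply [t^r <= 1 + t^2] to [Z / D]: the second moment alone yields every fractional moment up to
    order 2 with the right power of [D]. *)
Lemma fractional_moment {R : realType} dT (T : measurableType dT) (Q : probability T R) (w Z : T -> R) (c D r : R) :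
  weight Q w -> moderate w Z -> (forall t, 0 <= Z t) -> 0 < D -> 0 <= r <= 2 ->
  Ex Q (fun t => Z t ^+ 2) <= c * D ^+ 2 ->
  moderate w (fun t => Z t `^ r) /\ Ex Q (fun t => Z t `^ r) <= (1 + c) * D `^ r.
Proof.
move=> ww mZ Z0 D0 /andP[r0 r2] h2.
have bound (t : R) : 0 <= t -> t `^ r <= 1 + t ^+ 2.
  move=> t0; have [t1|t1] := leP t 1.
    by apply: le_trans (powR_le1 r0 t0 t1) _; rewrite lerDl sqr_ge0.
  rewrite -powR_mulrn//; apply: ler_wpDl => //; apply: ler_powR => //; exact: ltW.
have mr : moderate w (fun t => Z t `^ r).
  apply: (moderate_le (g := fun t => 1 + Z t ^+ 2)).
  - by apply: (measurableT_comp (measurable_powR r)); case: mZ.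
  - by move=> t; rewrite !ger0_norm ?powR_ge0 ?addr_ge0 ?sqr_ge0 ?bound.
  - by apply: (moderateD ww); [exact: moderate_cst|exact: moderateX].
split=> //; have Dn : D != 0 by rewrite gt_eqF.
have mD : moderate w (fun t => 1 + D ^- 2 * Z t ^+ 2).
  by apply: (moderateD ww); [exact: moderate_cst|exact/moderateZ/moderateX].
apply: (@le_trans _ _ (Ex Q (fun t => D `^ r * (1 + D ^- 2 * Z t ^+ 2)))).
  apply: (Ex_le ww) => //; first exact: moderateZ.
  move=> t; have -> : Z t = D * (Z t / D) by rewrite mulrCA mulfV ?mulr1.
  have t0 : 0 <= Z t / D by rewrite divr_ge0// ltW.
  rewrite powRM ?(ltW D0)// ler_wpM2l ?powR_ge0//; apply: le_trans (bound _ t0) _.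
  by rewrite lerD2l [in leRHS]exprMn mulrA mulVf ?mul1r ?expf_neq0.
rewrite (ExZ ww _ mD) mulrC ler_wpM2r ?powR_ge0//.
rewrite (ExD ww (moderate_cst _ _) (moderateZ _ (moderateX 2 mZ))) Ex_cst lerD2l.
by rewrite (ExZ ww _ (moderateX 2 mZ)) ler_pdivrMl ?exprn_gt0// mulrC.
Qed.

Section newton_increments.
Context {R : realType} {d : nat}.
Variables (V : potential R d) (M L m : R).
Hypotheses (M_gt0 : 0 < M) (L_gt0 : 0 < L) (m_gt0 : 0 < m).
Hypothesis hV : assumption1 M L m V.
Variable rho : R.
Hypotheses (rho_gt0 : 0 < rho) (rho_le1 : rho <= 1).
Local Notation G := (gradient V).
Local Notation H := (hessian V).
Local Notation I := (fisher V).
Local Notation it := (newton_iter V).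
Local Notation A := (invmx I).
Implicit Types (u v h : 'rV[R]_d).

Let Vd := a1_twice_differentiable hV.
Let VM := a1_hessian_bounded hV.
Let VL := a1_hessian_lipschitz hV.
Let mi : 0 < m^-1. Proof. by rewrite invr_gt0. Qed.

(** A remainder of order [1 + rho] valid for all [v]: the Lipschitz Hessian gives it for [|v| <= 1],
    the bounded Hessian for larger [v]. *)
Lemma gradient_taylor_holder x v :
  enorm (G (x + v) - G x - v *m H x) <= (L + 2 * M) * (enorm v * enorm v `^ rho).
Proof.
have v0 := enorm_ge0 v; have p0 := powR_ge0 (enorm v) rho; have L0 := ltW L_gt0; have M0 := ltW M_gt0.
have [v1|v1] := leP (enorm v) 1.
  apply: le_trans (gradient_taylor L_gt0 Vd VL x v) _; apply: ler_pM; rewrite ?sqr_ge0//.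
    by rewrite lerDl mulr_ge0.
  rewrite expr2 ler_wpM2l//; have [->|vn] := eqVneq (enorm v) 0; first exact: powR_ge0.
  by rewrite -[leLHS](powRr1 v0) ger_powR// lt_neqAle eq_sym vn v0.
apply: (@le_trans _ _ (M * enorm v + M * enorm v)).
  apply: enormD_le; last by rewrite enormN; exact: hessian_bounded M_gt0 VM v x.
  by apply: le_trans (gradient_lipschitz M_gt0 Vd VM _ _) _; rewrite addrAC subrr add0r.
have := powR_ge1 (ltW rho_gt0) (ltW v1).
have := mulr_ge0 M0 v0; have := mulr_ge0 L0 (mulr_ge0 v0 p0); nra.
Qed.

Variable n : nat.
Hypothesis n_gt0 : (0 < n)%N.
Variables (x x' : 'I_n -> 'rV[R]_d) (j : 'I_n) (u : 'rV[R]_d).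
Hypothesis xj : x' j = x j + u.
Hypothesis xk : forall k, k != j -> x' k = x k.
Local Notation Gm := (empirical_gradient V).
Local Notation Hm := (empirical_hessian V).
Local Notation Z := (deviation V).

Let n0 : (0 : R) < n%:R. Proof. by rewrite ltr0n. Qed.

(** Derivative of a Newton step in the observation [x j]: differentiating [it + Gm x it *m A] gives
    [J + (n^-1 H - J Hm) A], and [J = J I A] collects everything in front of [A]. *)
Definition newton_jacobian_step (J : 'M[R]_d) h : 'M[R]_d :=
  (n%:R^-1 *: H (x j - h) + J *m (I - Hm (fun k => x k - h))) *m A.

Fixpoint newton_jacobian i : 'M[R]_d :=
  if i is i'.+1 then newton_jacobian_step (newton_jacobian i') (it x i') else 0.
Local Notation J := newton_jacobian.

Lemma newton_jacobianS i v : v *m J i.+1 =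
  (n%:R^-1 *: (v *m H (x j - it x i)) + v *m J i *m (I - Hm (fun k => x k - it x i))) *m A.
Proof. by rewrite /= /newton_jacobian_step mulmxA mulmxDr -scalemxAr mulmxA. Qed.

Let x'E k : x' k = x k + (if k == j then u else 0).
Proof. by case: eqVneq => [->|/xk ->]; rewrite ?xj ?addr0. Qed.

Fixpoint newton_lip i : R :=
  if i is i'.+1 then newton_lip i' + m^-1 * (M * (1 + newton_lip i')) else 0.

Lemma newton_lip_ge0 i : 0 <= newton_lip i.
Proof.
elim: i => //= i IH; rewrite addr_ge0// !mulr_ge0 ?addr_ge0//; exact: ltW.
Qed.

(** A crude bound without the factor [1 / n]; it feeds the remainder of the expansion and local
    Lipschitz continuity, while [newton_jacobian_le] has the sharp order. *)
Lemma newton_iter_lipschitz i : enorm (it x' i - it x i) <= newton_lip i * enorm u.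
Proof.
elim: i => [|i IH] /=; first by rewrite subrr enorm0 mul0r.
rewrite opprD addrACA -mulmxBl mulrDl; apply: enormD_le => //.
apply: le_trans (enorm_fisherV m_gt0 hV _) _; rewrite -mulrA ler_wpM2l//; first exact: ltW.
rewrite empirical_gradientB; apply: (average_le n_gt0) => k.
apply: le_trans (gradient_lipschitz M_gt0 Vd VM _ _) _; rewrite -mulrA ler_wpM2l//; first exact: ltW.
rewrite x'E (_ : _ - _ = (if k == j then u else 0) - (it x' i - it x i)); last first.
  by move: (it _ _) (it _ _) => p q; apply/rowP => l; rewrite !mxE; ring.
rewrite mulrDl mul1r; apply: enormD_le; last by rewrite enormN.
by case: eqP => // _; rewrite enorm0 enorm_ge0.
Qed.

Lemma mulmx_empirical_hessian v (y : 'I_n -> 'rV[R]_d) : v *m Hm y = n%:R^-1 *: \sum_k v *m H (y k).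
Proof. by rewrite /empirical_hessian -scalemxAr mulmx_sumr. Qed.

Lemma enorm_fisher_hessian h v : enorm (v *m (I - Hm (fun k => x k - h))) <= 2 * M * enorm v.
Proof.
rewrite mulmxBr (_ : 2 * M * enorm v = M * enorm v + M * enorm v); last by ring.
apply: enormD_le; first exact: fisher_le M_gt0 L_gt0 hV v.
rewrite enormN mulmx_empirical_hessian.
by apply: (average_le n_gt0) => k; exact: hessian_bounded M_gt0 VM v _.
Qed.

Lemma enorm_fisher_hessian_deviation h v :
  enorm (v *m (I - Hm (fun k => x k - h))) <= (Z x + L * enorm h) * enorm v.
Proof.
have -> : v *m (I - Hm (fun k => x k - h)) = v *m (I - Hm x) + n%:R^-1 *: \sum_k (v *m H (x k) - v *m H (x k - h)).
  have -> : n%:R^-1 *: \sum_k (v *m H (x k) - v *m H (x k - h)) = v *m Hm x - v *m Hm (fun k => x k - h).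
    rewrite sumrB scalerBr; symmetry.
    exact (congr2 (fun a b => a - b) (mulmx_empirical_hessian v _) (mulmx_empirical_hessian v _)).
  rewrite [LHS]mulmxBr [v *m (I - Hm x)]mulmxBr.
  have S (p q r : 'rV[R]_d) : p - r = p - q + (q - r) by rewrite addrA subrK.
  exact (S _ _ _).
rewrite mulrDl; apply: enormD_le.
  apply: le_trans (enorm_mulmx _ _) _; rewrite mulrC ler_wpM2r ?enorm_ge0//.
  by rewrite lerDl enorm_ge0.
apply: (average_le n_gt0) => k; apply: le_trans (hessian_lipschitz L_gt0 VL v _ _) _.
by rewrite opprB addrC subrK.
Qed.

Fixpoint jacobian_bound i : R :=
  if i is i'.+1 then m^-1 * (M + 2 * M * jacobian_bound i') else 0.

Lemma jacobian_bound_ge0 i : 0 <= jacobian_bound i.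
Proof.
elim: i => //= i IH; rewrite mulr_ge0 ?addr_ge0 ?mulr_ge0 ?(ltW mi)//; exact: ltW.
Qed.

Lemma newton_jacobian_le i v : enorm (v *m J i) <= jacobian_bound i / n%:R * enorm v.
Proof.
elim: i v => [|i IH] v; first by rewrite mulmx0 enorm0 !mul0r.
rewrite newton_jacobianS; apply: le_trans (enorm_fisherV m_gt0 hV _) _.
rewrite /= -!mulrA ler_wpM2l//; first exact: ltW.
rewrite (_ : _ * _ = n%:R^-1 * (M * enorm v) + 2 * M * (jacobian_bound i / n%:R * enorm v)); last by ring.
apply: enormD_le.
  rewrite enormZ ger0_norm ?invr_ge0// ler_wpM2l ?invr_ge0//; exact: hessian_bounded M_gt0 VM v _.
apply: le_trans (enorm_fisher_hessian _ _) _; rewrite ler_wpM2l//.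
by rewrite mulr_ge0// ltW.
Qed.

Definition jacobian_gap i : R :=
  m^-1 * (L * newton_bound M m i + jacobian_bound i * (1 + L * newton_bound M m i)).

Lemma jacobian_gap_ge0 i : 0 <= jacobian_gap i.
Proof.
have nb := newton_bound_ge0 M_gt0 m_gt0 i; have jb := jacobian_bound_ge0 i.
have L0 := ltW L_gt0; have mi0 := ltW mi.
by rewrite mulr_ge0// addr_ge0 ?mulr_ge0 ?addr_ge0 ?mulr_ge0.
Qed.

(** All later iterates depend on one observation as the linear term [it_1] does, up to [Z / n]. This
    is why subtracting the linear part reduces the variance. *)
Lemma newton_jacobian_gap i v :
  enorm (v *m J i.+1 - v *m J 1) <= jacobian_gap i / n%:R * (Z x * enorm v).
Proof.
have nb := newton_bound_ge0 M_gt0 m_gt0 i; have jb := jacobian_bound_ge0 i.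
have hle := newton_iter_le_deviation M_gt0 m_gt0 hV n_gt0 x i.
have Z0 := deviation_ge0 V x; have v0 := enorm_ge0 v; have L0 := ltW L_gt0.
have n1 : 0 <= n%:R^-1 :> R by rewrite invr_ge0 ltW.
have E1 : v *m J 1 = (n%:R^-1 *: (v *m H (x j))) *m A.
  by rewrite /= /newton_jacobian_step subr0 mul0mx addr0 mulmxA -scalemxAr.
have -> : v *m J i.+1 - v *m J 1 = (n%:R^-1 *: (v *m H (x j - it x i))
    + v *m J i *m (I - Hm (fun k => x k - it x i)) - n%:R^-1 *: (v *m H (x j))) *m A.
  exact (etrans (congr2 (fun a b => a - b) (newton_jacobianS i v) E1) (esym (mulmxBl _ _ _))).
apply: le_trans (enorm_fisherV m_gt0 hV _) _.
rewrite /jacobian_gap -!mulrA ler_wpM2l//; first exact: ltW.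
rewrite addrAC -scalerBr.
set h := it x i in hle *.
rewrite (_ : _ * _ = n%:R^-1 * (L * (newton_bound M m i * Z x) * enorm v)
   + (Z x + L * (newton_bound M m i * Z x)) * (jacobian_bound i / n%:R * enorm v)); last by ring.
apply: enormD_le.
  rewrite enormZ (ger0_norm n1) ler_wpM2l//.
  apply: le_trans (hessian_lipschitz L_gt0 VL v _ _) _; rewrite ler_wpM2r// ler_wpM2l//.
  by rewrite addrAC subrr add0r enormN.
apply: le_trans (enorm_fisher_hessian_deviation _ _) _; apply: ler_pM; rewrite ?enorm_ge0//.
- by rewrite addr_ge0 ?mulr_ge0 ?enorm_ge0.
- by rewrite lerD2l ler_wpM2l.
- exact: newton_jacobian_le.
Qed.

Fixpoint jacobian_remainder i : R :=
  if i is i'.+1 then m^-1 * (2 * M * jacobian_remainder i' + (L + 2 * M) * (1 + newton_lip i') ^+ 2) else 0.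

Lemma jacobian_remainder_ge0 i : 0 <= jacobian_remainder i.
Proof.
have L0 := ltW L_gt0; have M0 := ltW M_gt0.
elim: i => //= i IH; rewrite mulr_ge0 ?(ltW mi)// addr_ge0 ?mulr_ge0 ?addr_ge0 ?mulr_ge0//.
  exact: newton_lip_ge0.
exact: newton_lip_ge0.
Qed.

(** Identifies [newton_jacobian] as the derivative, with a remainder of order [1 + rho] that the
    Newton recursion propagates. *)
Lemma newton_iter_expansion i :
  enorm (it x' i - it x i - u *m J i) <= jacobian_remainder i * (enorm u * enorm u `^ rho).
Proof.
have u0 := enorm_ge0 u; have p0 := powR_ge0 (enorm u) rho; have M0 := ltW M_gt0.
elim: i => [|i IH]; first by rewrite subr0 mulmx0 subr0 enorm0 mul0r.
have lip := newton_iter_lipschitz i.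
have -> : jacobian_remainder i.+1 =
  m^-1 * (2 * M * jacobian_remainder i + (L + 2 * M) * (1 + newton_lip i) ^+ 2) by [].
rewrite [it x' i.+1]/(_ + _) [it x i.+1]/(_ + _).
set h := it x i in IH lip *; set h' := it x' i in IH lip *; set Ji := J i in IH *.
(* The increment of the argument [x k - it] of the gradient: the change of the iterate affects every
   term, the change [u] of the observation only the term [j]. *)
pose v k := (if k == j then u else 0) - (h' - h).
pose B := I - Hm (fun k => x k - h).
have vE k : x' k - h' = x k - h + v k.
  by rewrite x'E /v; move: (if _ then _ else _) => p; apply/rowP => l; rewrite !mxE; ring.
have key : Gm x' h' - Gm x h = n%:R^-1 *: (u *m H (x j - h)) - (h' - h) *m Hm (fun k => x k - h)
    + n%:R^-1 *: \sum_k (G (x k - h + v k) - G (x k - h) - v k *m H (x k - h)).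
  rewrite empirical_gradientB; under eq_bigr do rewrite vE.
  rewrite [in RHS]sumrB scalerBr addrC.
  have -> : n%:R^-1 *: \sum_k v k *m H (x k - h) = n%:R^-1 *: (u *m H (x j - h)) - (h' - h) *m Hm (fun k => x k - h).
    rewrite mulmx_empirical_hessian -scalerBr; congr (_ *: _).
    under eq_bigr do rewrite /v mulmxBl.
    rewrite sumrB; congr (_ - _); rewrite (bigD1 j)//= eqxx big1 ?addr0// => k /negPf ->.
    by rewrite mul0mx.
  by rewrite subrK.
have -> : h' + Gm x' h' *m A - (h + Gm x h *m A) - u *m J i.+1 =
    ((h' - h - u *m Ji) *m B
     + n%:R^-1 *: \sum_k (G (x k - h + v k) - G (x k - h) - v k *m H (x k - h))) *m A.
  rewrite newton_jacobianS opprD addrACA -mulmxBl key -/h -/Ji -/B.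
  set S := n%:R^-1 *: \sum_k _; set a := n%:R^-1 *: _.
  (* Writing [h' - h] as its image under [I] and then [A] puts the common factor [A] in front of
     every term. *)
  rewrite -{1}[h' - h](mulmxK (fisher_unit m_gt0 hV)) -mulmxDl -mulmxBl; congr (_ *m A).
  rewrite [in RHS]mulmxBl /B [in RHS]mulmxBr.
  by move: ((h' - h) *m I) ((h' - h) *m Hm _) (u *m Ji *m _) => p q r; apply/rowP => l; rewrite !mxE; ring.
apply: le_trans (enorm_fisherV m_gt0 hV _) _; rewrite -[leRHS]mulrA ler_wpM2l ?(ltW mi)// mulrDl.
apply: enormD_le.
  apply: le_trans (enorm_fisher_hessian _ _) _; rewrite -!mulrA ler_wpM2l// ler_wpM2l//.
apply: (average_le n_gt0) => k; apply: le_trans (gradient_taylor_holder _ _) _.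
rewrite -mulrA ler_wpM2l ?addr_ge0 ?mulr_ge0 ?(ltW L_gt0)//.
have l0 := newton_lip_ge0 i; have l1 : 1 <= 1 + newton_lip i by rewrite lerDl.
have vk : enorm (v k) <= (1 + newton_lip i) * enorm u.
  rewrite mulrDl mul1r; apply: enormD_le; last by rewrite enormN.
  by case: eqP => // _; rewrite enorm0.
rewrite expr2 mulrACA; apply: ler_pM; rewrite ?enorm_ge0 ?powR_ge0//.
apply: (@le_trans _ _ (((1 + newton_lip i) * enorm u) `^ rho)).
  rewrite ge0_ler_powR ?nnegrE ?enorm_ge0 ?mulr_ge0 ?addr_ge0//; exact: ltW.
rewrite powRM ?addr_ge0// ler_wpM2r//.
by rewrite -[leRHS]powRr1 ?addr_ge0// ler_powR.
Qed.

End newton_increments.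

(** * Variance bounds from the Poincare inequality *)

Lemma lipschitz_locally {R : realType} {d : nat} (g : 'rV[R]_d -> R) (K : R) :
  (forall x y, `|g x - g y| <= K * enorm (x - y)) -> locally_lipschitz g.
Proof. by move=> h x; exists setT; [exact: filterT|exists K => y z _ _; exact: h]. Qed.

Section poincare.
Context {R : realType} {d : nat}.
Variables (V : potential R d) (M L m : R).
Hypotheses (M_gt0 : 0 < M) (L_gt0 : 0 < L) (m_gt0 : 0 < m).
Hypothesis hV : assumption1 M L m V.
Local Notation P := (gibbs V : probability 'rV[R]_d R).
Local Notation G := (gradient V).
Local Notation H := (hessian V).
Local Notation w := (gibbs_weight V).
Local Notation mo := (moderate w).
Let ww := weight_gibbs M_gt0 hV.

Lemma variance_evar g : mo g -> ('V_(gibbs V)[g] = (evar P g)%:E)%E.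
Proof.
move=> mg; rewrite /variance covariance.unlock expectation.unlock.
have -> : fine (\int[gibbs V]_z (g z)%:E)%E = Ex P g by [].
have mv : mo (fun x => (g x - Ex P g) ^+ 2).
  by apply: moderateX; apply: (moderateB ww) => //; exact: moderate_cst.
rewrite /evar /Ex /Rintegral fineK; last first.
  exact: integrable_fin_num (moderate_integrable ww mv).
by apply: eq_integral => x _; rewrite expr2.
Qed.

(** Stated with a measurable majorant [h] of the gradient norm, so that both sides are real
    expectations of functions of polynomial growth. *)
Definition poincare_bound (c : R) : Prop := forall g h : 'rV[R]_d -> R,
  locally_lipschitz g -> mo g -> mo h -> (forall x, enorm (gradient g x) <= h x) ->
  evar P g <= c * Ex P (fun x => h x ^+ 2).

Let valid (C : R) : Prop := forall g : 'rV[R]_d -> R, locally_lipschitz g ->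
    ('V_(gibbs V)[g] <= C%:E * 'E_(gibbs V)[fun x => (enorm (gradient g x) ^+ 2)%R])%E.

Let gradient_mean (g h : 'rV[R]_d -> R) : mo h -> (forall x, enorm (gradient g x) <= h x) ->
  ('E_(gibbs V)[fun x => (enorm (gradient g x) ^+ 2)%R] <= (Ex P (fun x => h x ^+ 2))%:E)%E.
Proof.
move=> mh gh; rewrite expectation.unlock.
have -> : (Ex P (fun x => h x ^+ 2))%:E = (\int[P]_x (h x ^+ 2)%:E)%E.
  by rewrite /Ex /Rintegral fineK//; exact: integrable_fin_num (moderate_integrable ww (moderateX 2 mh)).
apply: ge0_le_integral_any => x; rewrite lee_fin ?sqr_ge0//.
by rewrite lerXn2r ?nnegrE ?enorm_ge0 ?(le_trans (enorm_ge0 _) (gh x)).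
Qed.

Let valid_bound C : 0 <= C -> valid C -> poincare_bound C.
Proof.
move=> C0 vC g h lg mg mh gh; rewrite -lee_fin -variance_evar//.
by apply: le_trans (vC g lg) _; rewrite EFinM lee_wpmul2l ?lee_fin//; exact: gradient_mean.
Qed.

Hypothesis d_gt0 : (0 < d)%N.

Let u0 : 'rV[R]_d := delta_mx ord0 (Ordinal d_gt0).

(** Test with a partial derivative of [V]: its variance is a diagonal entry of the Fisher
    information, at least [m], and its gradient is a row of the Hessian, of norm at most [M]. *)
Let valid_ge C : valid C -> m / M ^+ 2 <= C.
Proof.
move=> vC; have Vd := a1_twice_differentiable hV; have VM := a1_hessian_bounded hV.
pose g := 'D_u0 V.
have u1 : enorm u0 = 1 by exact: enorm_delta.
have gE : g = fun x => dot (G x) u0.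
  by apply/funext => x; rewrite /g derive_gradient//; exact: differentiable_potential Vd _.
have mg : mo g by rewrite gE; exact: moderate_dotG M_gt0 hV u0.
have lg : locally_lipschitz g.
  apply: (@lipschitz_locally _ _ _ M) => x y; rewrite gE -dotBl.
  apply: le_trans (cauchy_schwarz _ _) _; rewrite u1 mulr1; exact: gradient_lipschitz M_gt0 Vd VM x y.
have gh x : enorm (gradient g x) <= M.
  apply: enorm_dual_le => [|v]; first exact: ltW.
  rewrite -derive_gradient; last exact: differentiable_potential2 Vd _ _.
  rewrite (derive2_hessian Vd); apply: le_trans (dot_le _ _) _; rewrite u1 mulr1.
  exact: hessian_bounded M_gt0 VM v x.
have mE : m <= evar P g.
  rewrite (evarE ww mg) gE (Ex_dotG M_gt0 hV) expr0n subr0.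
  have := fisher_dot_ge hV u0; rewrite u1 expr1n mulr1; move=> h; apply: le_trans h _.
  rewrite (dot_fisher M_gt0 hV); apply: eq_ler; congr Ex; apply/funext => x.
have := vC g lg; rewrite variance_evar//.
have e0 : (0 <= 'E_(gibbs V)[fun x => (enorm (gradient g x) ^+ 2)%R])%E.
  by rewrite expectation.unlock; apply: integral_ge0 => x _; rewrite lee_fin sqr_ge0.
have e1 := gradient_mean (moderate_cst _ M) gh; rewrite Ex_cst in e1.
have ef : ('E_(gibbs V)[fun x => (enorm (gradient g x) ^+ 2)%R] \is a fin_num)%E.
  by rewrite ge0_fin_numE//; exact: le_lt_trans e1 (ltry _).
rewrite -(fineK ef) -EFinM lee_fin => h.
rewrite -(fineK ef) lee_fin in e1; rewrite -(fineK ef) lee_fin in e0.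
rewrite ler_pdivrMr ?exprn_gt0//.
have mh := le_trans mE h.
have C0 : 0 <= C by rewrite leNgt; apply/negP => C0; move: mh m_gt0 e0; nra.
by apply: le_trans mh _; exact: ler_wpM2l.
Qed.

(** The infimum is itself a valid constant: for given [g] and [h], each valid [C] is at least the
    ratio of variance to energy, hence so is the infimum; the case of zero energy is settled by any
    single valid constant. *)
Lemma poincare_fin : (poincare V < +oo)%E ->
  [/\ poincare V = (fine (poincare V))%:E, m / M ^+ 2 <= fine (poincare V) &
      poincare_bound (fine (poincare V))].
Proof.
move=> foo.
have lb : ((m / M ^+ 2)%:E <= poincare V)%E.
  by apply: le_ereal_inf_tmp => _ [C vC <-]; rewrite lee_fin; exact: valid_ge.
have fP : poincare V \is a fin_num.
  by rewrite fin_numE; apply/andP; split; [rewrite gt_eqF// (lt_le_trans _ lb)// ltNyr|rewrite lt_eqF].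
have c0 : 0 <= m / M ^+ 2 by rewrite divr_ge0 ?sqr_ge0// ltW.
split; [by rewrite fineK|by rewrite -lee_fin fineK|].
move=> g h lg mg mh gh; set e := Ex P _.
have e0 : 0 <= e by apply: Ex_ge0 => x; exact: sqr_ge0.
have vb C : valid C -> evar P g <= C * e.
  by move=> vC; apply: valid_bound => //; exact: le_trans c0 (valid_ge vC).
have [C vC] : exists C, valid C.
  apply/not_existsP => nv; move: foo; rewrite /poincare (_ : [set _ | _ in _] = set0) ?ereal_inf0 ?ltxx//.
  by apply/seteqP; split=> // y [C vC _]; exact: (nv C).
have [e00|en] := eqVneq e 0; first by have := vb C vC; rewrite e00 !mulr0.
have ep : 0 < e by rewrite lt_def en e0.
rewrite -ler_pdivrMr// -lee_fin fineK//.
by apply: le_ereal_inf_tmp => _ [D vD <-]; rewrite lee_fin ler_pdivrMr//; exact: vb.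
Qed.
End poincare.

(** * Variance of the Newton functional without its linear part *)

Section newton_variance.
Context {R : realType} {d : nat}.
Variables (V : potential R d) (M L m : R).
Hypotheses (M_gt0 : 0 < M) (L_gt0 : 0 < L) (m_gt0 : 0 < m).
Hypothesis hV : assumption1 M L m V.
Variable rho : R.
Hypotheses (rho_gt0 : 0 < rho) (rho_le1 : rho <= 1).
Local Notation P := (gibbs V : probability 'rV[R]_d R).
Local Notation w := (gibbs_weight V).
Local Notation it := (newton_iter V).
Local Notation Z := (deviation V).
Let ww := weight_gibbs M_gt0 hV.
Variable n : nat.
Hypothesis n_gt0 : (0 < n)%N.
Local Notation Q := (iid P n).
Local Notation mo := (moderate (wtuple w (n:=n))).
Let wn := weight_iid ww n.
Let n0 : (0 : R) < n%:R. Proof. by rewrite ltr0n. Qed.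

Lemma moderate_newton_iter i l : mo (fun y => it (tnth y) i ord0 l).
Proof.
apply: (moderate_le (g := fun y => newton_bound M m i * Z (tnth y))).
- exact (measurable_row_comp l (measurable_newton_iter hV i)).
- move=> y; apply: le_trans (coord_le_enorm _ _) _.
  rewrite ger0_norm ?mulr_ge0 ?deviation_ge0 ?(newton_bound_ge0 M_gt0 m_gt0)//.
  exact: (newton_iter_le_deviation M_gt0 m_gt0 hV n_gt0).
- by apply: moderateZ; exact (moderate_deviation M_gt0 L_gt0 hV n_gt0).
Qed.

Variables (g : 'rV[R]_d -> R) (N : R) (theta : 'rV[R]_d) (i : nat).
Hypothesis hg : smooth rho 1 N g.

(* Removing the linear part leaves a functional whose gradient in a single
   observation is not merely [O(1 / n)] but [O(Delta^rho / n)] in mean square. *)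
Definition linearized_newton (x : 'I_n -> 'rV[R]_d) : R :=
  g (theta + it x i.+1) - dot (gradient g theta) (it x 1).
Local Notation F := linearized_newton.

Lemma moderate_linearized_newton : mo (fun y => F (tnth y)).
Proof.
apply: (moderateB wn).
  exact (moderate_shift rho_gt0 (wtuple w (n:=n)) (measurable_newton_iter hV i.+1) theta hg).
by apply: (moderate_sum wn) => l; apply: moderateZ; exact: moderate_newton_iter.
Qed.

Definition increment_const : R :=
  jacobian_bound M m i.+1 * newton_bound M m i.+1 `^ rho + jacobian_gap M L m i.

Lemma increment_const_ge0 : 0 <= increment_const.
Proof.
have jb := jacobian_bound_ge0 M_gt0 m_gt0 i.+1; have jg := jacobian_gap_ge0 M_gt0 L_gt0 m_gt0 i.
apply: addr_ge0 jg; apply: mulr_ge0 jb _; exact: powR_ge0.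
Qed.

(** A quantitative chain rule: expansions of order [1 + rho] of the inner maps [a], [a1] and of [g]
    compose to one for [F1], and [holder_differentiable] applies. *)
Lemma linearized_newton_derive (F1 : 'rV[R]_d -> R) z h h1 (a a1 : 'rV[R]_d -> 'rV[R]_d) (J1 J2 : 'M[R]_d) (e r1 r2 : R) :
  0 <= e -> 0 <= r1 -> 0 <= r2 ->
  (forall u, F1 (z + u) - F1 z = g (theta + a u) - g (theta + h) - dot (gradient g theta) (a1 u - h1)) ->
  (forall u, enorm (a u - h - u *m J2) <= r2 * (enorm u * enorm u `^ rho)) ->
  (forall u, enorm (a1 u - h1 - u *m J1) <= r1 * (enorm u * enorm u `^ rho)) ->
  (forall u, enorm (a u - h) <= e * enorm u) ->
  differentiable F1 z /\ forall u, 'D_u F1 z = 'D_(u *m J2) g (theta + h) - 'D_(u *m J1) g theta.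
Proof.
move=> e0 r10 r20 FE t2 t1 l2; have N0 := smooth_ge0 hg.
have dg y : differentiable g y := smooth_differentiable y hg.
pose p := gradient g (theta + h) *m J2^T - gradient g theta *m J1^T.
have pE u : dot p u = 'D_(u *m J2) g (theta + h) - 'D_(u *m J1) g theta.
  by rewrite !derive_gradient// /p dotBl !dot_mulmx !trmxK.
have [] := @holder_differentiable _ _ F1 z p (N * (e * e `^ rho + r2 + r1)) rho rho_gt0.
- by rewrite mulr_ge0// !addr_ge0 ?mulr_ge0 ?powR_ge0.
- move=> u; have u0 := enorm_ge0 u; have {}t1 := t1 u; have {}t2 := t2 u; have {}l2 := l2 u.
  rewrite FE pE; move: (a u) (a1 u) t1 t2 l2 => {a a1 FE}a a1 t1 t2 l2.
  have -> : g (theta + a) - g (theta + h) - dot (gradient g theta) (a1 - h1)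
      - ('D_(u *m J2) g (theta + h) - 'D_(u *m J1) g theta) =
    (g (theta + h + (a - h)) - g (theta + h) - 'D_(a - h) g (theta + h))
    + 'D_(a - h - u *m J2) g (theta + h) - 'D_(a1 - h1 - u *m J1) g theta.
    have -> : theta + h + (a - h) = theta + a by rewrite -addrA [h + _]addrC subrK.
    rewrite !derive_gradient// !dotBr; ring.
  set E := enorm u * _ in t1 t2 *.
  have E0 : 0 <= E by rewrite mulr_ge0 ?powR_ge0.
  rewrite -mulrA !mulrDl !mulrDr.
  apply: le_trans (ler_normB _ _) _; apply: lerD; last first.
    by apply: le_trans (smooth_bound theta (smooth_derive _ hg)) _; rewrite ler_wpM2l.
  apply: le_trans (ler_normD _ _) _; apply: lerD; last first.
    by apply: le_trans (smooth_bound _ (smooth_derive _ hg)) _; rewrite ler_wpM2l.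
  apply: le_trans (smooth_taylor rho_gt0 _ _ hg) _; rewrite ler_wpM2l// /E mulrACA.
  apply: ler_pM; rewrite ?enorm_ge0 ?powR_ge0//.
  rewrite -powRM// ge0_ler_powR ?nnegrE ?enorm_ge0 ?mulr_ge0//; exact: ltW.
by move=> dF DF; split=> // u; rewrite DF pE.
Qed.

Section increment.
Variables (x : 'I_n -> 'rV[R]_d) (j : 'I_n) (F1 : 'rV[R]_d -> R) (z : 'rV[R]_d).
Variable xz : 'rV[R]_d -> 'I_n -> 'rV[R]_d.
Hypothesis xzE : forall z k, xz z k = if k == j then z else x k.
Hypothesis F1E : forall z, F1 z = F (xz z).

Let xzD u : xz (z + u) j = xz z j + u.
Proof. by rewrite !xzE eqxx. Qed.

Let xzk u k : k != j -> xz (z + u) k = xz z k.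
Proof. by rewrite !xzE => /negPf ->. Qed.

Let increment_eq z0 u : F1 (z0 + u) - F1 z0 = g (theta + it (xz (z0 + u)) i.+1) - g (theta + it (xz z0) i.+1)
  - dot (gradient g theta) (it (xz (z0 + u)) 1 - it (xz z0) 1).
Proof. have S (p q r s : R) : p - q - (r - s) = p - r - (q - s) by ring.
by rewrite !F1E dotBr; exact (S _ _ _ _). Qed.

Let N0 := smooth_ge0 hg.
Let dg y : differentiable g y := smooth_differentiable y hg.

Lemma linearized_newton_lipschitz u :
  `|F1 (z + u) - F1 z| <= N * (newton_lip M m i.+1 + newton_lip M m 1) * enorm u.
Proof.
have l1 := newton_iter_lipschitz M_gt0 m_gt0 hV n_gt0 (xzD u) (xzk u) 1.
have l2 := newton_iter_lipschitz M_gt0 m_gt0 hV n_gt0 (xzD u) (xzk u) i.+1.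
rewrite increment_eq; move: l1 l2; move: (it (xz (z + u)) i.+1) (it (xz (z + u)) 1) => a a1.
move: (it (xz z) i.+1) (it (xz z) 1) => b b1 l1 l2.
rewrite -derive_gradient// (_ : theta + a = theta + b + (a - b)); last by rewrite -addrA [b + _]addrC subrK.
apply: le_trans (ler_normB _ _) _; rewrite mulrDr mulrDl -!mulrA; apply: lerD.
  by apply: le_trans (smooth_lipschitz _ _ hg) _; rewrite ler_wpM2l.
by apply: le_trans (smooth_bound theta (smooth_derive _ hg)) _; rewrite ler_wpM2l.
Qed.

(** Two sources of smallness: the derivative of [g] moves by [Z^rho] between [theta] and the
    iterate, while the Jacobian is of order [1 / n]; and the two Jacobians differ by [Z / n]. *)
Lemma linearized_newton_gradient :
  enorm (gradient F1 z) <= N * increment_const / n%:R * (Z (xz z) `^ rho + Z (xz z)).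
Proof.
have t1 u := newton_iter_expansion M_gt0 L_gt0 m_gt0 hV rho_gt0 rho_le1 n_gt0 (xzD u) (xzk u) 1.
have t2 u := newton_iter_expansion M_gt0 L_gt0 m_gt0 hV rho_gt0 rho_le1 n_gt0 (xzD u) (xzk u) i.+1.
have l2 u := newton_iter_lipschitz M_gt0 m_gt0 hV n_gt0 (xzD u) (xzk u) i.+1.
have hZ := newton_iter_le_deviation M_gt0 m_gt0 hV n_gt0 (xz z) i.+1.
have b2 := newton_jacobian_le M_gt0 L_gt0 m_gt0 hV n_gt0 (xz z) j i.+1.
have gap := newton_jacobian_gap M_gt0 L_gt0 m_gt0 hV n_gt0 (xz z) j i.
have Z0 := deviation_ge0 V (xz z).
have [dF DF] := linearized_newton_derive (newton_lip_ge0 M_gt0 m_gt0 i.+1)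
  (jacobian_remainder_ge0 M_gt0 L_gt0 m_gt0 1) (jacobian_remainder_ge0 M_gt0 L_gt0 m_gt0 i.+1)
  (increment_eq z) t2 t1 l2.
move: dF DF hZ b2 gap Z0.
move: (newton_iter V (xz z) i.+1) (newton_jacobian V (xz z) j i.+1) (newton_jacobian V (xz z) j 1).
move: (deviation V (xz z)) => Zy h J2 J1 dF DF hZ b2 gap Z0 {t1 t2 l2}.
apply: enorm_dual_le => [|u].
  by rewrite !mulr_ge0 ?increment_const_ge0 ?invr_ge0 ?addr_ge0 ?powR_ge0// ltW.
rewrite -derive_gradient// DF.
have {}b2 := b2 u; have {}gap := gap u.
have nb := newton_bound_ge0 M_gt0 m_gt0 i.+1; have jb := jacobian_bound_ge0 M_gt0 m_gt0 i.+1.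
have jg := jacobian_gap_ge0 M_gt0 L_gt0 m_gt0 i.
rewrite /increment_const; set cb := jacobian_bound _ _ _ in b2 jb *; set cn := newton_bound _ _ _ in hZ nb *.
set cg := jacobian_gap _ _ _ _ in gap jg *.
have -> : 'D_(u *m J2) g (theta + h) - 'D_(u *m J1) g theta =
  ('D_(u *m J2) g (theta + h) - 'D_(u *m J2) g theta) + 'D_(u *m J2 - u *m J1) g theta.
  by rewrite deriveBdir// addrA subrK.
have n1 : 0 <= n%:R^-1 :> R by rewrite invr_ge0 ltW.
have s1 : 'D_(u *m J2) g (theta + h) - 'D_(u *m J2) g theta <= N * (cb / n%:R * enorm u) * (cn `^ rho * Zy `^ rho).
  apply: le_trans (ler_norm _) _; have [_ k] := smooth_derive (u *m J2) hg.
  apply: le_trans (k _ _) _; apply: ler_pM; rewrite ?mulr_ge0 ?enorm_ge0 ?powR_ge0//.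
    by rewrite ler_wpM2l.
  rewrite addrAC subrr add0r -powRM// ge0_ler_powR ?nnegrE ?enorm_ge0 ?mulr_ge0//; exact: ltW.
have s2 : 'D_(u *m J2 - u *m J1) g theta <= N * (cg / n%:R * (Zy * enorm u)).
  apply: le_trans (ler_norm _) _; apply: le_trans (smooth_bound theta (smooth_derive _ hg)) _.
  by rewrite ler_wpM2l.
apply: le_trans (lerD s1 s2) _.
have q0 := powR_ge0 (Zy) rho; have cp := powR_ge0 cn rho.
move: (cn `^ rho) (Zy `^ rho) cp q0 => cr zr cr0 zr0.
have k0 : 0 <= N * n%:R^-1 * enorm u by rewrite !mulr_ge0 ?enorm_ge0.
have : 0 <= N * n%:R^-1 * enorm u * (cb * cr * Zy + cg * zr).
  apply: mulr_ge0 => //; apply: addr_ge0; last exact: mulr_ge0.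
  by rewrite mulr_ge0// mulr_ge0.
have -> : N * (cb * cr + cg) / n%:R * (zr + Zy) * enorm u =
  N * (cb / n%:R * enorm u) * (cr * zr) + N * (cg / n%:R * (Zy * enorm u)) +
  N * n%:R^-1 * enorm u * (cb * cr * Zy + cg * zr) by ring.
by rewrite lerDl.
Qed.

End increment.

Lemma linearized_newton_variance (c : R) : poincare_bound V c -> 0 <= c ->
  evar Q (fun y => F (tnth y)) <=
  c / n%:R * (N * increment_const) ^+ 2 * Ex Q (fun y => (Z (tnth y) `^ rho + Z (tnth y)) ^+ 2).
Proof.
move=> pc c0; have N0 := smooth_ge0 hg; have K0 := increment_const_ge0.
have mZ := moderate_deviation M_gt0 L_gt0 hV n_gt0.
have mZ2 : mo (fun y => Z (tnth y) `^ rho + Z (tnth y)).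
  apply: (moderateD wn) => //; apply: (moderate_powR wn) => //; last by move=> y; exact: deviation_ge0.
  by rewrite rho_le1 ltW.
set b := N * increment_const; pose h (y : n.-tuple 'rV[R]_d) := b / n%:R * (Z (tnth y) `^ rho + Z (tnth y)).
have mh : mo h by exact: moderateZ.
have ES : evar Q (fun y => F (tnth y)) <= \sum_(j < n) Ex Q (fun y => c * h y ^+ 2).
  apply: (efron_stein ww moderate_linearized_newton) => [j|j y].
    exact/moderateZ/moderateX.
  have mF1 := moderate_upd ww y j moderate_linearized_newton.
  have mh1 := moderate_upd ww y j mh.
  rewrite (ExZ ww _ (moderateX 2 mh1)); apply: pc => //.
    apply: (@lipschitz_locally _ _ _ (N * (newton_lip M m i.+1 + newton_lip M m 1))) => x x'.
    have e1 : x' + (x - x') = x by rewrite addrC subrK.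
    have := @linearized_newton_lipschitz (tnth y) j (fun z => F (tnth (upd y j z))) x' (fun z => tnth (upd y j z)).
    move=> /(_ _ _ (x - x')); rewrite e1; apply=> // z k.
    by rewrite tnth_upd.
  move=> z; apply: (@linearized_newton_gradient (tnth y) j (fun z => F (tnth (upd y j z))) z (fun z =>
      tnth (upd y j z))) => // z' k.
  by rewrite tnth_upd.
apply: le_trans ES _; rewrite sumr_const card_ord (ExZ wn _ (moderateX 2 mh)).
have -> : (fun y => h y ^+ 2) = fun y => (b / n%:R) ^+ 2 * (Z (tnth y) `^ rho + Z (tnth y)) ^+ 2.
  by apply/funext => y; rewrite exprMn.
rewrite (ExZ wn _ (moderateX 2 mZ2)); set e := Ex _ _; rewrite -mulr_natl.
by apply: eq_ler; field; rewrite gt_eqF.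
Qed.

End newton_variance.

(** * Error of the bias-reduced estimator *)

Section root_mean_square.
Context {R : realType} dT {T : measurableType dT} (Q : probability T R) (w : T -> R).
Hypothesis ww : weight Q w.
Implicit Types F G : T -> R.
Local Notation mo := (moderate w).

Definition rms F : R := Num.sqrt (Ex Q (fun t => F t ^+ 2)).

Lemma rms_ge0 F : 0 <= rms F. Proof. exact: sqrtr_ge0. Qed.

Lemma sqr_rms F : rms F ^+ 2 = Ex Q (fun t => F t ^+ 2).
Proof. by rewrite sqr_sqrtr// Ex_ge0// => t; exact: sqr_ge0. Qed.

Lemma rms_le F (a : R) : 0 <= a -> Ex Q (fun t => F t ^+ 2) <= a ^+ 2 -> rms F <= a.
Proof. by move=> a0 h; rewrite -[a]ger0_norm// -sqrtr_sqr ler_sqrt// sqr_ge0. Qed.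

Lemma rmsN F : rms (fun t => - F t) = rms F.
Proof. by congr Num.sqrt; congr Ex; apply/funext => t; rewrite sqrrN. Qed.

Lemma rms_cst (a : R) : rms (fun=> a) = `|a|.
Proof. by rewrite /rms Ex_cst sqrtr_sqr. Qed.

Lemma rmsD F G : mo F -> mo G -> rms (fun t => F t + G t) <= rms F + rms G.
Proof.
move=> mF mG; have a0 := rms_ge0 F; have b0 := rms_ge0 G.
apply/ler_addgt0Pr => e e0.
have e2 : 0 < e / 2 by rewrite divr_gt0.
(* The summand [e / 2] makes [a] and [b] positive, so that their quotients make sense when a norm
   vanishes. *)
pose a := rms F + e / 2; pose b := rms G + e / 2.
have ap : 0 < a by rewrite ltr_wpDl.
have bp : 0 < b by rewrite ltr_wpDl.
have -> : rms F + rms G + e = a + b by rewrite /a /b; field.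
apply: rms_le; first by rewrite addr_ge0// ltW.
have r0 : 0 < b / a by rewrite divr_gt0.
have r0' : 0 < a / b by rewrite divr_gt0.
have m1 := moderateZ (1 + b / a) (moderateX 2 mF).
have m2 := moderateZ (1 + a / b) (moderateX 2 mG).
apply: (@le_trans _ _ (Ex Q (fun t => (1 + b / a) * F t ^+ 2 + (1 + a / b) * G t ^+ 2))).
  apply: (Ex_le ww) => [||t].
  - by apply: moderateX; exact: (moderateD ww).
  - exact: (moderateD ww).
  (* AM-GM: [2 F G <= (b / a) F^2 + (a / b) G^2] *)
  - have -> : (1 + b / a) * F t ^+ 2 + (1 + a / b) * G t ^+ 2 =
      (F t + G t) ^+ 2 + (b * F t - a * G t) ^+ 2 / (a * b).
      by field; rewrite !gt_eqF.
    by rewrite lerDl divr_ge0 ?sqr_ge0 ?mulr_ge0// ltW.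
rewrite (ExD ww m1 m2) (ExZ ww _ (moderateX 2 mF)) (ExZ ww _ (moderateX 2 mG)) -!sqr_rms.
have -> : (a + b) ^+ 2 = (1 + b / a) * a ^+ 2 + (1 + a / b) * b ^+ 2 by field; rewrite !gt_eqF.
apply: lerD; apply: ler_wpM2l; rewrite ?addr_ge0 ?(ltW r0) ?(ltW r0')//.
  by rewrite lerXn2r ?nnegrE ?(ltW ap)// lerDl ltW.
by rewrite lerXn2r ?nnegrE ?(ltW bp)// lerDl ltW.
Qed.

Lemma rms_dist F G : mo F -> mo G -> `|rms F - rms G| <= rms (fun t => F t - G t).
Proof.
move=> mF mG; have mD := moderateB ww mF mG.
have h1 : rms F <= rms (fun t => F t - G t) + rms G.
  have := rmsD mD mG; congr (rms _ <= _); apply/funext => t; exact: subrK.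
have h2 : rms G <= rms (fun t => F t - G t) + rms F.
  rewrite -[X in _ <= X + _]rmsN; have := rmsD (moderateN mD) mF; congr (rms _ <= _).
  by apply/funext => t; rewrite opprB subrK.
by rewrite ler_norml; apply/andP; split; lra.
Qed.

Lemma rms_center F : rms (fun t => F t - Ex Q F) = Num.sqrt (evar Q F).
Proof. by []. Qed.

Lemma Ex_le_rms F : mo F -> `|Ex Q F| <= rms F.
Proof.
move=> mF; rewrite -sqrtr_sqr ler_sqrt ?(sqr_Ex_le ww)//.
by apply: Ex_ge0 => t; exact: sqr_ge0.
Qed.

End root_mean_square.

(** * Mean square error on a centred sample *)

Section estimator_error.
Context {R : realType} {d : nat}.
Variables (V : potential R d) (M L m : R).
Hypotheses (M_gt0 : 0 < M) (L_gt0 : 0 < L) (m_gt0 : 0 < m).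
Hypothesis hV : assumption1 M L m V.
Variable rho : R.
Hypotheses (rho_gt0 : 0 < rho) (rho_le1 : rho <= 1).
Local Notation P := (gibbs V : probability 'rV[R]_d R).
Local Notation w := (gibbs_weight V).
Local Notation it := (newton_iter V).
Local Notation A := (invmx (fisher V)).
Let ww := weight_gibbs M_gt0 hV.
Variable n : nat.
Hypotheses (n_gt0 : (0 < n)%N) (d_gt0 : (0 < d)%N) (d_le : d%:R <= n%:R :> R).
Local Notation Q := (iid P n).
Local Notation mo := (moderate (wtuple w (n:=n))).
Let wn := weight_iid ww n.
Let n0 : (0 : R) < n%:R. Proof. by rewrite ltr0n. Qed.
Let d0 : (0 : R) < d%:R. Proof. by rewrite ltr0n. Qed.
Let Z (y : n.-tuple 'rV[R]_d) := deviation V (tnth y).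
Let tau (y : n.-tuple 'rV[R]_d) := mle V (tnth y).
Let w1 (y : n.-tuple 'rV[R]_d) := it (tnth y) 1.
Implicit Types u : 'rV[R]_d.

Local Notation Delta := (Num.sqrt (d%:R / n%:R) : R).
Let dn0 : 0 < d%:R / n%:R :> R. Proof. by rewrite divr_gt0. Qed.
Let Delta_gt0 : 0 < Delta. Proof. by rewrite sqrtr_gt0. Qed.
Let Delta_le1 : Delta <= 1.
Proof. by rewrite -[leRHS]sqrtr1 ler_sqrt// ler_pdivrMr// mul1r. Qed.
Let Delta_powR : Delta <= Delta `^ rho.
Proof. by rewrite -[leLHS](powRr1 (ltW Delta_gt0)) ger_powR// Delta_gt0 Delta_le1. Qed.
Let sqr_Delta : Delta ^+ 2 = d%:R / n%:R. Proof. by rewrite sqr_sqrtr// ltW. Qed.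

Lemma newton_iter1_dot u y : dot (w1 y) u = n%:R^-1 * \sum_j dot (gradient V (tnth y j)) (u *m A^T).
Proof. by rewrite /w1 /= add0r empirical_gradient0E dot_mulmx dotZl dot_suml. Qed.

Lemma moderate_w1_dot u : mo (fun y => dot (w1 y) u).
Proof.
under eq_fun do rewrite newton_iter1_dot.
by apply: moderateZ; exact (moderate_iid_sum ww n (moderate_dotG M_gt0 hV (u *m A^T))).
Qed.

Lemma Ex_w1_dot u : Ex Q (fun y => dot (w1 y) u) = 0.
Proof.
under eq_fun do rewrite newton_iter1_dot.
rewrite (ExZ wn _ (moderate_iid_sum ww n (moderate_dotG M_gt0 hV (u *m A^T)))).
by rewrite (Ex_iid_sum ww n (moderate_dotG M_gt0 hV (u *m A^T))) (Ex_dotG M_gt0 hV) !mulr0.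
Qed.

(** The origin of the main term: the scores have covariance [I], so their average multiplied by
    [I^-1] has covariance [I^-1 / n]. *)
Lemma rms_w1_dot u : rms Q (fun y => dot (w1 y) u) = Num.sqrt (dot (u *m A) u) / Num.sqrt n%:R.
Proof.
set v := u *m A^T; have mv := moderate_dotG M_gt0 hV v.
rewrite -sqrtrV ?ler0n// -sqrtrM; last exact: (dot_invmx_ge0 m_gt0 (a1_fisher hV)).
congr Num.sqrt.
have -> : (fun y => dot (w1 y) u ^+ 2) =
    fun y => n%:R^-1 ^+ 2 * (\sum_j dot (gradient V (tnth y j)) v) ^+ 2.
  by apply/funext => y; rewrite newton_iter1_dot exprMn.
rewrite (ExZ wn _ (moderateX 2 (moderate_iid_sum ww n mv))).
rewrite (Ex_iid_sqr_sum ww n mv (Ex_dotG M_gt0 hV v)).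
have -> : Ex P (fun z => dot (gradient V z) v ^+ 2) = dot (v *m fisher V) v.
  by rewrite (dot_fisher M_gt0 hV); congr Ex; apply/funext => z; rewrite expr2.
have -> : dot (v *m fisher V) v = dot (u *m A) u.
  have -> : dot (v *m fisher V) v = dot (v *m fisher V *m A) u.
    by rewrite [RHS]dot_mulmx.
  by rewrite mulmxK ?(fisher_unit m_gt0 hV)// /v dot_mulmx trmxK dotC.
by field; rewrite gt_eqF.
Qed.

Let a : R := 2 / m.
Let b : R := newton_error M L m 1.
Let kappa : R := small_deviation L m.
Let c0 : R := deviation_const M 0.
Let K : R := 1 + c0.

Let Z_ge0 y : 0 <= Z y. Proof. exact: deviation_ge0. Qed.
Let mZ : mo Z. Proof. exact (moderate_deviation M_gt0 L_gt0 hV n_gt0). Qed.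
Let a_ge0 : 0 <= a. Proof. by rewrite divr_ge0// ltW. Qed.
Let b_ge0 : 0 <= b. Proof. exact: newton_error_ge0. Qed.
Let kappa_gt0 : 0 < kappa. Proof. exact: small_deviation_gt0. Qed.
Let c0_ge0 : 0 <= c0. Proof. exact: deviation_const_ge0. Qed.
Let K_ge0 : 0 <= K. Proof. exact: addr_ge0. Qed.
Let mtau : measurable_fun setT tau. Proof. exact: (measurable_mle M_gt0 m_gt0 hV n_gt0). Qed.

Let tau_le y : Z y <= kappa -> enorm (tau y) <= a * Z y.
Proof.
move=> Zk; apply: le_trans (risk_minimizer_le M_gt0 L_gt0 m_gt0 hV n_gt0 _ Zk) _.
  exact: (mleP M_gt0 m_gt0 hV n_gt0).
by rewrite ler_wpM2l// lerDr fnorm_ge0.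
Qed.

Let tau_newton y i : Z y <= kappa -> enorm (tau y - it (tnth y) i) <= newton_error M L m i * Z y ^+ i.+1.
Proof.
by apply: (risk_minimizer_iter M_gt0 L_gt0 m_gt0 hV n_gt0); exact: (mleP M_gt0 m_gt0 hV n_gt0).
Qed.

Let w1_le y : enorm (w1 y) <= a * Z y.
Proof.
apply: le_trans (newton_iter_le_deviation M_gt0 m_gt0 hV n_gt0 _ 1) _.
have -> : newton_bound M m 1 = m^-1 by rewrite /= mul0r add0r.
apply: ler_wpM2r; first exact: Z_ge0.
by rewrite /a ler_peMl ?invr_ge0 ?ler1n// ltW.
Qed.

Let mw1 i : mo (fun y => w1 y ord0 i).
Proof. exact (moderate_newton_iter M_gt0 L_gt0 m_gt0 hV n_gt0 1 i). Qed.

Let Ex_w1 i : Ex Q (fun y => w1 y ord0 i) = 0.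
Proof. by rewrite -(Ex_w1_dot (delta_mx ord0 i)); congr Ex; apply/funext => y; rewrite dotC dot_delta. Qed.

Let Z2 : Ex Q (fun y => Z y ^+ 2) <= c0 * Delta ^+ 2.
Proof. by have := deviation_moment M_gt0 L_gt0 hV n_gt0 0; rewrite sqr_Delta expr1. Qed.

Let Z_power (r : R) : 0 <= r <= 2 -> mo (fun y => Z y `^ r) /\ Ex Q (fun y => Z y `^ r) <= K * Delta `^ r.
Proof. by move=> r02; exact (fractional_moment wn mZ Z_ge0 Delta_gt0 r02 Z2). Qed.

Let powR1D (t : R) : 0 <= t -> t * t `^ rho = t `^ (1 + rho).
Proof. by move=> t0; rewrite powRD ?powRr1//; apply/implyP; rewrite gt_eqF// addr_gt0. Qed.

Let Z_mean : Ex Q Z <= K * Delta.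
Proof.
have [|_] := Z_power (r := 1); first by rewrite ler01 ler1n.
rewrite powRr1; last exact: ltW.
by congr (Ex _ _ <= _); apply/funext => y; rewrite powRr1.
Qed.

Let Z_moment : Ex Q (fun y => Z y * Z y `^ rho) <= K * (Delta * Delta `^ rho).
Proof.
have [|_] := Z_power (r := 1 + rho); first by rewrite addr_ge0 ?(ltW rho_gt0)//= lerD.
rewrite powR1D; last exact: ltW.
by congr (Ex _ _ <= _); apply/funext => y; rewrite powR1D.
Qed.

Let Z_variance : mo (fun y => (Z y `^ rho + Z y) ^+ 2) /\
  Ex Q (fun y => (Z y `^ rho + Z y) ^+ 2) <= 4 * K * (Delta `^ rho) ^+ 2.
Proof.
have [|mr _] := Z_power (r := rho); first by rewrite ltW//= (le_trans rho_le1)// ler1n.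
have mD := moderateD wn mr mZ; split; first exact: moderateX.
apply: le_trans (Ex_sqrD_le wn mr mZ) _.
have r0 : 0 <= rho * 2 <= 2.
  by rewrite mulr_ge0 ?(ltW rho_gt0)//= -[leRHS]mul1r ler_wpM2r.
have [_ h] := Z_power r0; rewrite powRrM -powR_mulrn ?powR_ge0// in h *.
have E1 : (fun y => (Z y `^ rho) ^+ 2) = fun y => Z y `^ (rho * 2).
  by apply/funext => y; rewrite powRrM powR_mulrn ?powR_ge0.
rewrite powR_mulrn ?powR_ge0// in h *; rewrite E1.
have D0 : Delta ^+ 2 <= (Delta `^ rho) ^+ 2.
  by rewrite lerXn2r ?nnegrE ?powR_ge0 ?(ltW Delta_gt0).
have s0 : 0 <= (Delta `^ rho) ^+ 2 := sqr_ge0 _.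
have h2 : Ex Q (fun y => Z y ^+ 2) <= K * (Delta `^ rho) ^+ 2.
  apply: le_trans Z2 _; apply: ler_pM (sqr_ge0 _) _ D0 => //.
  by rewrite lerDr.
by move: h h2; lra.
Qed.

Variables (k : nat) (N : R) (f : 'rV[R]_d -> R) (theta : 'rV[R]_d).
Hypothesis hf : smooth rho k.+1 N f.
Local Notation fk := (neumann Q tau k f).

Let c1 : R := shift_const a kappa * K.
Let c1_ge0 : 0 <= c1. Proof. by rewrite mulr_ge0// shift_const_ge0. Qed.

Definition neumann_const : R := \sum_(j < k.+1) 2 ^+ (k - j) * c1 ^+ j.
Definition neumann_derive_const : R := \sum_(j < k) c1 ^+ j.+1.
Definition neumann_mean_const : R := c1 ^+ k * (shift_const2 rho a b kappa * K).
Definition newton_gap_const : R :=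
  (newton_error M L m k.+1 + 2 / kappa ^+ k.+2) * Num.sqrt (deviation_const M k.+1).
(** The Newton gap counts twice: in mean square when the estimator is replaced by the iterate, and
    again in the bias of that replacement. *)
Definition error_const : R :=
  neumann_mean_const + 2 * (neumann_const * newton_gap_const)
  + 2 * Num.sqrt K * (neumann_const * increment_const M L m rho k)
  + neumann_derive_const * (M / m).

Lemma smooth_neumann_mle : smooth rho 1 (N * neumann_const) fk.
Proof.
exact (smooth_neumann rho_gt0 rho_le1 wn mtau Z_ge0 mZ a_ge0 kappa_gt0 tau_le
  (ltW Delta_gt0) Delta_le1 Z_mean c1_ge0 hf).
Qed.

Let hk := smooth_neumann_mle.
Let N_ge0 : 0 <= N := smooth_ge0 hf.

Let CN0 : 0 <= neumann_const.
Proof. by apply: sumr_ge0 => j _; rewrite mulr_ge0 ?exprn_ge0. Qed.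

Let Cd0 : 0 <= neumann_derive_const.
Proof. by apply: sumr_ge0 => j _; rewrite exprn_ge0. Qed.

Let mshift : mo (fun y => fk (theta + tau y)).
Proof. exact (moderate_shift rho_gt0 (wtuple w (n:=n)) mtau theta hk). Qed.

Let mnewton : mo (fun y => fk (theta + it (tnth y) k.+1)).
Proof. exact (moderate_shift rho_gt0 (wtuple w (n:=n)) (measurable_newton_iter hV k.+1) theta hk). Qed.

Let s_le (r : R) : 0 <= r -> r <= Delta ^+ k.+2 -> r <= Delta ^+ k * (Delta * Delta `^ rho).
Proof.
move=> r0 h; apply: le_trans h _; rewrite !exprSr -mulrA ler_wpM2l ?exprn_ge0 ?(ltW Delta_gt0)//.
by rewrite ler_wpM2l ?(ltW Delta_gt0).
Qed.

Let ep : R := Delta ^+ k * (Delta * Delta `^ rho).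
Let ep_ge0 : 0 <= ep.
Proof. by rewrite mulr_ge0 ?exprn_ge0 ?mulr_ge0 ?powR_ge0// ltW. Qed.

(** On the good event the distance is of order [Z^(k+2)], and off it [1 <= (Z / kappa)^(k+2)]; in
    mean square this is [Delta^(k+2)], at most [Delta^s] because [rho <= 1] and [Delta <= 1]. *)
Lemma mle_newton_gap : mo (fun y => fk (theta + tau y) - fk (theta + it (tnth y) k.+1)) /\
  rms Q (fun y => fk (theta + tau y) - fk (theta + it (tnth y) k.+1)) <=
  N * (neumann_const * newton_gap_const) * ep.
Proof.
have mA := moderateB wn mshift mnewton; split=> //.
have N1 : 0 <= N * neumann_const by rewrite mulr_ge0.
have e0 := newton_error_ge0 M_gt0 L_gt0 m_gt0 k.+1.
have k0 : 0 <= 2 / kappa ^+ k.+2 by rewrite divr_ge0// exprn_ge0// ltW.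
set cA := newton_error M L m k.+1 + 2 / kappa ^+ k.+2.
have cA0 : 0 <= cA by exact: addr_ge0.
have pt y : `|fk (theta + tau y) - fk (theta + it (tnth y) k.+1)| <= N * neumann_const * cA * Z y ^+ k.+2.
  have Zp : 0 <= Z y ^+ k.+2 by rewrite exprn_ge0.
  rewrite -mulrA; have [Zk|Zk] := leP (Z y) kappa.
    have -> : theta + tau y = theta + it (tnth y) k.+1 + (tau y - it (tnth y) k.+1).
      by rewrite -addrA [it _ _ + _]addrC subrK.
    apply: le_trans (smooth_lipschitz _ _ hk) _; rewrite ler_wpM2l//.
    by apply: le_trans (tau_newton _ Zk) _; rewrite ler_wpM2r// lerDl.
  apply: le_trans (ler_normB _ _) _.
  apply: (@le_trans _ _ (N * neumann_const * 2)).
    have h1 := smooth_bound (theta + tau y) hk.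
    have h2 := smooth_bound (theta + it (tnth y) k.+1) hk.
    by move: h1 h2; move: (`|_|) (`|_|) => p q h1 h2; lra.
  rewrite ler_wpM2l//; apply: (@le_trans _ _ (2 / kappa ^+ k.+2 * Z y ^+ k.+2)); last first.
    by rewrite ler_wpM2r// lerDr.
  rewrite -[leLHS]mulr1 -!mulrA ler_wpM2l// mulrC ler_pdivlMr ?exprn_gt0// mul1r.
  by rewrite lerXn2r ?nnegrE// ltW.
have kk : (2 * k.+2 = k.+2 * 2)%N by rewrite mulnC.
apply: (@le_trans _ _ (N * neumann_const * cA * (Num.sqrt (deviation_const M k.+1) * Delta ^+ k.+2))).
  apply: rms_le; first by rewrite mulr_ge0 ?(mulr_ge0 N1 cA0)// mulr_ge0 ?sqrtr_ge0// exprn_ge0// sqrtr_ge0.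
  apply: (@le_trans _ _ (Ex Q (fun y => (N * neumann_const * cA) ^+ 2 * Z y ^+ (2 * k.+2)))).
    apply: (Ex_le wn); [exact: moderateX|exact/moderateZ/moderateX|].
    move=> y; rewrite kk exprM -exprMn -[leLHS]real_normK ?num_real// lerXn2r ?nnegrE//.
    by rewrite mulr_ge0 ?(mulr_ge0 N1 cA0)// exprn_ge0.
  rewrite (ExZ wn _ (moderateX _ mZ)) [leRHS]exprMn ler_wpM2l ?sqr_ge0//.
  apply: le_trans (deviation_moment M_gt0 L_gt0 hV n_gt0 k.+1) _.
  rewrite [leRHS]exprMn sqr_sqrtr ?(deviation_const_ge0 M_gt0)// ler_wpM2l ?(deviation_const_ge0 M_gt0)//.
  by rewrite -exprM mulnC exprM sqr_Delta.
rewrite (_ : N * (neumann_const * newton_gap_const) * ep =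
  N * neumann_const * cA * (Num.sqrt (deviation_const M k.+1) * ep)); last first.
  by rewrite /newton_gap_const -/cA !mulrA.
apply: ler_wpM2l; first exact: mulr_ge0 N1 cA0.
apply: ler_wpM2l; first exact: sqrtr_ge0.
by apply: s_le => //; rewrite exprn_ge0// ltW.
Qed.

(** For [N = 0] the right side of the theorem is 0 even if [poincare V] is infinite, because zero
    times infinity is zero; both terms on the left must then vanish exactly. *)
Lemma estimator_rms_error0 : N = 0 ->
  rms Q (fun y => fk (theta + tau y) - f theta) = 0 /\
  dot (gradient f theta *m A) (gradient f theta) = 0.
Proof.
move=> N00; have h1 := hk; have h2 := hf; rewrite N00 in h1 h2.
have fk0 x : fk x = 0.
  by apply/eqP; rewrite -normr_eq0 eq_le normr_ge0 andbT; have := smooth_bound x h1; rewrite mul0r.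
have f0 x : f x = 0.
  by apply/eqP; rewrite -normr_eq0 eq_le normr_ge0 andbT; exact: smooth_bound x h2.
split.
  have -> : (fun y => fk (theta + tau y) - f theta) = fun=> 0.
    by apply/funext => y; rewrite fk0 f0 subr0.
  by rewrite rms_cst normr0.
suff -> : gradient f theta = 0 by rewrite mul0mx dot0l.
apply/eqP; rewrite -enorm_eq0 eq_le enorm_ge0 andbT; apply: enorm_dual_le => // v.
rewrite -derive_gradient; last exact: smooth_differentiable hf.
apply: le_trans (ler_norm _) _; apply: le_trans (smooth_bound theta (smooth_derive v h2)) _.
by rewrite mul0r.
Qed.

Variable c : R.
Hypotheses (pc : poincare_bound V c) (c_ge : m / M ^+ 2 <= c).

Let c_ge0 : 0 <= c.
Proof. by apply: le_trans c_ge; rewrite divr_ge0 ?sqr_ge0// ltW. Qed.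

Local Notation F := (fun y => linearized_newton V fk theta k (tnth y)).

Let mF : mo F.
Proof. exact (moderate_linearized_newton M_gt0 L_gt0 m_gt0 hV rho_gt0 n_gt0 theta k hk). Qed.

Lemma linearized_newton_rms :
  rms Q (fun y => F y - Ex Q F) <=
  N * (2 * Num.sqrt K * (neumann_const * increment_const M L m rho k)) * (Num.sqrt (c / n%:R) * Delta `^ rho).
Proof.
have [_ hZ] := Z_variance.
have cn : 0 <= c / n%:R by rewrite divr_ge0// ltW.
have i0 := increment_const_ge0 M_gt0 L_gt0 m_gt0 rho k.
rewrite rms_center; apply: (@le_trans _ _ (Num.sqrt ((Num.sqrt (c / n%:R) * (N * neumann_const *
    increment_const M L m rho k)
   * (2 * Num.sqrt K * Delta `^ rho)) ^+ 2))).
  rewrite ler_sqrt ?sqr_ge0//.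
  have := linearized_newton_variance M_gt0 L_gt0 m_gt0 hV rho_gt0 rho_le1 n_gt0 theta k hk pc c_ge0.
  move=> h; apply: le_trans h _; rewrite !exprMn !sqr_sqrtr//.
  apply: ler_wpM2l; first by rewrite -!exprMn mulr_ge0// sqr_ge0.
  by apply: le_trans hZ _; rewrite -natrX.
rewrite sqrtr_sqr ger0_norm; last by rewrite !mulr_ge0 ?sqrtr_ge0 ?powR_ge0.
by apply: eq_ler; ring.
Qed.

Lemma linearized_newton_bias :
  `|Ex Q F - f theta| <= N * (neumann_mean_const + neumann_const * newton_gap_const) * ep.
Proof.
have [mA hA] := mle_newton_gap.
have h := neumann_mean_le rho_gt0 rho_le1 wn mtau Z_ge0 mZ a_ge0 b_ge0 kappa_gt0 tau_le
  (fun y => @tau_newton y 1) w1_le mw1 Ex_w1 Z_mean Z_moment theta hf.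
have -> : Ex Q F = shift_mean Q tau fk theta - Ex Q (fun y => fk (theta + tau y) - fk (theta + it (tnth y) k.+1)).
  have mdot : mo (fun y => dot (gradient fk theta) (w1 y)).
    by under eq_fun do rewrite dotC; exact: moderate_w1_dot.
  have E0 : Ex Q (fun y => dot (gradient fk theta) (w1 y)) = 0.
    by under eq_fun do rewrite dotC; exact: Ex_w1_dot.
  have -> : Ex Q F = Ex Q (fun y => fk (theta + it (tnth y) k.+1)).
    by rewrite -[RHS]subr0 -E0 -(ExB wn mnewton mdot).
  by rewrite (ExB wn mshift mnewton) subKr.
rewrite addrAC; apply: le_trans (ler_normB _ _) _; rewrite mulrDr mulrDl; apply: lerD => //.
exact: le_trans (Ex_le_rms wn mA) hA.
Qed.

(** The variance of this linear term carries [m^-1], not [c]. Writing [m^-1 = (M / m)^2 (m / M^2)]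
    and using [m / M^2 <= c] brings it to the required form. *)
Lemma neumann_derive_rms :
  rms Q (fun y => dot (w1 y) (gradient fk theta - gradient f theta)) <=
  N * (neumann_derive_const * (M / m)) * (Num.sqrt (c / n%:R) * Delta `^ rho).
Proof.
set u := _ - _.
have hD v := neumann_derive_le rho_gt0 rho_le1 wn mtau Z_ge0 mZ a_ge0 kappa_gt0 tau_le
  (ltW Delta_gt0) Delta_le1 Z_mean c1_ge0 theta v hf.
have B0 : 0 <= N * neumann_derive_const * Delta by rewrite !mulr_ge0 ?sqrtr_ge0.
have hu : enorm u <= N * neumann_derive_const * Delta.
  apply: enorm_dual_le => // v; apply: le_trans (hD v); apply: le_trans (ler_norm _) _.
  rewrite dotBl !derive_gradient//; [exact: smooth_differentiable hf|exact: smooth_differentiable hk].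
rewrite rms_w1_dot -sqrtrV ?ler0n// -sqrtrM; last exact: (dot_invmx_ge0 m_gt0 (a1_fisher hV)).
have cn : 0 <= c / n%:R by rewrite divr_ge0// ltW.
apply: (@le_trans _ _ (Num.sqrt ((N * neumann_derive_const * Delta * (M / m)) ^+ 2 * (c / n%:R)))).
  rewrite ler_sqrt; last by rewrite mulr_ge0 ?sqr_ge0.
  rewrite mulrA ler_wpM2r ?invr_ge0 ?(ltW n0)//.
  apply: le_trans (dot_invmx_le m_gt0 (a1_fisher hV) u) _.
  rewrite [in leRHS]exprMn -[leRHS]mulrA [leLHS]mulrC; apply: ler_pM; rewrite ?sqr_ge0 ?invr_ge0 ?(ltW m_gt0)//.
    by rewrite lerXn2r ?nnegrE ?enorm_ge0.
  rewrite [leLHS](_ : _ = (M / m) ^+ 2 * (m / M ^+ 2)); last by field; rewrite !gt_eqF.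
  by rewrite ler_wpM2l ?sqr_ge0.
rewrite sqrtrM ?sqr_ge0// sqrtr_sqr ger0_norm; last by rewrite mulr_ge0 ?divr_ge0 ?(ltW M_gt0) ?(ltW m_gt0).
have -> : N * neumann_derive_const * Delta * (M / m) * Num.sqrt (c / n%:R) =
  N * (neumann_derive_const * (M / m)) * (Num.sqrt (c / n%:R) * Delta) by ring.
apply: ler_wpM2l; first by rewrite !mulr_ge0 ?invr_ge0 ?(ltW M_gt0) ?(ltW m_gt0).
by rewrite ler_wpM2l ?sqrtr_ge0.
Qed.

Lemma estimator_rms_error :
  `|rms Q (fun y => fk (theta + tau y) - f theta)
    - Num.sqrt (dot (gradient f theta *m A) (gradient f theta)) / Num.sqrt n%:R| <=
  error_const * N * (Num.sqrt (c / n%:R) * Delta `^ rho + ep).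
Proof.
have mU : mo (fun y => fk (theta + tau y) - f theta).
  by apply: (moderateB wn) => //; exact: moderate_cst.
rewrite -rms_w1_dot; apply: le_trans (rms_dist wn mU (moderate_w1_dot _)) _.
have [mA hA] := mle_newton_gap.
have mB : mo (fun y => F y - Ex Q F) by apply: (moderateB wn) => //; exact: moderate_cst.
have mC : mo (fun=> Ex Q F - f theta) by exact: moderate_cst.
have mE := moderate_w1_dot (gradient fk theta - gradient f theta).
set FA := (fun y => fk (theta + tau y) - fk (theta + it (tnth y) k.+1)) in mA hA.
set FE := (fun y => dot (w1 y) (gradient fk theta - gradient f theta)) in mE.
(* Four errors: replacing the estimator by the iterate, fluctuation of the functional without its
   linear part, bias, and exchanging [f_k'] for [f'] in the linear part. *)
have -> : (fun y => fk (theta + tau y) - f theta - dot (w1 y) (gradient f theta)) =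
   fun y => FA y + ((F y - Ex Q F) + ((Ex Q F - f theta) + FE y)).
  apply/funext => y; rewrite /FA /FE /linearized_newton dotBr [dot (w1 y) (gradient fk theta)]dotC.
  have S (p q r s t v : R) : p - r - v = p - q + (q - s - t + (t - r + (s - v))) by ring.
  exact (S _ _ _ _ _ _).
have mCE := moderateD wn mC mE; have mBCE := moderateD wn mB mCE.
apply: le_trans (rmsD wn mA mBCE) _; apply: le_trans (lerD hA (rmsD wn mB mCE)) _.
apply: le_trans (lerD (lexx _) (lerD linearized_newton_rms (rmsD wn mC mE))) _.
rewrite rms_cst.
apply: le_trans (lerD (lexx _) (lerD (lexx _) (lerD linearized_newton_bias neumann_derive_rms))) _.
have g0 : 0 <= newton_gap_const.
  by rewrite mulr_ge0 ?sqrtr_ge0// addr_ge0 ?newton_error_ge0// divr_ge0// exprn_ge0// ltW.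
have mm0 : 0 <= neumann_mean_const.
  by rewrite mulr_ge0 ?exprn_ge0// mulr_ge0//; exact: shift_const2_ge0.
have i0 := increment_const_ge0 M_gt0 L_gt0 m_gt0 rho k.
have Mm : 0 <= M / m by rewrite divr_ge0// ltW.
have sd0 : 0 <= Num.sqrt (c / n%:R) * Delta `^ rho by rewrite mulr_ge0 ?sqrtr_ge0 ?powR_ge0.
have p1 : 0 <= neumann_const * newton_gap_const by exact: mulr_ge0.
have p2 : 0 <= 2 * Num.sqrt K * (neumann_const * increment_const M L m rho k).
  by rewrite mulr_ge0 ?mulr_ge0 ?sqrtr_ge0.
have p3 : 0 <= neumann_derive_const * (M / m) by exact: mulr_ge0.
rewrite /error_const; move: (Num.sqrt (c / n%:R) * Delta `^ rho) sd0 => sd sd0.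
move: (2 * Num.sqrt K * _) p2 => q2 p2; move: (neumann_derive_const * _) p3 => q3 p3.
move: (neumann_const * _) p1 => q1 p1; move: neumann_mean_const mm0 => q0 p0.
move: ep ep_ge0 => e e0.
have -> : (q0 + 2 * q1 + q2 + q3) * N * (sd + e) =
  N * q1 * e + (N * q2 * sd + (N * (q0 + q1) * e + N * q3 * sd))
  + (N * (q0 + 2 * q1) * sd + N * (q2 + q3) * e) by ring.
by rewrite lerDl addr_ge0// !mulr_ge0 ?addr_ge0 ?mulr_ge0.
Qed.

End estimator_error.

(** * The location model *)

Section holder_class.
Context {R : realType} {d : nat}.
Variable rho : R.
Implicit Types (g : 'rV[R]_d -> R) (s : seq 'rV[R]_d).

(** The Holder norm tests derivatives on unit vectors; homogeneity in the direction extends the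
    bounds to all [u], the zero direction being separate. *)
Lemma smooth_of_forms l (N : R) g : 0 <= N -> times_differentiable l g ->
  (forall s x, (size s <= l)%N -> (forall v, v \in s -> enorm v <= 1) ->
    `|foldr (fun v h => 'D_v h) g s x| <= N) ->
  (forall s x y, size s = l -> (forall v, v \in s -> enorm v <= 1) ->
    `|foldr (fun v h => 'D_v h) g s x - foldr (fun v h => 'D_v h) g s y| <= N * enorm (x - y) `^ rho) ->
  smooth rho l N g.
Proof.
move=> N0; elim: l g => [|l IH] g tg hb hl.
  by split=> [x|x y]; [exact: (hb [::])|exact: (hl [::])].
have [dg td] := tg; split=> [x|//|u]; first exact: (hb [::]).
have [->|u0] := eqVneq u 0.
  rewrite enorm0 mulr0 (_ : 'D_0 g = fun=> 0); first exact: smooth0.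
  by apply/funext => x; rewrite derive_gradient// dot0r.
have e0 : 0 < enorm u by rewrite lt_def enorm_eq0 u0 enorm_ge0.
pose v := (enorm u)^-1 *: u.
have v1 : enorm v = 1 by rewrite enormZ ger0_norm ?invr_ge0 ?enorm_ge0// mulVf ?gt_eqF.
have -> : 'D_u g = fun x => enorm u * 'D_v g x.
  by apply/funext => x; rewrite deriveZdir// mulrA mulfV ?mul1r ?gt_eqF.
rewrite mulrC -[X in X * N]ger0_norm ?enorm_ge0//; apply: smoothZ.
apply: IH => [|s x sl hs|s x y sl hs]; first exact: td.
  (* [foldr] applies the last entry first, so a further inner derivative [D_v] is appended at the
     end of the list. *)
  have := hb (rcons s v) x; rewrite size_rcons foldr_rcons; apply=> // z.
  by rewrite mem_rcons inE => /predU1P[->|/hs//]; rewrite v1.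
have := hl (rcons s v) x y; rewrite size_rcons sl !foldr_rcons; apply=> // z.
by rewrite mem_rcons inE => /predU1P[->|/hs//]; rewrite v1.
Qed.

Lemma holder_form_le l g s x : (size s <= l)%N -> (forall v, v \in s -> enorm v <= 1) ->
  (`|foldr (fun v h => 'D_v h) g s x|%:E <= holder_norm l rho g)%E.
Proof.
move=> sl hs; rewrite /holder_norm le_max; apply/orP; left.
have sl1 : (size s < l.+1)%N by [].
apply: le_trans (@le_bigmax _ _ _ _ _ (Ordinal sl1)) => /=.
apply: (@le_trans _ _ (multilinear_norm (derivative_form (j := size s) g x))); last first.
  by apply: ereal_sup_ubound; exists x.
apply: ereal_sup_ubound; exists (in_tuple s) => // i; apply: hs; exact: mem_tnth.
Qed.

Lemma holder_smooth l g : in_holder l rho g ->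
  exists2 N, holder_norm l rho g = N%:E & 0 <= N /\ smooth rho l N g.
Proof.
move=> [tg foo].
have h0 : (0 <= holder_norm l rho g)%E.
  by apply: le_trans (@holder_form_le l g [::] 0 _ _) => //; rewrite lee_fin.
have ff : holder_norm l rho g \is a fin_num by rewrite ge0_fin_numE.
exists (fine (holder_norm l rho g)); rewrite ?fineK//.
have N0 : 0 <= fine (holder_norm l rho g) by rewrite fine_ge0.
split=> //; apply: smooth_of_forms => // [s x sl hs|s x y sl hs].
  by rewrite -lee_fin fineK//; exact: holder_form_le.
have [->|xy] := eqVneq x y.
  by rewrite !subrr normr0 mulr_ge0 ?powR_ge0.
have e0 : 0 < enorm (x - y) `^ rho.
  by rewrite powR_gt0// lt_def enorm_eq0 subr_eq0 xy enorm_ge0.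
rewrite -ler_pdivrMr// -lee_fin fineK// /holder_norm le_max; apply/orP; right.
rewrite EFinM; move: (tg) => _; subst l.
apply: (@le_trans _ _ (multilinear_norm (fun u : (size s).-tuple 'rV[R]_d =>
    (derivative_form g x u - derivative_form g y u)%R) * ((enorm (x - y) `^ rho)^-1)%:E)%E); last first.
  by apply: ereal_sup_ubound; exists (x, y).
apply: lee_wpmul2r; first by rewrite lee_fin invr_ge0 ltW.
apply: ereal_sup_ubound; exists (in_tuple s) => // i; apply: hs; exact: mem_tnth.
Qed.
End holder_class.

(** * Reduction of the location model to a centred sample *)

Section location_sample.
Context {R : realType} {n d : nat} {dO : measure_display} {Omega : measurableType dO}.
Variables (V : potential R d) (M L m : R).
Hypotheses (M_gt0 : 0 < M) (m_gt0 : 0 < m).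
Hypothesis hV : assumption1 M L m V.
Variables (Pr : 'rV[R]_d -> probability Omega R) (X : 'I_n -> Omega -> 'rV[R]_d).
Hypothesis hX : iid_location_sample V Pr X.
Hypothesis n_gt0 : (0 < n)%N.
Variable rho : R.
Hypotheses (rho_gt0 : 0 < rho) (rho_le1 : rho <= 1).
Local Notation P := (gibbs V : probability 'rV[R]_d R).
Local Notation w := (gibbs_weight V).
Local Notation Q := (iid P n).
Let ww := weight_gibbs M_gt0 hV.
Let wn := weight_iid ww n.
Let tau (y : n.-tuple 'rV[R]_d) := mle V (tnth y).
Let mtau : measurable_fun setT tau. Proof. exact: (measurable_mle M_gt0 m_gt0 hV n_gt0). Qed.

Section fixed_parameter.
Variable theta : 'rV[R]_d.

Definition centered_sample (j : 'I_n) (o : Omega) : 'rV[R]_d := X j o - theta.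
Local Notation Y := centered_sample.

Lemma measurable_centered_sample j : measurable_fun setT (Y j).
Proof. by apply: measurable_rowB; [exact: iid_measurable hX j|exact: measurable_cst]. Qed.

Lemma centered_law j (B : set 'rV[R]_d) : measurable B -> Pr theta (Y j @^-1` B) = gibbs V B.
Proof.
move=> mB; pose B' := [set x : 'rV[R]_d | B (x - theta)].
have mB' : measurable B'.
  rewrite -[B']setTI; apply: (measurable_rowB (f := id) (g := fun=> theta)) => //.
rewrite -[Y j @^-1` B]/(X j @^-1` B') (iid_law hX theta j mB') /gibbs.
rewrite (integral_mkcond B') (integral_mkcond B).
pose h x := (((fun x => (expR (- V x))%:E) \_ B) x : \bar R).
have mh : measurable_fun setT h.
  apply/(measurable_restrict _ _ _) => //; apply: measurable_funTS.
  by apply/measurable_EFinP; exact: measurable_gibbs_density.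
have h0 x : (0 <= h x)%E by apply: erestrict_ge0 => y _; rewrite lee_fin expR_ge0.
rewrite -(ge0_integral_translate (- theta) mh h0); apply: eq_integral => x _.
by rewrite /h !patchE; congr (if _ then _ else _); rewrite !in_setE.
Qed.

Lemma centered_independent (B : 'I_n -> set 'rV[R]_d) : (forall j, measurable (B j)) ->
  Pr theta (\bigcap_(j in setT) (Y j @^-1` B j)) = (\prod_(j < n) gibbs V (B j))%E.
Proof.
move=> mB; pose B' j := [set x : 'rV[R]_d | B j (x - theta)].
have mB' j : measurable (B' j).
  rewrite -[B' j]setTI; apply: (measurable_rowB (f := id) (g := fun=> theta)) => //.
have := iid_independent hX theta mB'; rewrite -[X in Pr theta X = _]/(\bigcap_(j in setT) (Y j @^-1` B j)) => ->.
by apply: eq_bigr => j _; rewrite -[X j @^-1` B' j]/(Y j @^-1` B j) centered_law.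
Qed.

Lemma mle_estimator_sample o : mle_estimator V X o = theta + tau (sample Y o).
Proof.
rewrite /tau (_ : tnth (sample Y o) = fun j => X j o + (- theta)).
  by rewrite (mle_shift M_gt0 m_gt0 hV n_gt0) addrC subrK.
by apply/funext => j; rewrite /sample tnth_mktuple.
Qed.

Lemma mle_mean_shift l N (g : 'rV[R]_d -> R) : smooth rho l N g ->
  mle_mean V Pr X g theta = shift_mean Q tau g theta.
Proof.
move=> hg; have mg := moderate_shift rho_gt0 (wtuple w (n:=n)) mtau theta hg.
have := Ex_sample measurable_centered_sample centered_independent ww mg.
rewrite /shift_mean => <-; rewrite /mle_mean expectation.unlock /Ex /Rintegral.
by congr fine; apply: eq_integral => o _; rewrite mle_estimator_sample.
Qed.

Lemma Lnorm_rms l N (g : 'rV[R]_d -> R) (a : R) : smooth rho l N g ->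
  ('N[Pr theta]_(2%:E)[(fun o => (g (mle_estimator V X o) - a)%R%:E)]
  = (rms Q (fun y => (g (theta + tau y) - a)%R))%:E)%E.
Proof.
move=> hg; have mg := moderate_shift rho_gt0 (wtuple w (n:=n)) mtau theta hg.
have mG : moderate (wtuple w (n:=n)) (fun y => (g (theta + tau y) - a) ^+ 2).
  by apply: moderateX; apply: (moderateB wn) => //; exact: moderate_cst.
rewrite Lnorm.unlock.
have -> : (\int[Pr theta]_o `|(g (mle_estimator V X o) - a)%R%:E| `^ 2 =
    (Ex Q (fun y => (g (theta + tau y) - a) ^+ 2)%R)%:E)%E.
  rewrite /Ex /Rintegral fineK; last exact: integrable_fin_num (moderate_integrable wn mG).
  rewrite -(ge0_integral_sample measurable_centered_sample centered_independent).
  - apply: eq_integral => o _; rewrite mle_estimator_sample abse_EFin poweR_EFin powR_mulrn//.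
    by rewrite real_normK ?num_real.
  - by apply/measurable_EFinP; case: mG.
  - by move=> y; rewrite lee_fin sqr_ge0.
by rewrite poweR_EFin powR12_sqrt// Ex_ge0// => y; exact: sqr_ge0.
Qed.

End fixed_parameter.

(** Smoothness is carried along, with some norm, because it makes the iterated functions measurable
    and bounded, as the change of sample space requires. *)
Lemma smooth_bias_iter j l N (g : 'rV[R]_d -> R) : smooth rho l N g ->
  (exists N', smooth rho l N' (iter j (shift_bias Q tau) g)) /\
  iter j (mle_bias V Pr X) g = iter j (shift_bias Q tau) g.
Proof.
move=> hg; elim: j => [|j [[N' h'] IH]]; first by split=> //; exists N.
split.
  exists (N' + `|-1| * N').
  have := smoothD (shift_mean_smooth rho_gt0 rho_le1 wn mtau h') (smoothZ (-1) h').
  congr smooth; apply/funext => x; by rewrite mulN1r.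
by rewrite iterS IH; apply/funext => theta; rewrite /mle_bias (mle_mean_shift theta h').
Qed.

Lemma bias_reduced_neumann k l N (f : 'rV[R]_d -> R) : smooth rho l N f ->
  bias_reduced V Pr X k f = neumann Q tau k f.
Proof.
move=> hf; apply/funext => theta; apply: eq_bigr => j _.
by have [_ ->] := smooth_bias_iter j hf.
Qed.

End location_sample.

Lemma assumption1_le {R : realType} {d : nat} (M L m : R) (V : potential R d) :
  0 < M -> 0 < L -> assumption1 M L m V -> (0 < d)%N -> m <= M.
Proof.
move=> M0 L0 hV d0; pose u : 'rV[R]_d := delta_mx ord0 (Ordinal d0).
have u1 : enorm u = 1 by exact: enorm_delta.
have := fisher_dot_ge hV u; rewrite u1 expr1n mulr1 => /le_trans; apply.
apply: le_trans (dot_le _ _) _; rewrite u1 mulr1.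
by apply: le_trans (fisher_le M0 L0 hV u) _; rewrite u1 mulr1.
Qed.

Theorem corollary2p1 (R : realType) :
  exists2 c : R, 0 < c &
  forall (M L m : R) (k : nat) (rho : R),
    0 < M -> 0 < L -> 0 < m -> 0 < rho -> rho <= 1 ->
  let s : R := k%:R + 1 + rho in
  exists2 C : R, 0 < C &
  forall (n d : nat) (V : potential R d)
    (dO : measure_display) (Omega : measurableType dO)
    (Pr : 'rV[R]_d -> probability Omega R) (X : 'I_n -> Omega -> 'rV[R]_d)
    (f : 'rV[R]_d -> R),
  (0 < n)%N -> (0 < d)%N ->
  iid_location_sample V Pr X ->
  assumption1 M L m V ->
  d%:R <= c * Num.min (m / M) (m ^+ 2 / (L * Num.sqrt M)) ^+ 2 * n%:R ->
  in_holder k.+1 rho f ->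
  let fk := bias_reduced V Pr X k f in
  (ereal_sup [set `|'N[Pr theta]_(2%:E)
                      [(fun w => (fk (mle_estimator V X w) - f theta)%R%:E)]
                    - (asymptotic_std V f theta / Num.sqrt n%:R)%:E|
             | theta in [set: 'rV[R]_d]]
   <= C%:E * holder_norm k.+1 rho f
      * (sqrte (poincare V * (n%:R^-1)%:E) * ((d%:R / n%:R) `^ (rho / 2))%:E
         + (Num.sqrt (d%:R / n%:R) `^ s)%:E))%E.
Proof.
(* With [c = 1], the inequality [m <= M] makes the minimum at most 1, so the dimension condition
   gives [d <= n], that is [Delta <= 1]. *)
exists 1 => // M L m k rho M0 L0 m0 r0 r1 s.
(* This depends on [M], [L], [m], [rho] and [k] alone, as the order of quantifiers demands; the
   witness below majorises it and is visibly positive. *)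
pose K : R := error_const M L m rho k.
exists (`|K| + 1); first by rewrite ltr_wpDl.
move=> n d V dO Omega Pr X f n0 d0 hX hV dn hf; cbv zeta; set fk := bias_reduced V Pr X k f.
have nn : (0 : R) < n%:R by rewrite ltr0n.
have dd : (0 : R) < d%:R by rewrite ltr0n.
have dle : d%:R <= n%:R :> R.
  apply: le_trans dn _; rewrite mul1r ler_piMl ?(ltW nn)//.
  have q0 : 0 <= Num.min (m / M) (m ^+ 2 / (L * Num.sqrt M)).
    by rewrite le_min !divr_ge0 ?sqr_ge0 ?mulr_ge0 ?sqrtr_ge0 ?ltW.
  rewrite expr_le1// ge_min; apply/orP; left.
  by rewrite ler_pdivrMr// mul1r; exact: assumption1_le hV d0.
have [N hN [N0 sf]] := holder_smooth hf.
have fkE := bias_reduced_neumann M0 m0 hV hX n0 r0 r1 k sf.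
set D := Num.sqrt (d%:R / n%:R) : R.
have D0 : 0 <= D := sqrtr_ge0 _.
have dn0 : 0 < d%:R / n%:R :> R by rewrite divr_gt0.
have Dp : 0 < D by rewrite sqrtr_gt0.
have DrE : (d%:R / n%:R) `^ (rho / 2) = D `^ rho :> R.
  by rewrite [rho / 2]mulrC powRrM powR12_sqrt ?(ltW dn0).
have DsE : D `^ s = D ^+ k * (D * D `^ rho).
  have P a b : D `^ (a + b) = D `^ a * D `^ b by rewrite powRD// (gt_eqF Dp) implybT.
  by rewrite /s (P _ rho) (P _ 1) powR_mulrn// powRr1// mulrA.
have hk := smooth_neumann_mle M0 L0 m0 hV r0 r1 n0 d0 dle sf; rewrite -fkE -/fk in hk.
apply: ge_ereal_sup => _ [theta _ <-].
rewrite (Lnorm_rms M0 m0 hV hX n0 r0 theta (f theta) hk) -EFinB abse_EFin hN /fk fkE.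
have -> : asymptotic_std V f theta =
    Num.sqrt (dot (gradient f theta *m invmx (fisher V)) (gradient f theta)).
  by rewrite /asymptotic_std dotE.
(* Treated apart because a zero norm multiplied by an infinite Poincare constant is 0 in the
   extended reals. *)
have [N00|Nn] := eqVneq N 0.
  have [-> ->] := estimator_rms_error0 M0 L0 m0 hV r0 r1 n0 d0 dle theta sf N00.
  by rewrite sqrtr0 mul0r subrr normr0 N00 mule0 mul0e.
have Np : 0 < N by rewrite lt_def Nn N0.
have C0 : 0 < `|K| + 1 by rewrite ltr_wpDl.
(* With an infinite Poincare constant the right side is [+oo], since [N], [d] and [n] are
   positive. *)
have [poo|pfin] := eqVneq (poincare V) +oo%E.
  rewrite poo mulyr gtr0_sg ?invr_gt0// mul1e /= mulyr gtr0_sg ?powR_gt0// mul1e addye//.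
  by rewrite -EFinM mulry gtr0_sg ?mulr_gt0// mul1e leey.
have poo : (poincare V < +oo)%E by rewrite lt_neqAle pfin leey.
have [pE pge pb] := poincare_fin M0 m0 hV d0 poo.
have -> : (sqrte (poincare V * (n%:R^-1)%:E) = (Num.sqrt (fine (poincare V) / n%:R))%:E)%E by rewrite pE.
rewrite -(EFinM (`|K| + 1) N) -(EFinM (Num.sqrt _)) -EFinD -EFinM lee_fin DrE DsE.
apply: le_trans (estimator_rms_error M0 L0 m0 hV r0 r1 n0 d0 dle theta sf pb pge) _.
apply: ler_wpM2r; first by rewrite addr_ge0 ?mulr_ge0 ?sqrtr_ge0 ?powR_ge0 ?exprn_ge0.
apply: ler_wpM2r => //; apply: le_trans (ler_norm _) _; by rewrite lerDl.
Qed.
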